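(* There exist absolute constants $c,C>0$ such that for every $n\ge 2$ a uniformly random $P_n\in\mathcal{P}_n$ admits a factorization $P_n=\Phi I$, where $\Phi$ is a product of cyclotomic polynomials and $I\in\mathbb{Z}[x]$ is irreducible and noncyclotomic, with probability at least \[ 1-C\exp\!\left(-\frac{cn}{(\log n)^4}\right). \] Moreover, for every fixed $0<\alpha<1$ there exist constants $c_\alpha,C_\alpha>0$ such that for every $n\ge 1$, with probability at least $1-C_\alpha e^{-c_\alpha n^\alpha}$, a uniformly random $P_n\in\mathcal{P}_n$ admits such a factorization $P_n=\Phi I$ with $\deg\Phi\le n^\alpha$.
   Context: For $n\ge 1$, $\mathcal{P}_n=\left\{1+\sum_{j=1}^{n-1}p_jx^j+x^n : p_j\in\{0,1\}\right\}\subset\mathbb{Z}[x]$, a set of $2^{n-1}$ polynomials. A product of cyclotomic polynomials is a finite product of cyclotomic polynomials $\Phi_k$ ($k\ge1$), with repetitions allowed, and the empty product is $1$. Noncyclotomic means not equal to a cyclotomic polynomial. *)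

(* Defs.v *)
From mathcomp Require Import all_boot all_order all_algebra all_field.
From mathcomp Require Import finmap.
From mathcomp Require Import boolp reals.

Set Implicit Arguments.
Unset Strict Implicit.
Unset Printing Implicit Defensive.

Import Order.TTheory GRing.Theory Num.Theory.

Local Open Scope ring_scope.

(* The coefficient p_j, 1 <= j <= n - 1, is the value of p at j.-1 : 'I_n.-1. *)
Definition newman_poly (n : nat) (p : {ffun 'I_n.-1 -> bool}) : {poly int} :=
  1 + \sum_(j < n.-1) (p j)%:R *: 'X^(j.+1) + 'X^n.

Definition newman_polys (n : nat) : {fset {poly int}} :=
  [fset newman_poly p | p : {ffun 'I_n.-1 -> bool}]%fset.

Lemma card_newman_polys (n : nat) : (0 < n)%N ->
  #|` newman_polys n| = (2 ^ n.-1)%N.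
Proof.
move=> n_gt0; rewrite /newman_polys card_in_imfset /=; last first.
  move=> p q _ _ /addIr /addrI epq; apply/ffunP => i.
  have coefS (r : {ffun 'I_n.-1 -> bool}) :
      (\sum_(j < n.-1) (r j)%:R *: 'X^(j.+1) : {poly int})`_i.+1 = (r i)%:R.
    rewrite coef_sum (bigD1 i) //= coefZ coefXn eqxx mulr1 big1 ?addr0 //.
    move=> j ji; rewrite coefZ coefXn eqSS.
    by rewrite (negPf (_ : (i : nat) != j)) ?mulr0 // eq_sym.
  have := coefS p; rewrite epq coefS.
  by case: (p i) (q i) => [] [].
by rewrite -cardE card_ffun card_bool card_ord.
Qed.

Definition uniform_pr (R : realType) (T : choiceType) (A : {fset T})
    (E : T -> Prop) : R :=
  #|` [fset x in A | `[< E x >] ]%fset|%:R / #|` A|%:R.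

(* 'Phi_0 is 1 in the library, hence the condition 0 < k. *)
Definition is_cyclotomic (p : {poly int}) : Prop :=
  exists k : nat, (0 < k)%N /\ p = 'Phi_k.

Definition is_cyclotomic_product (p : {poly int}) : Prop :=
  exists s : seq nat, all (fun k => 0 < k)%N s /\ p = \prod_(k <- s) 'Phi_k.

(* Irreducible element of a domain. For {poly int} this is irreducibility in
   Z[x], where the units are 1 and -1; the library's irreducible_poly is based
   on pseudo-division and does not see constant factors. *)
Definition irreducible_elt (D : idomainType) (x : D) : Prop :=
  [/\ x != 0, x \isn't a GRing.unit &
      forall y z : D, x = y * z -> y \is a GRing.unit \/ z \is a GRing.unit].

Definition good_factorization (P Phi I : {poly int}) : Prop :=
  [/\ P = Phi * I, is_cyclotomic_product Phi,
      irreducible_elt I & ~ is_cyclotomic I].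

(* Main.v *)
(* Let P be the random polynomial of degree n, different from its reversal P*,
   and write P = Phi I with Phi the maximal cyclotomic part. Suppose that I = A B.

   If P and P* have only roots of unity in common, no factor of I is
   self-reciprocal up to sign, and Ljunggren's flip turns P = A B into a second
   0-1 polynomial Q = A B* such that Q Q* = P P*. With A fixed modulo 2, comparing
   the coefficients of Q Q* and P P* degree by degree gives a linear number of
   nearly independent constraints on B modulo 2, so such P are exponentially rare.

   If P and P* share a root a that is not a root of unity, Dobrowolski's
   determinant bounds the Mahler measure of a from below, and Landau's inequality
   then yields a prime q = O((log n)^4) such that a^q is a root of no polynomial
   of degree at most n with coefficients -1, 0, 1. Fix P - P*, of which a is a
   root. Exposing P outside the pairs {j, n - j} with 2 j = n modulo q then
   determines P, since two candidates differ by X^c W(X^q). Each of the about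
   n / (2 q) pairs loses a factor 3/4, whence exp(- c n / (log n)^4).

   Finally, modulo 2 a given monic divisor of degree D has at most 2^(n - D)
   multiples among the P, and there are at most n^O(1) (3/2)^D products of
   cyclotomic polynomials of degree D; this bounds the degree of Phi. *)
Require Import Defs.
From mathcomp Require Import all_boot all_order all_algebra all_field.
From mathcomp Require Import finmap.
From mathcomp Require Import boolp reals sequences exp.
From mathcomp Require Import perm ring lra zify.

Set Implicit Arguments.
Unset Strict Implicit.
Unset Printing Implicit Defensive.

Import Order.TTheory GRing.Theory Num.Theory.

(** * Chebyshev's lower bound for the number of primes *)

(** The integer factors of a 0-1 polynomial may have large coefficients, so factorizations in Z[x]
    cannot simply be counted. But a 0-1 polynomial is recovered from its reduction modulo 2, and
    over the field with two elements there are only [2 ^ (a - 1) * 2 ^ (b - 1)] products of degrees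
    [a + b = n] whose factors have end coefficients 1: fewer than the polynomials [P] themselves.
    Hence an exponentially small proportion of colliding pairs is enough, and the union over [a] and
    over the first asymmetry of the smaller factor costs only [n ^ 2].

    The size of [q] comes from two opposite bounds. If the power map is injective on the conjugates
    of [a], then [a ^ q] has Mahler measure [M ^ q], [M] being that of [a], whereas a nonzero
    polynomial of degree at most [n] with coefficients -1, 0, 1 has Mahler measure at most
    [sqrt (n + 1)]. So [q] has to exceed a multiple of [log n / log M]. The lower bound on [log M]
    is of order [(log log n / log n) ^ 3], which leaves room for a prime [q] below a multiple of
    [(log n) ^ 4], even after discarding the few primes whose power map is not injective. *)

Definition primes_upto (x : nat) : seq nat := [seq p <- iota 0 x.+1 | prime p].

Lemma mem_primes_upto x p : (p \in primes_upto x) = prime p && (p <= x).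
Proof. by rewrite mem_filter mem_iota. Qed.

Lemma uniq_primes_upto x : uniq (primes_upto x).
Proof. by rewrite filter_uniq ?iota_uniq. Qed.

Lemma central_bin_ge m : 2 ^ m <= 'C(m.*2, m).
Proof.
rewrite -[2]/(1 + 1) expnDn -addnn -binomial.Vandermonde leq_sum // => i _.
by rewrite !exp1n !muln1 leq_pmulr // bin_gt0 leq_subr.
Qed.

(** By Legendre's formula the exponent is the sum over [k] of [2m %/ p ^ k - 2 * (m %/ p ^ k)]. Each
    term is 0 or 1, and only the [k] with [p ^ k <= 2m] contribute. *)
Lemma logn_central_bin p m : prime p -> 0 < m ->
  p ^ logn p 'C(m.*2, m) <= m.*2.
Proof.
move=> pp m0; have p1 := prime_gt1 pp.
have b0 : 0 < 'C(m.*2, m) by rewrite bin_gt0 -addnn leq_addr.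
have E : logn p 'C(m.*2, m) + (logn p m`!).*2 = logn p (m.*2)`!.
  rewrite -(@bin_fact m.*2 m) -?addnn ?leq_addr // addnK !lognM ?muln_gt0 ?fact_gt0 //.
  by rewrite addnn.
set T := trunc_log p m.*2.
have T2m : p ^ T <= m.*2 by rewrite trunc_logP ?double_gt0.
apply: leq_trans (T2m); rewrite leq_exp2l //.
have : logn p (m.*2)`! <= T + (logn p m`!).*2.
  have -> : logn p m`! = \sum_(1 <= k < m.*2.+1) m %/ p ^ k.
    rewrite logn_fact // [RHS](big_cat_nat (n := m.+1)) ?ltnS -?addnn ?leq_addr //=.
    rewrite -[LHS]addn0; congr (_ + _); apply/esym.
    rewrite big_nat_cond big1 // => k /andP[/andP[mk _] _].
    by apply: divn_small; apply: leq_trans (ltn_expl k p1); rewrite ltnW.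
  rewrite logn_fact // -[X in _ <= _ + X]mul2n big_distrr /=.
  apply: leq_trans (_ : \sum_(1 <= k < m.*2.+1) ((k <= T) + 2 * (m %/ p ^ k)) <= _).
    rewrite big_nat_cond [X in _ <= X]big_nat_cond leq_sum // => k _.
    have pk0 : 0 < p ^ k by rewrite expn_gt0 prime_gt0.
    case: (leqP k T) => kT.
      rewrite add1n -ltnS ltn_divLR // -muln2; have := ltn_ceil m pk0; nia.
    rewrite divn_small //; apply: leq_trans (trunc_log_ltn _ p1) _.
    by rewrite leq_exp2l.
  rewrite big_split /= leq_add2r.
  have T2 : T <= m.*2 by apply: leq_trans T2m; apply: ltnW; apply: ltn_expl.
  rewrite (big_cat_nat (n := T.+1)) ?ltnS //= [X in _ + X]big_nat_cond.
  rewrite [X in _ + X]big1 ?addn0; last first.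
    by move=> k /andP[/andP[Tk _] _]; rewrite leqNgt Tk.
  apply: leq_trans (_ : \sum_(1 <= k < T.+1) 1 <= _).
    by apply: leq_sum => k _; case: (k <= T).
  by rewrite sum_nat_const_nat muln1 subn1.
by move: E; lia.
Qed.

(** The central binomial coefficient is a product of prime powers, one for each of at most
    [size (primes_upto m.*2)] primes, and each of them is at most [2m]. *)
Lemma primes_upto_lower m : 0 < m -> 2 ^ m <= m.*2 ^ size (primes_upto m.*2).
Proof.
move=> m0; apply: leq_trans (central_bin_ge m) _.
have b0 : 0 < 'C(m.*2, m) by rewrite bin_gt0 -addnn leq_addr.
rewrite {1}(prod_prime_decomp b0) prime_decompE big_map /=.
apply: leq_trans (_ : \prod_(p <- primes 'C(m.*2, m)) m.*2 <= _).
  rewrite big_seq [X in _ <= X]big_seq leq_prod // => p.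
  by rewrite mem_primes => /andP[pp _]; apply: logn_central_bin.
rewrite big_const_seq count_predT iter_muln_1 leq_pexp2l ?double_gt0 //.
apply: uniq_leq_size (primes_uniq _) _ => p.
rewrite mem_primes mem_primes_upto => /and3P[pp _ pb]; rewrite pp /=.
have : p %| (m.*2)`!.
  have mm : m <= m.*2 by rewrite -addnn leq_addr.
  by rewrite -(bin_fact mm); apply: dvdn_mulr.
elim: (m.*2) => [|k IHk].
  by rewrite dvdn1 => /eqP p1; rewrite p1 in pp.
rewrite factS Euclid_dvdM // => /orP[/dvdn_leq ->|/IHk h] //.
exact: leq_trans h (leqnSn _).
Qed.

Local Open Scope ring_scope.

(** * Conjugates of an algebraic integer *)

(* The last clause encodes the irreducibility of [f] over the rationals: the
   roots [rs] are a full set of conjugates. *)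
Definition conj_roots (f : {poly int}) (rs : seq algC) : Prop :=
  [/\ f \is monic, uniq rs,
      map_poly intr f = \prod_(r <- rs) ('X - r%:P) &
      forall (g : {poly rat}) (r r' : algC), r \in rs -> r' \in rs ->
        root (map_poly ratr g) r -> root (map_poly ratr g) r'].

Lemma map_poly_ratr_int (S : numFieldType) (f : {poly int}) :
  map_poly (ratr : rat -> S) (map_poly intr f) = map_poly intr f.
Proof. by apply/polyP => i; rewrite !coef_map /= ratr_int. Qed.

Lemma conj_rootsP (x : algC) : x \in Aint ->
  exists f rs, conj_roots f rs /\ x \in rs.
Proof.
move=> Ax; have [p [Dp mon_p] dvp] := minCpolyP x.
have [f Df] := floorpP Ax.
have [rs] := closed_field_poly_normal (minCpoly x).
rewrite (monicP (minCpoly_monic x)) scale1r => Drs.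
have px0 : root (map_poly (ratr : rat -> algC) p) x by rewrite -Dp root_minCpoly.
have irr_p : irreducible_poly p.
  apply/(subfx_irreducibleP px0 (monic_neq0 mon_p)) => q qx0 nzq.
  by rewrite dvdp_leq // -dvp.
have cop g : ~~ (p %| g) -> coprimep p g.
  move=> ndv; apply/coprimepP => d dp dg.
  case: (eqVneq (size d) 1%N) => [/eqP|sd]; first by rewrite -size_poly_eq1.
  by case/negP: ndv; rewrite -(eqp_dvdl _ (irr_p.2 _ sd dp)).
exists f, rs; split; last by rewrite -root_prod_XsubC -Drs root_minCpoly.
split=> //; last 2 first.
- by rewrite -Drs Df; apply: eq_map_poly.
- move=> g r r' r_rs r'_rs gr.
  have pr t : t \in rs -> root (map_poly (ratr : rat -> algC) p) t.
    by move=> t_rs; rewrite -Dp Drs root_prod_XsubC.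
  case: (boolP (p %| g)) => [pg|/cop].
    by move: (pr _ r'_rs); apply: root_dvdp; rewrite dvdp_map.
  rewrite -(coprimep_map (ratr : {rmorphism rat -> algC})) => /coprimep_root /(_ (pr _ r_rs)).
  by rewrite -rootE gr.
- have: map_poly (intr : int -> algC) f \is monic.
    by rewrite -[map_poly _ _]Df minCpoly_monic.
  rewrite !monicE lead_coef_map_inj ?rmorph0 //; last exact: intr_inj.
  by rewrite -[1]/(1%:~R) eqr_int.
(* Separability in characteristic 0: the derivative is nonzero and of smaller degree, hence coprime
   to the irreducible [p]. *)
- rewrite -separable_prod_XsubC -Drs Dp separable_poly.unlock deriv_map coprimep_map.
  apply: cop; apply/negP => /dvdp_leq; have sp := irr_p.1.
  have dp0 : p^`() != 0.
    apply/eqP => /polyP /(_ (size p).-2); rewrite coef_deriv coef0.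
    have -> : (size p).-2.+1 = (size p).-1 by case: (size p) sp => [|[]].
    move/eqP; rewrite -lead_coefE (monicP mon_p) mulrn_eq0 oner_eq0 orbF.
    by case: (size p) sp => [|[]].
  by move/(_ dp0); rewrite leqNgt lt_size_deriv ?monic_neq0.
Qed.

Lemma size_conj_roots f rs : conj_roots f rs -> size f = (size rs).+1.
Proof.
case=> _ _ E _; rewrite -(size_prod_XsubC _ id) -E size_map_inj_poly ?rmorph0 //.
exact: intr_inj.
Qed.

(** Integrality comes from the companion matrix of [f]: the Vandermonde matrix of the distinct roots
    diagonalizes it, so its [m]-th power, an integer matrix, has the [m]-th powers of the roots as
    eigenvalues with multiplicity. *)
Lemma conj_roots_pow f rs m : conj_roots f rs ->
  exists g : {poly int},
    map_poly intr g = \prod_(r <- rs) ('X - (r ^+ m)%:P) :> {poly algC}.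
Proof.
move=> cr; have sf := size_conj_roots cr; case: cr => mon_f uniq_rs Drs _.
pose d := (size f).-1.
pose C := companionmx f : 'M[int]_d.
pose CC := map_mx (intr : int -> algC) C.
pose a : 'rV[algC]_d := \row_j rs`_j.
pose V : 'M[algC]_d := Vandermonde d a.
have sd : d = size rs by rewrite /d sf.
have CV : CC *m V = V *m diag_mx a.
  apply/matrixP => i j; rewrite mul_mx_diag !mxE.
  set r := rs`_j.
  have r_rs : r \in rs by rewrite mem_nth // -sd.
  transitivity (r ^+ i.+1); last by rewrite exprSr.
  have rf : \sum_(k < d) (f`_k)%:~R * r ^+ k + r ^+ d = 0 :> algC.
    have : root (map_poly (intr : int -> algC) f) r.
      by rewrite Drs root_prod_XsubC.
    rewrite /root (@horner_coef_wide _ d.+1); last first.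
      by rewrite (leq_trans (size_poly _ _)) // sf sd.
    rewrite big_ord_recr /= => /eqP E; rewrite -[RHS]E coef_map /=.
    have -> : f`_d = 1 by rewrite -(monicP mon_f).
    by rewrite mul1r; congr (_ + _); apply: eq_bigr => k _; rewrite coef_map.
  under eq_bigr => k _ do rewrite !mxE.
  case: (eqVneq (i : nat) d.-1) => [id|id].
    have -> : i.+1 = d by rewrite id prednK // (leq_ltn_trans _ (ltn_ord i)).
    rewrite -[RHS](addKr (\sum_(k < d) (f`_k)%:~R * r ^+ k)) rf addr0 -sumrN.
    by apply: eq_bigr => k _; rewrite rmorphN mulNr.
  have id1 : (i.+1 < d)%N.
    by have := ltn_ord i; rewrite leq_eqVlt => /orP[/eqP /(congr1 predn) /= E|//]; rewrite E eqxx in id.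
  rewrite (bigD1 (Ordinal id1)) //= eqxx mul1r big1 ?addr0 //.
  move=> k nk; rewrite [_ == _ :> nat]eq_sym.
  by rewrite (negPf (nk : (k : nat) != i.+1)) mul0r.
have CmV : CC ^+ m *m V = V *m diag_mx (map_mx (fun x => x ^+ m) a).
  elim: (m) => [|k IHk].
    rewrite expr0 mul1mx (_ : map_mx _ _ = const_mx 1) ?diag_const_mx ?mulmx1 //.
    by apply/matrixP => i j; rewrite !mxE expr0.
  rewrite exprS -mulmxA IHk mulmxA CV -mulmxA; congr (_ *m _).
  rewrite mulmx_diag; congr diag_mx.
  by apply/matrixP => i j; rewrite !mxE exprS.
have detV : \det V != 0.
  rewrite det_Vandermonde; apply/prodf_neq0 => i _; apply/prodf_neq0 => j ij.
  by rewrite !mxE subr_eq0 nth_uniq -?sd // neq_ltn ij orbT.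
exists (char_poly (C ^+ m)).
have -> : map_poly intr (char_poly (C ^+ m)) = char_poly (CC ^+ m).
  rewrite map_char_poly; congr char_poly.
  by elim: (m) => [|k IHk]; rewrite ?expr0 ?map_mx1 // !exprS map_mxM IHk.
(* Similarity without inverting [V]: the two characteristic matrices are intertwined by [V], whose
   determinant is nonzero and cancels. *)
have -> : char_poly (CC ^+ m) = char_poly (diag_mx (map_mx (fun x => x ^+ m) a)).
  have detVp : \det (map_mx polyC V) != 0.
    by rewrite (det_map_mx (polyC : {rmorphism algC -> {poly algC}})) polyC_eq0.
  apply: (mulfI detVp); rewrite -[RHS]det_mulmx mulrC -[LHS]det_mulmx; congr (\det _).
  rewrite /char_poly_mx mulmxBl mulmxBr -!map_mxM /= CmV.
  by rewrite scalar_mxC.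
rewrite char_poly_trig ?diag_mx_is_trig //.
rewrite (big_nth 0) -sd big_mkord; apply: eq_bigr => i _.
by rewrite !mxE eqxx.
Qed.

(** Characteristic 0: if [G = H * (X - u) ^ (k + 1)] with [H(u)] nonzero, then the cofactor of
    [(X - u) ^ k] in [G'] takes the value [(k + 1) * H(u)] at [u]. *)
Lemma mup_deriv (F : numFieldType) (G : {poly F}) (u : F) :
  G != 0 -> root G u -> G^`() != 0 /\ mup u G = (mup u G^`()).+1.
Proof.
move=> G0 Gu; have [k [H]] := multiplicity_XsubC G u.
rewrite G0 /= => Hu DG.
case: k DG => [|k] DG; first by rewrite DG expr0 mulr1 (negPf Hu) in Gu.
have H0 : H != 0 by apply: contraNneq Hu => ->; rewrite root0.
pose K := H^`() * ('X - u%:P) + H *+ k.+1.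
have Ku : ~~ root K u.
  rewrite /root !hornerE subrr mulr0 add0r hornerMn mulrn_eq0 negb_or /=.
  by rewrite -rootE.
have DG' : G^`() = ('X - u%:P) ^+ k * K.
  by rewrite DG derivM deriv_exp derivXsubC mul1r /K -mulr_natr -[H *+ _]mulr_natr exprS; ring.
rewrite DG' mupMl // mup_XsubCX eqxx DG mupMr // mup_XsubCX eqxx; split=> //.
rewrite mulf_neq0 ?expf_neq0 ?polyXsubC_eq0 //.
by apply: contraNneq Ku => ->; rewrite root0.
Qed.

Lemma mup_derivn_geq (F : numFieldType) (G : {poly F}) (u : F) k :
  G != 0 -> (forall s, (s < k)%N -> root G^`(s) u) -> (k <= mup u G)%N.
Proof.
elim: k G => [|k IHk] G G0 Gs //.
have [G'0 ->] := mup_deriv G0 (Gs 0%N isT).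
by apply: IHk => // s sk; rewrite -derivSn Gs.
Qed.

Lemma root_comp_Xn (p : {poly int}) (x : algC) m :
  root (map_poly (ratr : rat -> algC) (map_poly intr p \Po 'X^m)) x =
  root (map_poly intr p) (x ^+ m).
Proof.
by rewrite map_comp_poly map_polyXn map_poly_ratr_int /root horner_comp hornerXn.
Qed.

(** The power sum is minus the subleading coefficient of the integer polynomial whose roots are the
    [m]-th powers. *)
Lemma conj_roots_power_sum f rs m : conj_roots f rs ->
  \sum_(r <- rs) r ^+ m \is a Num.int.
Proof.
move=> /(conj_roots_pow m)[g Dg]; case: (eqVneq (size rs) 0%N) => [/size0nil->|s0].
  by rewrite big_nil rpred0.
have := coefPn_prod_XsubC (ps := [seq r ^+ m | r <- rs]).
rewrite size_map => /(_ s0); rewrite !big_map -Dg coef_map => /eqP.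
by rewrite -eqr_oppLR => /eqP <-; rewrite rpredN intr_int.
Qed.

(** Conjugates have the same rational polynomials vanishing at them, also after composition with
    [X ^ m]; multiplicities follow by passing to derivatives, which are again rational. *)
Lemma conj_roots_mup (g : {poly rat}) f rs r r' m : conj_roots f rs ->
  r \in rs -> r' \in rs -> g != 0 ->
  mup (r ^+ m) (map_poly ratr g) = mup (r' ^+ m) (map_poly ratr g).
Proof.
case=> _ _ _ cj r_rs r'_rs.
have {}cj (h : {poly rat}) : root (map_poly ratr h) (r ^+ m) = root (map_poly ratr h) (r' ^+ m).
  have E (x : algC) : root (map_poly ratr h) (x ^+ m) = root (map_poly ratr (h \Po 'X^m)) x.
    by rewrite map_comp_poly map_polyXn /root horner_comp hornerXn.
  by rewrite !E; apply/idP/idP; apply: cj.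
elim: {g}(size g) {-2}g (leqnn (size g)) => [|n IHn] g sg g0.
  by rewrite size_poly_leq0 (negPf g0) in sg.
case: (boolP (root (map_poly ratr g) (r ^+ m))) => gr; last first.
  by rewrite !mupNroot // -cj.
have g0' : map_poly (ratr : rat -> algC) g != 0 by rewrite map_poly_eq0.
have [g'0 ->] := mup_deriv g0' gr.
rewrite cj in gr; have [_ ->] := mup_deriv g0' gr.
rewrite deriv_map map_poly_eq0 in g'0 *.
by congr _.+1; apply: IHn => //; rewrite -ltnS (leq_trans (lt_size_deriv g0)).
Qed.

(** The size of a fibre of the power map is the multiplicity of its value as a root of the integer
    polynomial of the [m]-th powers. *)
Lemma conj_roots_class f rs r r' m : conj_roots f rs ->
  r \in rs -> r' \in rs ->
  count (fun s => s ^+ m == r ^+ m) rs = count (fun s => s ^+ m == r' ^+ m) rs.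
Proof.
move=> cr r_rs r'_rs; have [g Dg] := conj_roots_pow m cr.
have E x : count (fun s => s ^+ m == x) rs = mup x (map_poly (ratr : rat -> algC) (map_poly intr g)).
  rewrite map_poly_ratr_int Dg -(big_map (fun r => r ^+ m) predT (fun x => 'X - x%:P)).
  by rewrite mu_prod_XsubC count_map; apply: eq_count => s /=; rewrite eq_sym.
rewrite !E; apply: (conj_roots_mup _ cr) => //.
rewrite -(map_poly_eq0 (ratr : {rmorphism rat -> algC})) map_poly_ratr_int Dg.
by rewrite monic_neq0 // monic_prod_XsubC.
Qed.

(* All fibres of [r |-> r ^ M] on conjugates have the same size, and multiplying
   [M] by a new prime [p] with [a ^ p = b ^ p] at least doubles it. *)
Lemma conj_roots_noninjective_primes f rs (ps : seq nat) : conj_roots f rs ->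
  0 \notin rs -> (0 < size rs)%N -> uniq ps -> all prime ps ->
  (forall p, p \in ps ->
    exists r r', [/\ r \in rs, r' \in rs, r != r' & r ^+ p = r' ^+ p]) ->
  (2 ^ size ps <= size rs)%N.
Proof.
move=> cr rs0 srs ups aps bad.
pose M (l : seq nat) := (\prod_(p <- l) p)%N.
suff H r : r \in rs -> (2 ^ size ps <= count (fun s => s ^+ M ps == r ^+ M ps) rs)%N.
  case: (rs) srs H => // r t _ H; apply: leq_trans (H r _) (count_size _ _).
  exact: mem_head.
elim: ps ups aps bad r => [|p ps IHps] /= => [_ _ _|/andP[pps ups] /andP[pp aps] bad] r r_rs.
  by rewrite expn0 /M big_nil -has_count; apply/hasP; exists r.
have [|a [b [a_rs b_rs ab eab]]] := bad p; first by rewrite mem_head.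
have {}IHps := IHps ups aps (fun q qps => bad q (@mem_behead _ (p :: ps) q qps)).
rewrite (conj_roots_class _ cr r_rs a_rs) expnS mul2n -addnn.
have cop : coprime p (M ps).
  rewrite /M; elim: (ps) pps aps => [|q l IHl]; first by rewrite big_nil coprimen1.
  rewrite inE negb_or big_cons coprimeMr => /andP[pq pl] /= /andP[qq al].
  by rewrite IHl // andbT prime_coprime // dvdn_prime2.
have nz x : x \in rs -> x != 0 by move=> ?; apply: contraNneq rs0 => <-.
(* If the [p]-th powers and the [M ps]-th powers both agreed, Bezout would give [a / b = 1]. So one
   fibre of the new power map contains two disjoint fibres of the old one. *)
have nab : a ^+ M ps != b ^+ M ps.
  apply: contra ab => /eqP eM.
  have M0 : (0 < M ps)%N.
    by rewrite /M big_seq; apply: prodn_cond_gt0 => q /(allP aps) /prime_gt0.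
  have c1 k : a ^+ k = b ^+ k -> (a / b) ^+ k = 1.
    by move=> e; rewrite expr_div_n e divff // expf_neq0 // nz.
  have [u v Euv _] := egcdnP p M0.
  have : (a / b) ^+ (u * M ps) = 1 by rewrite mulnC exprM c1 // expr1n.
  rewrite Euv (eqP (_ : gcdn (M ps) p == 1%N)) 1?gcdnC //.
  rewrite addn1 exprS [(v * p)%N]mulnC [in _ ^+ (p * v)]exprM c1 // expr1n mulr1.
  by move/(canRL (divfK (nz _ b_rs))); rewrite mul1r => ->.
apply: leq_trans (leq_add (IHps a a_rs) (IHps b b_rs)) _.
rewrite -count_predUI.
rewrite [X in (_ + X)%N](_ : _ = 0%N) ?addn0; last first.
  apply/eqP; rewrite -leqn0 leqNgt -has_count; apply/hasP => -[s _ /=].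
  by case/andP => /eqP -> ; apply/negP.
apply: sub_count => s /=; rewrite /M big_cons -/(M ps) [(p * _)%N]mulnC !exprM.
case/orP => /eqP -> //.
by rewrite -!exprM ![(M ps * _)%N]mulnC !exprM eab.
Qed.

(** By conjugation every [s] in [rs] satisfies [s ^ p = phi s ^ q] for some [phi s] in [rs].
    Iterating [phi] until it loops yields a [t] with [t ^ (p ^ i) = t ^ (q ^ i)] for some positive
    [i]; so [t] is a root of unity, and with it all its conjugates. *)
Lemma conj_roots_cross f rs p q r r' : conj_roots f rs ->
  0 \notin rs -> r \in rs -> r' \in rs -> r ^+ p = r' ^+ q -> p != q ->
  exists2 m, (0 < m)%N & r ^+ m = 1.
Proof.
move=> cr rs0 r_rs r'_rs e pq.
have nz x : x \in rs -> x != 0 by move=> ?; apply: contraNneq rs0 => <-.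
case: (cr) => _ _ _ cj.
have step s : s \in rs -> {t | t \in rs & s ^+ p = t ^+ q}.
  move=> s_rs; apply/sig2_eqW.
  have [g Dg] := conj_roots_pow q cr.
  have gE x : root (map_poly (ratr : rat -> algC) (map_poly intr g \Po 'X^p)) x =
     (x ^+ p \in [seq t ^+ q | t <- rs]).
    rewrite root_comp_Xn Dg -(big_map (fun r => r ^+ q) predT (fun x => 'X - x%:P)).
    by rewrite root_prod_XsubC.
  have : s ^+ p \in [seq t ^+ q | t <- rs].
    by rewrite -gE; apply: (cj _ r) => //; rewrite gE e; apply: map_f.
  by case/mapP => t; exists t.
pose T := seq_sub rs.
pose phi (s : T) : T := let: exist2 t tr _ := step (ssval s) (ssvalP s) in SeqSub tr.
have phiE (s : T) : ssval s ^+ p = ssval (phi s) ^+ q.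
  by rewrite /phi; case: (step _ _).
have iterE m (s : T) : ssval s ^+ (p ^ m) = ssval (iter m phi s) ^+ (q ^ m).
  elim: m => [|m IHm]; first by rewrite !expn0.
  by rewrite iterS !expnSr exprM IHm -exprM mulnC exprM phiE -exprM mulnC.
pose x0 : T := SeqSub r_rs.
have /trajectP[i io ei] := looping_order phi x0.
set j := order phi x0 in io ei.
set t := iter i phi x0 in ei.
have t_rs : ssval t \in rs by exact: ssvalP.
have tt : ssval t ^+ (p ^ (j - i)) = ssval t ^+ (q ^ (j - i)).
  by rewrite iterE /t -iterD subnK ?ei // ltnW.
have pq' : (p ^ (j - i) != q ^ (j - i))%N.
  by rewrite eqn_exp2r // subn_gt0.
have tm u v : (u < v)%N -> ssval t ^+ u = ssval t ^+ v -> ssval t ^+ (v - u) = 1.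
  move=> uv euv; apply: (mulIf (expf_neq0 u (nz _ t_rs))).
  by rewrite -exprD subnK ?mul1r // ltnW.
have [m m0 em] : exists2 m, (0 < m)%N & ssval t ^+ m = 1.
  case: (ltngtP (p ^ (j - i)) (q ^ (j - i))) pq' => // uv _.
    by exists (q ^ (j - i) - p ^ (j - i))%N; rewrite ?subn_gt0 ?tm.
  by exists (p ^ (j - i) - q ^ (j - i))%N; rewrite ?subn_gt0 ?tm.
exists m => //.
have E (x : algC) : root (map_poly (ratr : rat -> algC) ('X^m - 1)) x = (x ^+ m == 1).
  by rewrite rmorphB /= map_polyXn rmorph1 /root !hornerE subr_eq0.
by apply/eqP; rewrite -E; apply: (cj _ (ssval t)) => //; rewrite E em.
Qed.

(** * Mahler measure *)

Definition max1 (r : algC) : algC := if 1 < `|r| then `|r| else 1.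

Definition mahler (rs : seq algC) : algC := \prod_(r <- rs) max1 r.

Lemma max1_ge1 r : 1 <= max1 r.
Proof. by rewrite /max1; case: ifP => // /ltW. Qed.

Lemma max1_ge_norm r : `|r| <= max1 r.
Proof.
rewrite /max1; case: ifP => // /negbT.
by rewrite -real_leNgt ?rpred1 ?normr_real.
Qed.

Lemma max1_ge0 r : 0 <= max1 r.
Proof. exact: le_trans ler01 (max1_ge1 r). Qed.

Lemma max1X r m : max1 (r ^+ m) = max1 r ^+ m.
Proof.
rewrite /max1 normrX; case: m => [|m]; first by rewrite !expr0 ltxx.
case: (real_ltP (rpred1 _) (normr_real r)) => h; first by rewrite exprn_egt1.
by rewrite expr1n ifF //; apply: le_gtF; apply: exprn_ile1.
Qed.

Lemma mahler_ge1 rs : 1 <= mahler rs.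
Proof.
apply: (big_ind (fun x => 1 <= x)) => // [x y|r _]; last exact: max1_ge1.
exact: mulr_ege1.
Qed.

Definition norm2 (N : nat) (P : {poly algC}) : algC := \sum_(i < N) `|P`_i| ^+ 2.

(* Landau's trick: replacing a root [w] by [1 / w^*] keeps the L2 norm, up to
   the normalization. *)
Lemma norm2_flip (w : algC) (U : {poly algC}) N : (size U < N)%N ->
  norm2 N (('X - w%:P) * U) = norm2 N ((1 - w^* *: 'X) * U).
Proof.
case: N => // N; rewrite ltnS => sU; apply/eqP; rewrite -subr_eq0 /norm2 -sumrB.
pose f i := if i is j.+1 then `|U`_j| ^+ 2 else 0.
rewrite (eq_bigr (fun i : 'I_N.+1 => (`|w| ^+ 2 - 1) * (f i.+1 - f i))); last first.
  move=> i _; rewrite mulrBl mulrBl mul1r -scalerAl !coefB coefCM coefZ !coefXM.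
  rewrite !normCK !rmorphB !rmorphM /= ?conjCK.
  by case: i => -[|i] /= _; rewrite ?rmorph0 ?normCK ?conjCK /=; ring.
rewrite -mulr_sumr -(big_mkord predT (fun i => f i.+1 - f i)) telescope_sumr //=.
by rewrite nth_default // normr0 expr0n subrr mulr0.
Qed.

(** Once every root outside the unit disc is flipped, the leading coefficient has modulus exactly
    [|c| * mahler ws], and its square is one term of the unchanged L2 norm. *)
Lemma landau (c : algC) (ws : seq algC) :
  (`|c| * mahler ws) ^+ 2 <=
  norm2 (size ws).+1 (c *: \prod_(w <- ws) ('X - w%:P)).
Proof.
pose flip w : {poly algC} := if 1 < `|w| then 1 - w^* *: 'X else 'X - w%:P.
have szf w : size (flip w) = 2.
  rewrite /flip; case: ifP => [w1|_]; last by rewrite size_XsubC.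
  have w0 : - w^* != 0.
    by rewrite oppr_eq0 conjC_eq0 -normr_gt0 (lt_trans ltr01).
  by rewrite addrC -scaleNr size_addl size_scale // ?size_polyX // size_poly1.
have lcf w : `|lead_coef (flip w)| = max1 w.
  rewrite lead_coefE szf /flip /max1; case: ifP => _.
    by rewrite coefB coefZ coefX coef1 mulr1 sub0r normrN norm_conjC.
  by rewrite coefB coefX coefC subr0 normr1.
have f0 w : flip w != 0 by rewrite -size_poly_gt0 szf.
have szp : size (\prod_(w <- ws) flip w) = (size ws).+1.
  elim: (ws) => [|w l IHl]; first by rewrite big_nil size_poly1.
  by rewrite big_cons size_mul ?prodf_seq_neq0 ?IHl ?szf //; apply/allP => ? _ /=; rewrite f0.
have key (U : {poly algC}) N : (size U + size ws <= N)%N ->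
    norm2 N (\prod_(w <- ws) ('X - w%:P) * U) = norm2 N (\prod_(w <- ws) flip w * U).
  elim: ws U {szp} => [|w l IHl] U; first by rewrite !big_nil.
  rewrite /= addnS => sN; rewrite !big_cons -mulrA mulrCA IHl; last first.
    apply: leq_trans sN; rewrite -addSn leq_add2r.
    by apply: leq_trans (size_polyMleq _ _) _; rewrite size_XsubC.
  rewrite mulrCA -mulrA /flip; case: ifP => // _; apply: norm2_flip; rewrite -/flip.
  apply: leq_ltn_trans sN; apply: leq_trans (size_polyMleq _ _) _.
  have -> : size (\prod_(w0 <- l) flip w0) = (size l).+1; last by rewrite addSn addnC.
  elim: (l) => [|v k IHk]; first by rewrite big_nil size_poly1.
  by rewrite big_cons size_mul ?prodf_seq_neq0 ?IHk ?szf //; apply/allP => ? _ /=; rewrite f0.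
rewrite -mul_polyC [c%:P * _]mulrC key; last first.
  by rewrite -[_.+1]add1n leq_add2r size_polyC_leq1.
rewrite /norm2 big_ord_recr /= -[X in X <= _]add0r lerD ?sumr_ge0 //.
  by move=> i _; rewrite exprn_ge0.
rewrite [_ * c%:P]mulrC coefCM normrM ler_pXn2r // ?nnegrE ?mulr_ge0 //; last first.
  exact: le_trans ler01 (mahler_ge1 _).
rewrite -[X in _`_X]/((size ws).+1.-1) -szp -lead_coefE lead_coef_prod normr_prod.
by rewrite (eq_bigr max1).
Qed.

Lemma mahler_sub (s t : seq algC) : uniq s -> {subset s <= t} ->
  mahler s <= mahler t.
Proof.
elim: s t => [|x s IHs] t; first by rewrite /mahler big_nil mahler_ge1.
case/andP => xs us st; have xt : x \in t by rewrite st ?mem_head.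
rewrite /mahler big_cons (perm_big _ (perm_to_rem xt)) big_cons.
apply: ler_wpM2l; first exact: max1_ge0.
apply: IHs => // y ys; have := st y; rewrite inE ys orbT => /(_ isT).
rewrite (perm_mem (perm_to_rem xt)) inE => /orP[/eqP yx|//].
by rewrite -yx ys in xs.
Qed.

(* The powers [r ^ q] are distinct conjugates, so all of them are roots of [W]. *)
Lemma conj_roots_mahler f rs (a : algC) q (W : {poly int}) :
  conj_roots f rs -> a \in rs -> {in rs &, injective (fun r => r ^+ q)} ->
  W != 0 -> root (map_poly intr W) (a ^+ q) ->
  mahler rs ^+ q.*2 <= \sum_(i < size W) (W`_i ^+ 2)%:~R.
Proof.
move=> cr a_rs injq W0 Wa.
have [_ urs _ cj] := cr.
have sW : size (map_poly (intr : int -> algC) W) = size W.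
  by rewrite size_map_inj_poly ?rmorph0 //; exact: intr_inj.
have [ws Dws] := closed_field_poly_normal (map_poly (intr : int -> algC) W).
set c := lead_coef _ in Dws.
have c0 : c != 0 by rewrite /c lead_coef_eq0 -size_poly_eq0 sW size_poly_eq0.
have c1 : 1 <= `|c|.
  by apply: norm_intr_ge1 => //; rewrite /c lead_coefE coef_map intr_int.
have sws : (size ws).+1 = size W.
  by rewrite -sW Dws size_scale // size_prod_XsubC.
have sub : {subset [seq r ^+ q | r <- rs] <= ws}.
  move=> _ /mapP[r r_rs ->].
  have : root (map_poly intr W) (r ^+ q).
    rewrite -root_comp_Xn; apply: (cj _ a) => //; rewrite root_comp_Xn //.
  by rewrite Dws rootZ // root_prod_XsubC.
have umap : uniq [seq r ^+ q | r <- rs] by rewrite map_inj_in_uniq.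
have le1 : mahler rs ^+ q <= `|c| * mahler ws.
  apply: le_trans (_ : mahler [seq r ^+ q | r <- rs] <= _).
    rewrite /mahler big_map -prodrXl le_eqVlt; apply/orP; left.
    by apply/eqP; apply: eq_bigr => r _; rewrite max1X.
  apply: le_trans (mahler_sub umap sub) _.
  by rewrite ler_peMl // (le_trans ler01 (mahler_ge1 _)).
rewrite -muln2 exprM.
apply: le_trans (_ : (`|c| * mahler ws) ^+ 2 <= _).
  by rewrite ler_pXn2r // nnegrE ?mulr_ge0 ?exprn_ge0 // (le_trans ler01 (mahler_ge1 _)).
apply: le_trans (landau c ws) _; rewrite -Dws sws le_eqVlt; apply/orP; left.
apply/eqP/eq_bigr => i _; rewrite coef_map /= -intr_norm -rmorphXn.
by rewrite real_normK ?num_real.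
Qed.

(** * Dobrowolski's determinant *)

Lemma ffact_leq_exp n m : (n ^_ m <= n ^ m)%N.
Proof.
rewrite ffact_prod -[X in (_ <= _ ^ X)%N]card_ord -prod_nat_const.
by apply: leq_prod => i _; rewrite leq_subr.
Qed.

(** Leibniz's expansion. The loss against Hadamard's inequality is at most [N ^ (N / 2)], which only
    affects constants. *)
Lemma det_norm_le N (A : 'M[algC]_N) (b : 'I_N -> algC) :
  (forall u v, `|A u v| <= b u) -> `|\det A| <= N`!%:R * \prod_u b u.
Proof.
move=> Ab; apply: le_trans (ler_norm_sum _ _ _) _.
apply: le_trans (_ : \sum_(s : 'S_N) \prod_u b u <= _).
  apply: ler_sum => s _; rewrite normrM normrX normrN1 expr1n mul1r normr_prod.
  by apply: ler_prod => u _; rewrite normr_ge0 Ab.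
by rewrite sumr_const card_Sn mulr_natl.
Qed.

Lemma dvdp_prod_pow (F : fieldType) (G : {poly F}) (s : seq F) (m : F -> nat) :
  uniq s -> (forall x, x \in s -> ('X - x%:P) ^+ m x %| G) ->
  \prod_(x <- s) ('X - x%:P) ^+ m x %| G.
Proof.
elim: s => [|x s IHs]; first by rewrite big_nil dvd1p.
case/andP => xs us dvG; rewrite big_cons Gauss_dvdp.
  rewrite dvG ?mem_head // IHs // => y ys; apply: dvG.
  by rewrite inE ys orbT.
rewrite coprimep_expl // coprimep_sym coprimep_XsubC.
rewrite /root horner_prod prodf_seq_neq0; apply/allP => y ys /=.
rewrite horner_exp !hornerE expf_neq0 // subr_eq0.
by apply: contraNneq xs => ->.
Qed.

Lemma exp_poly_Fp p (h : {poly 'F_p}) : prime p -> h ^+ p = h \Po 'X^p.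
Proof.
move=> pp; have cp : p \in [pchar {poly 'F_p}].
  by apply: (rmorph_pchar (polyC : {rmorphism 'F_p -> {poly 'F_p}})); apply: pchar_Fp.
elim/poly_ind: h => [|h c IHh].
  by rewrite comp_poly0 expr0n eqn0Ngt prime_gt0.
rewrite -!(pFrobenius_autE cp) pFrobenius_autD_comm; last exact: mulrC.
rewrite !pFrobenius_autE exprMn IHh comp_polyD comp_polyM comp_polyX comp_polyC.
by rewrite -polyC_exp; have := expf_card c; rewrite card_Fp // => ->.
Qed.

Lemma exp_poly_int p (f : {poly int}) : prime p ->
  exists g : {poly int}, f \Po 'X^p = f ^+ p + g *+ p.
Proof.
move=> pp; pose h := f \Po 'X^p - f ^+ p.
have h0 : map_poly (intr : int -> 'F_p) h = 0.
  rewrite rmorphB /= rmorphXn /= exp_poly_Fp // map_comp_poly map_polyXn.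
  by rewrite subrr.
exists (map_poly (fun x => (x %/ p)%Z) h); rewrite -[LHS](subrK (f ^+ p)) addrC -/h.
congr (_ + _); apply/polyP => i; rewrite coefMn coef_map_id0 ?div0z //.
have : (p %| h`_i)%Z.
  rewrite (dvdz_pcharf (pchar_Fp pp)).
  by have /polyP /(_ i) := h0; rewrite coef_map coef0 => ->.
by move/divzK; rewrite -mulr_natr natz => ->.
Qed.

(* Rows of Dobrowolski's confluent Vandermonde matrix: the derivatives of order
   less than [k] at the conjugates [r i], and the values at [r i ^ e j]. *)
Definition dob_eval (d k n : nat) (r : 'I_d -> algC) (e : 'I_n -> nat) 
    (u : 'I_#|{: 'I_d * 'I_k}| + 'I_#|{: 'I_d * 'I_n}|) (G : {poly algC}) : algC :=
  match u with
  | inl a => let: (i, s) := enum_val a in G^`(s).[r i]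
  | inr b => let: (i, j) := enum_val b in G.[r i ^+ e j]
  end.

Lemma dob_eval_sum d k n r e u (I : finType) (c : I -> algC) (G : I -> {poly algC}) :
  @dob_eval d k n r e u (\sum_i c i *: G i) = \sum_i c i * dob_eval r e u (G i).
Proof.
case: u => a /=; case: (enum_val a) => i s.
  rewrite linear_sum horner_sum; apply: eq_bigr => w _.
  by rewrite linearZ hornerZ.
by rewrite horner_sum; apply: eq_bigr => w _; rewrite hornerZ.
Qed.

Lemma prod_enum_pair (R : comPzSemiRingType) d n (F : 'I_d -> 'I_n -> R) :
  \prod_(u < #|{: 'I_d * 'I_n}|) F (enum_val u).1 (enum_val u).2 =
  \prod_i \prod_j F i j.
Proof.
rewrite -(big_enum_val (fun x => F x.1 x.2)) pair_big /=.
by apply: eq_bigl.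
Qed.

Lemma derivn_mul_root (F : fieldType) (q g : {poly F}) (x : F) k s :
  root q x -> (s < k)%N -> (q ^+ k * g)^`(s).[x] = 0.
Proof.
move=> qx; elim: s k g => [|s IHs] [|k] g //= sk.
  by rewrite hornerM horner_exp (rootP qx) expr0n mul0r.
rewrite -[RHS](IHs k ((q^`() * g) *+ k.+1 + q * g^`())) // -derivnS derivSn.
rewrite derivM deriv_exp; congr (_^`(s).[x]).
by rewrite -[_ *+ k.+1]mulr_natr -[X in _ = _ * (X + _)]mulr_natr exprS; ring.
Qed.

(* Modulo [p], [f(X ^ p) = f ^ p], hence [f(r ^ p)] is divisible by [p] for every
   conjugate [r], while [f ^ k] vanishes to order [k] at [r]. *)
Lemma dobrowolski_mul f rs (ps : seq nat) k :
  conj_roots f rs -> all prime ps ->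
  let r (i : 'I_(size rs)) := rs`_i in
  let e (j : 'I_(size ps)) := nth 0%N ps j in
  exists2 theta, theta \in Aint &
  \det (\matrix_(u < _ + _, v < _ + _) @dob_eval _ k _ r e (split u) 'X^v) =
    (\prod_(p <- ps) p ^ (k * size rs))%:R * theta :> algC.
Proof.
move=> cr aps r e; set d := size rs; set n := size ps.
have [mon_f _ Df cj] := cr.
pose fC := map_poly (intr : int -> algC) f.
have mon_fk : fC ^+ k \is monic by rewrite monic_exp // monic_map.
have card1 : #|{: 'I_d * 'I_k}| = (d * k)%N by rewrite card_prod !card_ord.
have sfk : size (fC ^+ k) = (#|{: 'I_d * 'I_k}|).+1.
  have sf : size fC = d.+1 by rewrite /fC Df size_prod_XsubC.
  by rewrite [LHS]polySpred ?monic_neq0 // size_exp sf card1.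
set n1 := #|{: 'I_d * 'I_k}| in sfk *; set n2 := #|_|.
(* A unitriangular change of columns: each [col v] is monic of degree [v], so replacing the
   monomials by these polynomials keeps the determinant and makes the matrix block triangular. *)
pose col (v : 'I_(n1 + n2)) : {poly algC} :=
  match split v with inl a => 'X^a | inr b => fC ^+ k * 'X^b end.
have col_size v : size (col v) = v.+1.
  rewrite /col; case: splitP => a ->; first by rewrite size_polyXn.
  by rewrite size_monicM ?monic_neq0 ?monicXn // sfk size_polyXn addnS.
have col_monic v : col v \is monic.
  by rewrite /col; case: split => a; rewrite ?monicMr ?monicXn.
set A := \matrix_(u, v) _.
pose B : 'M[algC]_(n1 + n2) := \matrix_(u, v) dob_eval r e (split u) (col v).
have AB : \det A = \det B.
  pose T : 'M[algC]_(n1 + n2) := \matrix_(w, v) (col v)`_w.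
  have -> : B = A *m T.
    apply/matrixP => u v; rewrite !mxE.
    have -> : col v = \sum_(w < n1 + n2) (col v)`_w *: 'X^w.
      rewrite -[LHS]coefK poly_def (big_ord_widen (n1 + n2)%N (fun w => (col v)`_w *: 'X^w)).
        rewrite big_mkcond /=; apply: eq_bigr => w _; case: ltnP => // h.
        by rewrite nth_default ?scale0r.
      by rewrite col_size.
    rewrite dob_eval_sum; apply: eq_bigr => w _; rewrite !mxE mulrC.
    by [].
  rewrite det_mulmx -[LHS]mulr1; congr (_ * _); rewrite -det_tr det_trig.
    rewrite big1 // => v _; rewrite !mxE -[X in _`_X]/(v.+1.-1) -(col_size v) -lead_coefE.
    exact/monicP.
  apply/is_trig_mxP => i j ij; by rewrite !mxE nth_default // col_size.
rewrite AB.
pose be (b : 'I_n2) := let: (i, j) := enum_val b in r i ^+ e j.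
pose pr (b : 'I_n2) := e (enum_val b).2.
pose ri (b : 'I_n2) := r (enum_val b).1.
have prP b : prime (pr b) by apply: (allP aps); rewrite /pr mem_nth.
have r_rs i : r i \in rs by rewrite mem_nth.
have r_root i : root fC (r i) by rewrite /fC Df root_prod_XsubC.
have r_Aint i : r i \in Aint.
  apply: (root_monic_Aint (r_root i)); first by rewrite monic_map.
  by apply/polyOverP => m; rewrite coef_map intr_int.
have [g gP] := choice (fun b => exp_poly_int f (prP b)).
have gE b : fC.[be b] = (map_poly intr (g b)).[ri b] * (pr b)%:R.
  have := gP b; move=> /(congr1 (map_poly (intr : int -> algC))).
  rewrite map_comp_poly map_polyXn => /(congr1 (horner^~ (ri b))).
  rewrite horner_comp hornerXn rmorphD rmorphXn rmorphMn /= hornerD horner_exp.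
  rewrite (rootP (r_root _)) expr0n eqn0Ngt prime_gt0 // add0r hornerMn mulr_natr => <-.
  by rewrite /be /ri /pr; case: (enum_val b).
have polyint_Aint (h : {poly int}) i : (map_poly intr h).[r i] \in Aint.
  rewrite horner_coef rpred_sum // => m _.
  by rewrite rpredM ?rpredX // coef_map Aint_int.
pose B11 : 'M[algC]_n1 := \matrix_(u, v) dob_eval r e (inl u) 'X^v.
pose C : 'M[algC]_n2 := \matrix_(u, v) ((map_poly intr (g u)).[ri u] ^+ k * be u ^+ v).
pose B22 : 'M[algC]_n2 := diag_mx (\row_u (pr u)%:R ^+ k) *m C.
have sl (a : 'I_n1) : split (lshift n2 a) = inl a := unsplitK (inl a).
have sr (a : 'I_n2) : split (rshift n1 a) = inr a := unsplitK (inr a).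
have DB : B = block_mx B11 0 (dlsubmx B) B22.
  rewrite -[LHS]submxK; congr (block_mx _ _ _ _); apply/matrixP => u v.
  - by rewrite !mxE /col !sl.
  - rewrite !mxE /col sl sr /=; case: (enum_val u) => i s.
    by rewrite derivn_mul_root.
  - rewrite /B22 mul_diag_mx !mxE /col !sr.
    have -> : dob_eval r e (inr u) (fC ^+ k * 'X^v) = fC.[be u] ^+ k * be u ^+ v.
      rewrite /be /=; case: (enum_val u) => i j.
      by rewrite hornerM horner_exp hornerXn.
    by rewrite gE exprMn -mulrA mulrCA mulrA.
have be_Aint b : be b \in Aint.
  by rewrite /be; case: (enum_val b) => i j; rewrite rpredX.
exists (\det B11 * \det C).
  apply: rpredM; apply: rpred_sum => s _; apply: rpredM;
    rewrite ?rpredX ?rpredN ?rpred1 //; apply: rpred_prod => i _; rewrite mxE.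
    rewrite /=; case: (enum_val i) => j t; rewrite derivnXn hornerMn hornerXn.
    by rewrite rpredMn ?rpredX.
  by rewrite rpredM ?rpredX ?polyint_Aint.
rewrite DB det_lblock det_mulmx det_diag mulrCA; congr (_ * _).
under eq_bigr => u _ do rewrite mxE.
rewrite (@prod_enum_pair _ _ _ (fun i j => (e j)%:R ^+ k)) prodr_const card_ord.
rewrite natr_prod (big_nth 0%N) big_mkord -prodrXl; apply: eq_bigr => j _.
by rewrite natrX exprM.
Qed.

Definition dob_mx (d k n : nat) (r : 'I_d -> algC) (e : 'I_n -> nat) :=
  \matrix_(u < #|{: 'I_d * 'I_k}| + #|{: 'I_d * 'I_n}|,
           v < #|{: 'I_d * 'I_k}| + #|{: 'I_d * 'I_n}|) dob_eval r e (split u) 'X^v.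

Lemma size_prod_XsubC_pow (F : fieldType) (s : seq F) (m : F -> nat) :
  size (\prod_(x <- s) ('X - x%:P) ^+ m x) = (\sum_(x <- s) m x).+1.
Proof.
elim: s => [|x s IHs]; first by rewrite !big_nil size_poly1.
rewrite !big_cons size_monicM ?monic_exp ?monicXsubC //; last first.
  by rewrite -size_poly_gt0 IHs.
by rewrite size_exp_XsubC IHs addnS.
Qed.

(** A kernel vector is the coefficient vector of a polynomial of degree less than [d * (k + n)] that
    vanishes to order [k] at [d] points and also at [d * n] further points, which is one zero too
    many. *)
Lemma det_dob_mx_neq0 (d k n : nat) (r : 'I_d -> algC) (e : 'I_n -> nat) :
  injective r -> injective (fun x : 'I_d * 'I_n => r x.1 ^+ e x.2) ->
  (forall i i' j, r i ^+ e j != r i') -> \det (dob_mx k r e) != 0.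
Proof.
move=> injr injb disj; apply/negP; rewrite -det_tr => /det0P[v v0 vA].
set N1 := #|{: 'I_d * 'I_k}| in v v0 vA; set N2 := #|_| in v v0 vA.
pose G := \sum_(w < N1 + N2) v 0 w *: 'X^w : {poly algC}.
have Gw (w : 'I_(N1 + N2)) : G`_w = v 0 w.
  rewrite coef_sum (bigD1 w) //= coefZ coefXn eqxx mulr1 big1 ?addr0 //.
  move=> w' nw; rewrite coefZ coefXn [_ == _ :> nat]eq_sym.
  by rewrite (negPf (nw : (w' : nat) != w)) mulr0.
have G0 : G != 0.
  apply: contra v0 => /eqP G0; apply/eqP/rowP => w.
  by rewrite -Gw G0 coef0 mxE.
have sG : (size G <= N1 + N2)%N.
  apply: leq_trans (size_sum _ _ _) _; apply/bigmax_leqP => w _.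
  by apply: leq_trans (size_scale_leq _ _) _; rewrite size_polyXn.
have LG (u : 'I_N1 + 'I_N2) : dob_eval r e u G = 0.
  rewrite dob_eval_sum -[u]unsplitK.
  have /rowP /(_ (unsplit u)) := vA; rewrite !mxE => E; rewrite -[RHS]E.
  by apply: eq_bigr => w _; rewrite !mxE.
have c1 : N1 = (d * k)%N by rewrite /N1 card_prod !card_ord.
have c2 : N2 = (d * n)%N by rewrite /N2 card_prod !card_ord.
pose s1 := [seq r i | i : 'I_d].
pose s2 := [seq r x.1 ^+ e x.2 | x : 'I_d * 'I_n].
pose m x := if x \in s1 then k else 1%N.
have us : uniq (s1 ++ s2).
  rewrite cat_uniq; apply/and3P; split; rewrite ?map_inj_uniq -?enumT ?enum_uniq //.
  apply/hasP => -[_ /mapP[[i j] _ ->] /mapP[i' _ /eqP]] /=.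
  by rewrite (negPf (disj _ _ _)).
have s12 x : x \in s2 -> x \notin s1.
  move=> xs2; apply/negP => xs1; move: us; rewrite cat_uniq => /and3P[_ /hasP h _].
  by case: h; exists x.
have dv x : x \in s1 ++ s2 -> ('X - x%:P) ^+ m x %| G.
  rewrite mem_cat /m; case: ifP => [x1 _ | nx1 /= x2].
    rewrite -mup_geq //; apply: mup_derivn_geq => // s sk.
    case/mapP: x1 => i _ ->.
    have := LG (inl (enum_rank (i, Ordinal sk))); rewrite /= enum_rankK /=.
    by move=> h; apply/rootP.
  case/mapP: x2 => -[i j] _ ->; rewrite expr1 dvdp_XsubCl.
  by have := LG (inr (enum_rank (i, j))); rewrite /= enum_rankK => h; apply/rootP.
have /dvdp_leq := dvdp_prod_pow us dv => /(_ G0).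
rewrite leqNgt => /negP; apply; apply: leq_ltn_trans sG _.
rewrite size_prod_XsubC_pow big_cat /= !big_image /= c1 c2 ltnS.
rewrite (eq_bigr (fun=> k)) => [|i _]; last by rewrite /m map_f ?mem_enum.
rewrite [X in (_ <= _ + X)%N](eq_bigr (fun=> 1%N)) => [|x _]; last first.
  by rewrite /m ifN //; apply: s12; apply: (map_f (fun x => r x.1 ^+ e x.2)); rewrite mem_enum.
by rewrite !sum_nat_const card_prod !card_ord muln1.
Qed.

(** A permutation of the conjugates may change the sign of the determinant, hence the square. It is
    the determinant of the transposed matrix times the matrix, whose entries are integer
    combinations of power sums of the conjugates. *)
Lemma det_dob_mx_sqr_int f rs k n (e : 'I_n -> nat) : conj_roots f rs ->
  \det (dob_mx k (fun i : 'I_(size rs) => rs`_i) e) ^+ 2 \is a Num.int.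
Proof.
move=> cr; set r := fun i => _.
rewrite expr2 -{1}det_tr -det_mulmx rpred_sum // => s _.
rewrite rpredM ?rpredX ?rpredN ?rpred1 // rpred_prod // => v _; rewrite mxE.
move: (s v) => w; under eq_bigr => u _ do rewrite !mxE.
have pw m : \sum_i r i ^+ m \is a Num.int.
  by have := conj_roots_power_sum m cr; rewrite (big_nth 0) big_mkord.
rewrite big_split_ord /= rpredD //.
  under eq_bigr => u _ do rewrite (unsplitK (inl u)) /=.
  under eq_bigr => u _.
    rewrite (_ : _ * _ = r (enum_val u).1 ^+ (w - (enum_val u).2 + (v - (enum_val u).2)) *
       (w ^_ (enum_val u).2 * v ^_ (enum_val u).2)%:R); last first.
      case: (enum_val u) => i t /=; rewrite !derivnXn !hornerMn !hornerXn.
      rewrite exprD natrM -[X in X * _ = _]mulr_natr -[X in _ * X = _]mulr_natr. ring.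
    over.
  rewrite -(big_enum_val (fun x : 'I_(size rs) * 'I_k => r x.1 ^+ (w - x.2 + (v - x.2)) * (w ^_ x.2 * v ^_ x.2)%:R)).
  rewrite (eq_bigl predT) // -(pair_bigA _ (fun (i : 'I_(size rs)) (t : 'I_k) => r i ^+ (w - t + (v - t)) * (w ^_ t * v ^_ t)%:R)) /=.
  rewrite exchange_big rpred_sum // => t _; rewrite -mulr_suml rpredM ?rpred_nat //.
under eq_bigr => u _ do rewrite (unsplitK (inr u)) /=.
under eq_bigr => u _.
  rewrite (_ : _ * _ = r (enum_val u).1 ^+ (e (enum_val u).2 * (w + v))); last first.
    by case: (enum_val u) => i t /=; rewrite !hornerXn mulnDr exprD !exprM mulrC.
  over.
rewrite -(big_enum_val (fun x : 'I_(size rs) * 'I_n => r x.1 ^+ (e x.2 * (w + v)))).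
rewrite (eq_bigl predT) // -(pair_bigA _ (fun (i : 'I_(size rs)) (t : 'I_n) => r i ^+ (e t * (w + v)))) /=.
by rewrite exchange_big rpred_sum // => t _.
Qed.

Lemma fact_leq_exp n : (n`! <= n ^ n)%N.
Proof. by rewrite -ffactnn ffact_leq_exp. Qed.

(** Each of the [d * k] derivative rows contributes [N ^ k] from falling factorials and [N] factors
    [max1]; each of the [d * n] value rows contributes [x * N] factors [max1]. The remaining [N ^ N]
    bounds the [N!] of Leibniz. *)
Lemma det_dob_mx_bound d k n (r : 'I_d -> algC) (e : 'I_n -> nat) x N :
  (forall j, (e j <= x)%N) -> N = (d * (k + n))%N ->
  `|\det (dob_mx k r e)| <=
    (N ^ (N + k * k * d))%:R * (\prod_i max1 (r i)) ^+ (N * (k + x * n)).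
Proof.
move=> ex DN; have cN : (#|{: 'I_d * 'I_k}| + #|{: 'I_d * 'I_n}|)%N = N.
  by rewrite !card_prod !card_ord DN mulnDr.
pose b (u : 'I_(#|{: 'I_d * 'I_k}| + #|{: 'I_d * 'I_n}|)) : algC := match split u with
  | inl a => (N ^ k)%:R * max1 (r (enum_val a).1) ^+ N
  | inr a => max1 (r (enum_val a).1) ^+ (x * N) end.
have xexp (y : algC) i j : (i <= j)%N -> `|y| ^+ i <= max1 y ^+ j.
  move=> ij; apply: le_trans (_ : max1 y ^+ i <= _).
    by apply: lerXn2r; rewrite ?nnegrE ?max1_ge0 ?max1_ge_norm.
  by rewrite ler_weXn2l ?max1_ge1.
apply: le_trans (det_norm_le (b := b) _) _.
  move=> u v; rewrite mxE /b.
  have vN : (v < N)%N by rewrite -cN.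
  case: (split u) => a /=; case: (enum_val a) => i t /=.
    rewrite derivnXn hornerMn hornerXn normrMn normrX -[leLHS]mulr_natl.
    apply: ler_pM; rewrite ?ler0n ?exprn_ge0 //; last first.
      by apply: xexp; apply: leq_trans (leq_subr _ _) (ltnW vN).
    rewrite ler_nat; apply: leq_trans (ffact_leq_exp _ _) _.
    have N0 : (0 < N)%N by apply: leq_ltn_trans vN.
    apply: leq_trans (_ : N ^ t <= _)%N.
      by case: (t : nat) => // m; rewrite leq_exp2r // ltnW.
    by rewrite leq_pexp2l // ltnW.
  by rewrite hornerXn -exprM normrX xexp // leq_mul // ltnW.
rewrite big_split_ord /= /b.
under eq_bigr => u _ do rewrite (unsplitK (inl u)).
under [X in _ * (_ * X)]eq_bigr => u _ do rewrite (unsplitK (inr u)).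
rewrite (@prod_enum_pair _ _ _ (fun (i : 'I_d) (t : 'I_k) => (N ^ k)%:R * max1 (r i) ^+ N)).
rewrite (@prod_enum_pair _ _ _ (fun (i : 'I_d) (t : 'I_n) => max1 (r i) ^+ (x * N))).
have -> : \prod_i \prod_(t < k) ((N ^ k)%:R * max1 (r i) ^+ N) =
    (N ^ (k * k * d))%:R * (\prod_i max1 (r i)) ^+ (N * k) :> algC.
  under eq_bigr => i _ do rewrite prodr_const card_ord exprMn -exprM.
  by rewrite big_split /= prodr_const card_ord prodrXl -!natrX -!expnM mulnA.
have -> : \prod_i \prod_(t < n) max1 (r i) ^+ (x * N) =
    (\prod_i max1 (r i)) ^+ (N * (x * n)) :> algC.
  under eq_bigr => i _ do rewrite prodr_const card_ord -exprM.
  by rewrite prodrXl; congr (_ ^+ _); lia.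
rewrite !mulrA -natrM -mulrA -exprD -mulnDr.
apply: ler_wpM2r.
  by rewrite exprn_ge0 // prodr_ge0 // => i _; apply: max1_ge0.
by rewrite ler_nat expnD leq_mul // cN fact_leq_exp.
Qed.

(** The cofactor [theta] of the prime powers in the determinant is a nonzero algebraic integer with
    rational square. The square is therefore a nonzero integer, so [theta] has modulus at least
    1. *)
Lemma dobrowolski f rs (ps : seq nat) k x N :
  conj_roots f rs -> 0 \notin rs ->
  (forall r m, r \in rs -> (0 < m)%N -> r ^+ m != 1) ->
  uniq ps -> all prime ps -> all (fun p => p <= x)%N ps ->
  (forall p, p \in ps -> {in rs &, injective (fun r => r ^+ p)}) ->
  N = (size rs * (k + size ps))%N ->
  (\prod_(p <- ps) p ^ (k * size rs))%:R <=
    (N ^ (N + k * k * size rs))%:R * mahler rs ^+ (N * (k + x * size ps)).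
Proof.
move=> cr rs0 nru ups aps pps injp DN.
pose r (i : 'I_(size rs)) := rs`_i.
pose e (j : 'I_(size ps)) := nth 0%N ps j.
have r_rs i : r i \in rs by rewrite mem_nth.
have e_ps j : e j \in ps by rewrite mem_nth.
have [_ urs _ _] := cr.
have injr : injective r.
  by move=> i j /eqP; rewrite /r nth_uniq // => /eqP /val_inj.
have cross p q i j : r i ^+ p = r j ^+ q -> p = q.
  move=> E; apply/eqP; apply: contraT => pq.
  have [m m0] := conj_roots_cross cr rs0 (r_rs i) (r_rs j) E pq.
  by move/eqP; rewrite (negPf (nru _ _ _ m0)).
have det0 : \det (dob_mx k r e) != 0.
  apply: det_dob_mx_neq0 => //.
    move=> [i j] [i' j'] /= E; have ej := cross _ _ _ _ E.
    have jj' : j = j'.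
      by apply/val_inj/eqP; rewrite -(nth_uniq 0%N (ltn_ord j) (ltn_ord j') ups); apply/eqP.
    move: E; rewrite jj' => /(injp _ (e_ps j')) E; congr (_, _).
    by apply: injr; apply: E.
  (* The points [r i ^ e j] avoid the conjugates themselves: this is the crossing relation with
     second exponent 1, which is not a prime. *)
  move=> i i' j; apply/eqP => E; have := cross (e j) 1%N i i' E => ej.
  by have := allP aps _ (e_ps j); rewrite ej.
have [theta Atheta Dtheta] := dobrowolski_mul k cr aps.
rewrite -/(dob_mx k r e) in Dtheta.
set P := (\prod_(p <- ps) _)%N in Dtheta *.
have P0 : P%:R != 0 :> algC.
  by apply: contraNneq det0 => P0; rewrite Dtheta P0 mul0r.
have theta2 : theta ^+ 2 \is a Num.int.
  apply: Cint_rat_Aint; last by rewrite rpredX.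
  have -> : theta ^+ 2 = \det (dob_mx k r e) ^+ 2 / P%:R ^+ 2.
    by rewrite Dtheta exprMn mulrC mulKf // expf_neq0.
  apply: rpred_div; last by rewrite rpredX ?rpred_nat.
  by have /intrP[m ->] := det_dob_mx_sqr_int k e cr; exact: rpred_int.
have theta1 : 1 <= `|theta|.
  have t0 : theta != 0 by apply: contraNneq det0 => t0; rewrite Dtheta t0 mulr0.
  have : 1 <= `|theta ^+ 2| by apply: norm_intr_ge1; rewrite ?expf_neq0.
  by rewrite normrX expr_ge1.
apply: le_trans (_ : `|\det (dob_mx k r e)| <= _).
  by rewrite Dtheta normrM normr_nat ler_peMr.
have -> : mahler rs = \prod_i max1 (r i).
  by rewrite /mahler (big_nth 0) big_mkord.
by apply: det_dob_mx_bound => // j; apply: (allP pps).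
Qed.

(** After taking [d]-th roots, the left side of [dobrowolski] is at least
    [y ^ (k ^ 3) = y ^ (16 * l * k ^ 2)]. On the right, [N <= n ^ 2] gives [n ^ (6 * k ^ 2)] and the
    assumed bound on [mahler rs] gives [n ^ (4 * k ^ 2)]. Since [n <= y ^ l], this would force
    [16 <= 10]. *)
Lemma mahler_gap f rs (ps : seq nat) n y x l q :
  conj_roots f rs -> 0 \notin rs ->
  (forall r m, r \in rs -> (0 < m)%N -> r ^+ m != 1) ->
  (0 < size rs <= n)%N ->
  uniq ps -> all prime ps -> all (fun p => y <= p <= x)%N ps ->
  (forall p, p \in ps -> {in rs &, injective (fun r => r ^+ p)}) ->
  let k := (16 * l)%N in
  size ps = (k ^ 2)%N -> (k + k ^ 2 <= n)%N ->
  (0 < l)%N -> (1 < y)%N -> (n <= y ^ l)%N -> (x * k ^ 2 <= q)%N ->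
  ~ (mahler rs ^+ q.*2 <= (n ^ 2)%:R).
Proof.
move=> cr rs0 nru /andP[d0 dn] ups aps pps injp k sps kn l0 y1 nyl xkq Mq.
set d := size rs in d0 dn.
have k0 : (0 < k)%N by rewrite muln_gt0.
have n0 : (0 < n)%N by apply: leq_trans dn.
have x0 : (0 < x)%N.
  have : (0 < size ps)%N by rewrite sps expn_gt0 k0.
  case: ps pps {ups aps injp sps} => //= p ps /andP[/andP[yp px] _] _.
  by apply: leq_trans px; apply: leq_trans yp; apply: ltnW.
have ppx : all (fun p => p <= x)%N ps by apply: sub_all pps => p /andP[].
pose N := (d * (k + size ps))%N.
have := @dobrowolski f rs ps k x N cr rs0 nru ups aps ppx injp erefl.
have M1 := mahler_ge1 rs; have M0 := le_trans ler01 M1.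
set M := mahler rs in M1 M0 Mq *; rewrite -/d => dob.
have Nn : (N <= n ^ 2)%N by rewrite /N sps expnS expn1 leq_mul.
have lb : (y ^ (k * k ^ 2 * d) <= \prod_(p <- ps) p ^ (k * d))%N.
  apply: leq_trans (_ : \prod_(p <- ps) y ^ (k * d) <= _)%N.
    by rewrite big_const_seq count_predT iter_muln_1 sps -expnM mulnAC.
  rewrite big_seq [X in (_ <= X)%N]big_seq leq_prod // => p /(allP pps) /andP[yp _].
  by case: (k * d)%N => // m; rewrite leq_exp2r.
have ub : (y ^ (k * k ^ 2))%:R <= (n ^ (10 * k ^ 2))%:R :> algC.
  have Ek : (10 * k ^ 2 = 2 * (3 * k ^ 2) + 2 * (2 * k ^ 2))%N by lia.
  apply: le_trans (_ : (N ^ (k + 2 * k ^ 2))%:R * M ^+ ((k + k ^ 2) * (k + x * k ^ 2)) <= _).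
    rewrite -(@ler_pXn2r _ d) // ?nnegrE ?mulr_ge0 ?exprn_ge0 ?ler0n //.
    apply: le_trans (_ : (\prod_(p <- ps) p ^ (k * d))%:R <= _).
      by rewrite -natrX -expnM ler_nat.
    apply: le_trans dob _; rewrite exprMn -natrX -expnM -exprM le_eqVlt; apply/orP; left.
    by apply/eqP; congr (_ * _); [congr (_ ^ _)%:R|congr (_ ^+ _)]; rewrite /N sps; nia.
  rewrite Ek [X in _ <= X%:R]expnD [X in _ <= X]natrM; apply: ler_pM; rewrite ?ler0n ?exprn_ge0 //.
    rewrite ler_nat expnM; apply: leq_trans (_ : (n ^ 2) ^ (k + 2 * k ^ 2) <= _)%N.
      by case: (k + _)%N => // m; rewrite leq_exp2r.
    rewrite leq_pexp2l ?expn_gt0 ?n0 //; nia.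
  apply: le_trans (_ : M ^+ (q.*2 * (2 * k ^ 2)) <= _).
    rewrite ler_weXn2l //; nia.
  by rewrite exprM expnM natrX lerXn2r ?nnegrE ?exprn_ge0 ?ler0n.
have : (y ^ (k * k ^ 2) <= y ^ (l * (10 * k ^ 2)))%N.
  move: ub; rewrite ler_nat => /leq_trans; apply.
  by rewrite [X in (_ <= X)%N]expnM leq_exp2r // muln_gt0 expn_gt0 k0.
rewrite leq_exp2l // /k; nia.
Qed.

(** * A prime separating a power from all polynomials of height 1 *)

(* For [n < 2 ^ 4 ^ l] with [4 ^ l] of order [log n]: the auxiliary primes of
   Dobrowolski's determinant lie below [dob_x l], and the prime [q] between
   [dob_q1 l] and [dob_q2 l]. The bound [dob_q2 l = O((log n) ^ 4)] is the source
   of the exponent 4 of the theorem. *)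
Definition dob_lam (l : nat) : nat := (4 ^ l %/ l).+1.
Definition dob_k (l : nat) : nat := (16 * dob_lam l)%N.
Definition dob_x (l : nat) : nat := (8 * l * (dob_k l ^ 2 + 2 * 4 ^ l)).*2%N.
Definition dob_q1 (l : nat) : nat := (dob_x l * dob_k l ^ 2)%N.
Definition dob_q2 (l : nat) : nat := (16 * l * (dob_q1 l + 4 ^ l + 3)).*2%N.

Definition dob_primes (l : nat) : seq nat :=
  [seq q <- primes_upto (dob_q2 l) | (dob_q1 l <= q)%N && odd q].

Lemma leq_mul_pow4 l : (4 <= l)%N -> (16 * l <= 4 ^ l)%N.
Proof.
elim: l => // l IHl; rewrite leq_eqVlt => /orP[/eqP <- //|l4].
by have := IHl l4; rewrite expnS; lia.
Qed.

Lemma dob_lam_bound l : (4 <= l)%N ->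
  [/\ (4 ^ l <= l * dob_lam l)%N, (l * dob_lam l <= 2 * 4 ^ l)%N & (dob_lam l <= 2 * 4 ^ l)%N].
Proof.
move=> l4; have l0 : (0 < l)%N by apply: leq_trans l4.
have lb := leq_mul_pow4 l4.
have := ltn_ceil (4 ^ l) l0; have := leq_trunc_div (4 ^ l) l.
have := leq_div (4 ^ l) l.
rewrite /dob_lam; set a := (4 ^ l)%N in lb *; set b := (a %/ l)%N => h1 h2 h3.
by split; nia.
Qed.

Lemma dob_q2_gt0 l : (0 < l)%N -> (0 < dob_q2 l)%N.
Proof. by move=> l0; rewrite /dob_q2 double_gt0 !muln_gt0 l0 addn_gt0 orbT. Qed.

Lemma dob_k_gt1 l : (1 < dob_k l + dob_k l ^ 2)%N.
Proof. by apply: leq_trans (leq_addr _ _); rewrite /dob_k /dob_lam mulnS. Qed.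

Lemma dob_bounds l : (4 <= l)%N ->
  (dob_x l <= 2 ^ (8 * l))%N /\ (dob_q2 l <= 2 ^ 31 * 2 ^ (8 * l))%N.
Proof.
move=> l4; have [h1 h2 h3] := dob_lam_bound l4.
have la : (l <= 4 ^ l)%N by apply: leq_trans (leq_mul_pow4 l4); lia.
have a256 : (256 <= 4 ^ l)%N by rewrite -[256%N]/(4 ^ 4)%N leq_pexp2l.
have -> : (2 ^ (8 * l) = (4 ^ l) ^ 4)%N by transitivity (((2 ^ 2) ^ l) ^ 4)%N => //; rewrite -!expnM; congr (_ ^ _)%N; lia.
have lk : (l * dob_k l ^ 2 <= 2 ^ 10 * (4 ^ l) ^ 2)%N.
  have -> : (l * dob_k l ^ 2 = 2 ^ 8 * ((l * dob_lam l) * dob_lam l))%N.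
    by rewrite /dob_k; lia.
  have -> : (2 ^ 10 * (4 ^ l) ^ 2 = 2 ^ 8 * ((2 * 4 ^ l) * (2 * 4 ^ l)))%N by lia.
  by rewrite leq_mul2l leq_mul ?orbT.
have xb : (dob_x l <= 2 ^ 15 * (4 ^ l) ^ 2)%N.
  have -> : dob_x l = (2 ^ 4 * (l * dob_k l ^ 2) + 2 ^ 5 * (l * 4 ^ l))%N.
    by rewrite /dob_x; lia.
  have := leq_mul la (leqnn (4 ^ l)%N); lia.
have a2 : (2 ^ 15 <= (4 ^ l) ^ 2)%N by apply: leq_trans (_ : 256 ^ 2 <= _)%N; rewrite ?leq_exp2r.
split.
  by apply: leq_trans xb _; rewrite -[4%N in X in (_ <= _ ^ X)%N]/(2 + 2)%N expnD leq_mul2r a2 orbT.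
have -> : dob_q2 l = (2 ^ 5 * (dob_x l * (l * dob_k l ^ 2)) + 2 ^ 5 * (l * (4 ^ l + 3)))%N.
  by rewrite /dob_q2 /dob_q1; lia.
have h4 := leq_mul xb lk.
have h5 : (l * (4 ^ l + 3) <= 2 * ((4 ^ l) ^ 2))%N by nia.
have h6 : ((4 ^ l) ^ 2 <= (4 ^ l) ^ 4)%N by rewrite leq_pexp2l // ltnW // (leq_trans _ a256).
move: h4 h5 h6; set a := (4 ^ l)%N; lia.
Qed.

Lemma size_primes_from x y :
  (size (primes_upto x) <= size [seq p <- primes_upto x | (y <= p)%N] + y)%N.
Proof.
rewrite -(count_predC (fun p => (y <= p)%N) (primes_upto x)) size_filter leq_add2l -size_filter.
rewrite -[X in (_ <= X)%N](size_iota 0 y).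
apply: uniq_leq_size; first by rewrite filter_uniq ?uniq_primes_upto.
by move=> p; rewrite mem_filter mem_iota /= -ltnNge add0n => /andP[].
Qed.

Lemma size_primes_upto_lower m e c : (0 < m)%N -> (m.*2 <= 2 ^ e)%N ->
  (e * c <= m)%N -> (0 < e)%N -> (c <= size (primes_upto m.*2))%N.
Proof.
move=> m0 me cm e0; have := primes_upto_lower m0.
set s := size _ => h.
have : (2 ^ m <= 2 ^ (e * s))%N.
  apply: leq_trans h _; rewrite expnM.
  by case: s => // s; rewrite leq_exp2r.
rewrite leq_exp2l // => h1.
by rewrite -(leq_pmul2l e0); apply: leq_trans h1.
Qed.

(** A prime is dropped if its power map is not injective on the conjugates of [a]. Fewer than
    [4 ^ l] primes are, since 2 to their number is at most the degree of [a], and Chebyshev's bound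
    leaves enough of the others. A [W] vanishing at [a ^ q] would give
    [mahler rs ^ (2 * q) <= n + 1 <= n ^ 2], against [mahler_gap] with [y = 2 ^ l]. *)
Lemma exists_separating_prime n l (a : algC) (P : {poly int}) :
  (4 <= l)%N -> (n < 2 ^ 4 ^ l)%N -> (dob_k l + dob_k l ^ 2 <= n)%N ->
  a \in Aint -> a != 0 -> (forall m, (0 < m)%N -> a ^+ m != 1) ->
  P != 0 -> (size P <= n.+1)%N -> root (map_poly intr P) a ->
  exists2 q, q \in dob_primes l &
    forall W : {poly int}, W != 0 -> (size W <= n.+1)%N ->
      (forall i, `|W`_i| <= 1) -> ~~ root (map_poly intr W) (a ^+ q).
Proof.
move=> l4 nl kn Aa a0 nra P0 sP Pa.
have [f [rs [cr a_rs]]] := conj_rootsP Aa.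
have [mon_f urs Df cj] := cr.
have k0 : (0 < dob_k l)%N by [].
have n2 : (1 < n)%N by apply: leq_trans kn; rewrite -addn1 leq_add // expn_gt0.
have cjX m (r : algC) : r \in rs -> r ^+ m = 1 -> a ^+ m = 1.
  move=> r_rs rm.
  have E (z : algC) : root (map_poly (ratr : rat -> algC) ('X^m - 1)) z = (z ^+ m == 1).
    by rewrite rmorphB /= map_polyXn rmorph1 /root !hornerE subr_eq0.
  by apply/eqP; rewrite -E; apply: (cj _ r) => //; rewrite E rm.
have nru r m : r \in rs -> (0 < m)%N -> r ^+ m != 1.
  by move=> r_rs m0; apply: contra (nra m m0) => /eqP /(cjX _ _ r_rs) ->.
have rs0 : 0 \notin rs.
  apply/negP => rs0; move/negP: a0; apply.
  have := cj 'X 0 a rs0 a_rs; rewrite map_polyX => h.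
  by have := h (introT eqP (hornerX _)); rewrite /root hornerX.
have d0 : (0 < size rs)%N by case: (rs) a_rs.
have dn : (size rs <= n)%N.
  rewrite -ltnS; apply: leq_trans sP.
  have sPC : size (map_poly (intr : int -> algC) P) = size P.
    by rewrite size_map_inj_poly ?rmorph0 //; exact: intr_inj.
  rewrite -sPC; apply: max_poly_roots => //.
    by rewrite -size_poly_eq0 sPC size_poly_eq0.
  apply/allP => r r_rs; rewrite -map_poly_ratr_int; apply: (cj _ a) => //.
  by rewrite map_poly_ratr_int.
pose drop p := has (fun r => has (fun r' => (r != r') && (r ^+ p == r' ^+ p)) rs) rs.
have dropP p : ~~ drop p -> {in rs &, injective (fun r => r ^+ p)}.
  move=> /hasPn nd r r' r_rs r'_rs e; apply/eqP; apply: contraT => ne.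
  by have /hasPn /(_ r' r'_rs) := nd r r_rs; rewrite ne e eqxx.
have ndrop (s : seq nat) : uniq s -> all prime s -> (size [seq p <- s | drop p] < 4 ^ l)%N.
  move=> us as_; rewrite -(@ltn_exp2l 2) //; apply: leq_ltn_trans nl.
  apply: leq_trans dn; apply: (conj_roots_noninjective_primes cr) => //.
  - by rewrite filter_uniq.
  - by apply/allP => p; rewrite mem_filter => /andP[_]; apply: (allP as_).
  move=> p; rewrite mem_filter => /andP[/hasP[r r_rs /hasP[r' r'_rs /andP[ne /eqP e]]] _].
  by exists r, r'.
have [xb q2b] := dob_bounds l4.
have l0 : (0 < l)%N by apply: leq_trans l4.
have [h1 h2 h3] := dob_lam_bound l4.
have sel (s : seq nat) : uniq s -> all prime s ->
    (size s < size [seq p <- s | ~~ drop p] + 4 ^ l)%N.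
  move=> us as_; have := ndrop s us as_; rewrite !size_filter -(count_predC drop s) addnC.
  by rewrite ltn_add2l.
have apr x (Q : pred nat) : all prime [seq p <- primes_upto x | Q p].
  by apply/allP => p; rewrite mem_filter mem_primes_upto => /and3P[].
pose s1 := [seq p <- primes_upto (dob_x l) | (2 ^ l <= p)%N].
have s1k : (dob_k l ^ 2 <= size [seq p <- s1 | ~~ drop p])%N.
  (* Two losses of at most [4 ^ l] each: the dropped primes, and the primes below [2 ^ l]. *)
  have c1 : (dob_k l ^ 2 + 2 * 4 ^ l <= size (primes_upto (dob_x l)))%N.
    apply: (@size_primes_upto_lower _ (8 * l)) => //.
    - by rewrite !muln_gt0 l0 addn_gt0 expn_gt0.
    - by rewrite muln_gt0.
  have := size_primes_from (dob_x l) (2 ^ l); rewrite -/s1 => c2.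
  have := sel s1 (filter_uniq _ (uniq_primes_upto _)) (apr _ _) => c3.
  have : (2 ^ l <= 4 ^ l)%N by rewrite leq_exp2r.
  lia.
pose ps := take (dob_k l ^ 2) [seq p <- s1 | ~~ drop p].
have ps_sub p : p \in ps -> [/\ prime p, (2 ^ l <= p <= dob_x l)%N & ~~ drop p].
  by move=> /mem_take; rewrite 2!mem_filter mem_primes_upto => /and4P[-> -> -> ->].
have sps : size ps = (dob_k l ^ 2)%N by rewrite size_takel.
have ups : uniq ps by apply/take_uniq/filter_uniq/filter_uniq/uniq_primes_upto.
have [q qQ ndq] : exists2 q, q \in dob_primes l & ~~ drop q.
  apply/hasP; rewrite has_filter -size_eq0 -lt0n.
  (* Discarded are at most [dob_q1 l] primes below [dob_q1 l], fewer than [4 ^ l] dropped primes,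
     and the prime 2. *)
  have c1 : (dob_q1 l + 4 ^ l + 3 <= size (primes_upto (dob_q2 l)))%N.
    apply: (@size_primes_upto_lower _ (16 * l)) => //.
    - by rewrite !muln_gt0 l0 addnS.
    - apply: leq_trans q2b _; rewrite -expnD leq_pexp2l //; lia.
    - by rewrite muln_gt0.
  have c2 := size_primes_from (dob_q2 l) (dob_q1 l).
  pose s2 := [seq p <- primes_upto (dob_q2 l) | (dob_q1 l <= p)%N].
  have c3 : (size s2 <= size (dob_primes l) + 1)%N.
    have -> : dob_primes l = [seq p <- s2 | odd p].
      by rewrite -filter_predI; apply: eq_filter => p /=; rewrite andbC.
    rewrite -(count_predC odd s2) size_filter leq_add2l -size_filter.
    apply: (@uniq_leq_size _ _ [:: 2%N]); first by apply/filter_uniq/filter_uniq/uniq_primes_upto.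
    move=> p; rewrite 2!mem_filter mem_primes_upto inE /= => /and4P[podd _ pp _].
    by case: (even_prime pp) podd => [->//|->].
  have := sel (dob_primes l) (filter_uniq _ (uniq_primes_upto _)) (apr _ _).
  rewrite -/s2 in c2; move=> c4.
  have arith (A B C D F e : nat) : (C + e + 3 <= D -> D <= B + C -> B <= A + 1 ->
    A < F + e -> 0 < F)%N by lia.
  exact: arith c1 c2 c3 c4.
exists q => // W W0 sW W1; apply/negP => Wa.
have qq1 : (dob_q1 l <= q)%N by move: qQ; rewrite mem_filter => /andP[/andP[]].
have := conj_roots_mahler cr a_rs (dropP q ndq) W0 Wa.
move=> h.
have : mahler rs ^+ q.*2 <= (n ^ 2)%:R.
  apply: le_trans h _; apply: le_trans (_ : (size W)%:R <= _).
    rewrite -[X in _ <= X%:R]card_ord -sumr_const ler_sum // => i _.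
    rewrite -[1]/(1%:~R) ler_int -real_normK ?num_real // expr_le1 //.
  rewrite ler_nat; apply: leq_trans sW _; nia.
apply: (@mahler_gap f rs ps n (2 ^ l) (dob_x l) (dob_lam l) q) => //.
- by rewrite d0.
- by apply/allP => p /ps_sub[].
- by apply/allP => p /ps_sub[].
- by move=> p /ps_sub[_ _]; apply: dropP.
- by rewrite -{1}(expn0 2) ltn_exp2l.
- by rewrite -expnM; apply: leq_trans (ltnW nl) _; rewrite leq_exp2l.
Qed.

(** * Reversal, and Newman polynomials modulo 2 *)

(** The reversal [X ^ n * p (1 / X)]. The degree [n] is an argument and is not read off from [p], so
    that [star n] is linear. *)
Definition star (R : nzRingType) (n : nat) (p : {poly R}) : {poly R} :=
  \poly_(i < n.+1) p`_(n - i).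

Lemma coef_star (R : nzRingType) n (p : {poly R}) i :
  (star n p)`_i = if (i <= n)%N then p`_(n - i) else 0.
Proof. by rewrite coef_poly ltnS. Qed.

Lemma size_star (R : nzRingType) n (p : {poly R}) : (size (star n p) <= n.+1)%N.
Proof. exact: size_poly. Qed.

Lemma starD (R : nzRingType) n (p q : {poly R}) : star n (p + q) = star n p + star n q.
Proof.
by apply/polyP => i; rewrite coefD !coef_star coefD; case: ifP; rewrite ?addr0.
Qed.

Lemma starZ (R : nzRingType) n c (p : {poly R}) : star n (c *: p) = c *: star n p.
Proof.
by apply/polyP => i; rewrite coefZ !coef_star coefZ; case: ifP; rewrite ?mulr0.
Qed.

Lemma star_sum (R : nzRingType) n I (r : seq I) (F : I -> {poly R}) :
  star n (\sum_(i <- r) F i) = \sum_(i <- r) star n (F i).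
Proof.
elim: r => [|i r IHr]; rewrite ?big_nil ?big_cons ?starD ?IHr //.
by apply/polyP => i; rewrite coef_star !coef0 if_same.
Qed.

Lemma starXn (R : nzRingType) n t : (t <= n)%N -> star n 'X^t = 'X^(n - t) :> {poly R}.
Proof.
move=> tn; apply/polyP => i; rewrite coef_star !coefXn.
case: ifP => ni; last by case: eqP => // E; lia.
by congr (_%:R : R); congr nat_of_bool; apply/eqP/eqP; lia.
Qed.

Lemma poly_sum_wide (R : nzRingType) n (p : {poly R}) : (size p <= n)%N ->
  p = \sum_(i < n) p`_i *: 'X^i.
Proof.
move=> sp; rewrite -poly_def; apply/polyP => i; rewrite coef_poly.
by case: ltnP => // ni; rewrite nth_default // (leq_trans sp).
Qed.

Lemma starK (R : nzRingType) n (p : {poly R}) : (size p <= n.+1)%N -> star n (star n p) = p.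
Proof.
move=> sp; apply/polyP => i; rewrite !coef_star leq_subr.
case: leqP => ni; first by rewrite subKn.
by rewrite nth_default // (leq_trans sp).
Qed.

Lemma starM (R : comNzRingType) a b (p q : {poly R}) :
  (size p <= a.+1)%N -> (size q <= b.+1)%N ->
  star (a + b) (p * q) = star a p * star b q.
Proof.
move=> sp sq; rewrite {1}(poly_sum_wide sp) {1}(poly_sum_wide sq) mulr_suml star_sum.
rewrite [in RHS](poly_sum_wide sp) [in RHS](poly_sum_wide sq) !star_sum mulr_suml.
apply: eq_bigr => i _; rewrite !mulr_sumr star_sum; apply: eq_bigr => j _.
have ia : (i <= a)%N by rewrite -ltnS.
have jb : (j <= b)%N by rewrite -ltnS.
rewrite -scalerAl -scalerAr -exprD !starZ !starXn ?leq_add //.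
rewrite -scalerAl -scalerAr -exprD; congr (_ *: (_ *: 'X^_)).
by lia.
Qed.

Lemma map_star (R S : nzRingType) (f : {rmorphism R -> S}) n p :
  map_poly f (star n p) = star n (map_poly f p).
Proof.
apply/polyP => i; rewrite coef_map !coef_star /=; case: leqP => _; rewrite ?rmorph0 ?coef_map //.
Qed.

Definition nbit (n : nat) (p : {ffun 'I_n.-1 -> bool}) (i : nat) : bool :=
  [|| i == 0%N, i == n | if insub i.-1 is Some j then p j else false].

Lemma nbit0 n p : @nbit n p 0.
Proof. by []. Qed.

Lemma nbitn n p : @nbit n p n.
Proof. by rewrite /nbit eqxx orbT. Qed.

Lemma nbit_ord n (p : {ffun 'I_n.-1 -> bool}) (j : 'I_n.-1) : nbit p j.+1 = p j.
Proof.
rewrite /nbit /= valK; case: eqP => // E; have := ltn_ord j; lia.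
Qed.

Lemma nbit_out n (p : {ffun 'I_n.-1 -> bool}) i : (n < i)%N -> nbit p i = false.
Proof.
move=> ni; rewrite /nbit insubF; last by lia.
by rewrite orbF; apply/negP => /orP[] /eqP; lia.
Qed.

Lemma coef_newman n (p : {ffun 'I_n.-1 -> bool}) i : (0 < n)%N ->
  (newman_poly p)`_i = (nbit p i)%:R.
Proof.
move=> n0; rewrite /newman_poly !coefD coef1 coefXn coef_sum.
case: (posnP i) => [->|i0].
  rewrite big1 => [|j _]; last by rewrite coefZ coefXn mulr0.
  by rewrite eq_sym eqn0Ngt n0 /= !addr0.
rewrite /= add0r.
case: (ltnP i.-1 n.-1) => h.
  have E : i = (Ordinal h).+1 by rewrite /= prednK.
  rewrite E nbit_ord (bigD1 (Ordinal h)) //= coefZ coefXn eqxx mulr1 big1.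
    by rewrite addr0 (_ : _ == n = false) ?addr0 //; apply/eqP; lia.
  move=> j nj; rewrite coefZ coefXn eqSS eq_sym.
  by rewrite (negPf (nj : (j : nat) != _)) mulr0.
rewrite big1 => [|j _]; last first.
  rewrite coefZ coefXn (_ : _ == _ = false) ?mulr0 //.
  by apply/eqP; have := ltn_ord j; lia.
rewrite add0r; case: eqP => [->|ne]; first by rewrite nbitn.
by rewrite nbit_out //; lia.
Qed.

(* [bool] is used as the field with two elements. *)
Definition bpoly (n : nat) (p : {ffun 'I_n.-1 -> bool}) : {poly bool} :=
  \poly_(i < n.+1) nbit p i.

Lemma coef_bpoly n (p : {ffun 'I_n.-1 -> bool}) i : (bpoly p)`_i = nbit p i.
Proof. by rewrite coef_poly ltnS; case: leqP => // /nbit_out ->. Qed.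

Lemma size_bpoly n (p : {ffun 'I_n.-1 -> bool}) : (size (bpoly p) <= n.+1)%N.
Proof. exact: size_poly. Qed.

Lemma nbit_inj n (p q : {ffun 'I_n.-1 -> bool}) : nbit p =1 nbit q -> p = q.
Proof. by move=> h; apply/ffunP => j; rewrite -!nbit_ord h. Qed.

Definition toggle (n : nat) (p : {ffun 'I_n.-1 -> bool}) (t : nat) : {ffun 'I_n.-1 -> bool} :=
  [ffun j => p j (+) (j.+1 == t)].

Lemma toggleK n t : involutive (@toggle n ^~ t).
Proof. by move=> p; apply/ffunP => j; rewrite !ffunE -addbA addbb addbF. Qed.

Lemma nbit_toggle n (p : {ffun 'I_n.-1 -> bool}) t i : (0 < t < n)%N ->
  nbit (toggle p t) i = nbit p i (+) (i == t).
Proof.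
move=> /andP[t0 tn]; rewrite /nbit; case: eqP => [->|i0].
  by case: (t) t0.
case: eqP => [->|ni]; first by rewrite gtn_eqF.
case: insubP => [j _ /= E|h] /=.
  by rewrite ffunE E prednK // lt0n; apply/eqP.
rewrite (_ : i == t = false) //; apply/eqP; lia.
Qed.

Lemma bpoly_toggle n (p : {ffun 'I_n.-1 -> bool}) t : (0 < t < n)%N ->
  bpoly (toggle p t) = bpoly p + 'X^t.
Proof.
move=> tn; apply/polyP => i.
rewrite coefD !coef_bpoly nbit_toggle // coefXn; by case: (i == t).
Qed.

(* Averaging over the orbits of the involution [toggle]. *)
Lemma sum_toggle_le (R : numFieldType) n t (F G : {ffun 'I_n.-1 -> bool} -> R) :
  (forall p, F p + F (toggle p t) <= G p + G (toggle p t)) -> \sum_p F p <= \sum_p G p.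
Proof.
move=> h; have E (H : {ffun 'I_n.-1 -> bool} -> R) :
    \sum_p H p = \sum_p (H p + H (toggle p t)) / 2.
  rewrite -mulr_suml big_split /= [X in (_ + X)](_ : _ = \sum_p H p).
    by rewrite mulrDl -splitr.
  by rewrite [RHS](reindex_inj (inv_inj (@toggleK n t))).
by rewrite E [X in _ <= X]E ler_sum // => p _; rewrite ler_pM2r // invr_gt0 ltr0n.
Qed.

(* The coefficient of [X ^ j] in [p * star n p], computed in the integers for the
   0-1 lift [p] of [P]. *)
Definition autocorr (n : nat) (P : {poly bool}) (j : nat) : nat :=
  (\sum_(i < j.+1) nat_of_bool (P`_i && P`_(n - j + i))%R)%N.

(** Because the end coefficients are 1, a level is the sum of its two own coefficients and of
    products of coefficients from lower levels. This makes the comparison of two autocorrelations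
    proceed level by level. *)
Lemma autocorrS n (P : {poly bool}) j : P`_0 = true -> P`_n = true -> (j < n)%N ->
  autocorr n P j.+1 = (nat_of_bool (P`_(n - j.+1))%R + nat_of_bool (P`_j.+1)%R +
    \sum_(i < j) nat_of_bool (P`_i.+1 && P`_(n - j.+1 + i.+1))%R)%N.
Proof.
move=> P0 Pn jn; rewrite /autocorr big_ord_recl big_ord_recr /= P0 addn0.
have -> : (n - j.+1 + bump 0 j = n)%N by rewrite /bump leq0n add1n subnK.
by rewrite Pn andbT addnA addnAC.
Qed.

Lemma addE_bool (x y : bool) : x + y = x (+) y.
Proof. by []. Qed.

(** * Collisions of autocorrelations *)

(* If [P = a b] and [Q = a b^*] have the same autocorrelation, toggling the
   coefficient [b_t] can preserve equality at level [t] only where [e_t] vanishes,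
   while it flips [e_(t + m)], [m] being the first asymmetry of [a].
   Hence 2 to the power [\sum_t e_t] has mean at most 1 over collisions, whereas
   2 to the power [- \sum_t e_t] has exponentially small mean. *)
Section CollisionCount.
Variables (al be : nat) (fa : {ffun 'I_al.-1 -> bool}).
Hypotheses (al0 : (0 < al)%N) (albe : (al <= be)%N).
Let n := (al + be)%N.
Let a := bpoly fa.
Let P (b : {ffun 'I_be.-1 -> bool}) := a * bpoly b.
Let Q (b : {ffun 'I_be.-1 -> bool}) := a * star be (bpoly b).
Let e (b : {ffun 'I_be.-1 -> bool}) j : bool := ((a + star al a) * bpoly b)`_j.
Let ok b j := autocorr n (P b) j == autocorr n (Q b) j.

Let P_toggle b t i : (0 < t < be)%N ->
  (P (toggle b t))`_i = (P b)`_i (+) (if (i < t)%N then false else nbit fa (i - t)).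
Proof.
move=> tb; rewrite /P bpoly_toggle // mulrDr coefD coefMXn addE_bool; congr (_ (+) _).
by case: ifP => // _; rewrite coef_bpoly.
Qed.

Let Q_toggle b t i : (0 < t < be)%N ->
  (Q (toggle b t))`_i = (Q b)`_i (+) (if (i < be - t)%N then false else nbit fa (i - (be - t))).
Proof.
move=> tb; rewrite /Q bpoly_toggle // starD starXn; last by case/andP: tb => _ /ltnW.
rewrite mulrDr coefD coefMXn addE_bool; congr (_ (+) _).
by case: ifP => // _; rewrite coef_bpoly.
Qed.

Let e_toggle b t i : (0 < t < be)%N ->
  e (toggle b t) i = e b i (+) (if (i < t)%N then false else
    nbit fa (i - t) (+) (if (i - t <= al)%N then nbit fa (al - (i - t)) else false)).
Proof.
move=> tb; rewrite /e bpoly_toggle // mulrDr coefD coefMXn addE_bool; congr (_ (+) _).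
case: ifP => // _; rewrite coefD coef_bpoly coef_star addE_bool; congr (_ (+) _).
by case: ifP => // _; rewrite coef_bpoly.
Qed.

(** [e] records where [P] and the reversal of [Q] differ: both are multiples of [bpoly b], with
    cofactors [a] and [star al a]. *)
Let eE b j : (j <= n)%N -> e b j = (P b)`_j (+) (Q b)`_(n - j).
Proof.
move=> jn; rewrite /e mulrDl coefD addE_bool; congr (_ (+) _).
have -> : star al a * bpoly b = star n (Q b).
  by rewrite /n starM ?size_bpoly ?size_star // starK ?size_bpoly.
by rewrite coef_star jn.
Qed.

Let PQ_coef0 b : (P b)`_0 = true /\ (Q b)`_0 = true.
Proof. 
rewrite /P /Q /a !coef0M coef_star leq0n subn0 !coef_bpoly.
by rewrite !nbit0 nbitn.
Qed.

Let PQ_coefn b : (P b)`_n = true /\ (Q b)`_n = true.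
Proof.
have E (R : {poly bool}) : R`_n = (star n R)`_0 by rewrite coef_star leq0n subn0.
rewrite !E /P /Q /n !starM ?size_bpoly ?size_star // starK ?size_bpoly //.
rewrite /a !coef0M !coef_star !leq0n !subn0 !coef_bpoly.
by rewrite !nbitn nbit0.
Qed.

(** At level [t = j + 1] the toggle flips only [P_t] on one side and [Q_(n - t)] on the other. If
    [e_t] is set, these two bits differ, so one autocorrelation rises by 1 while the other falls by
    1, and the two cannot agree both before and after. *)
Let ok_step b j : (j.+1.*2 < be)%N -> e b j.+1 -> ok b j.+1 -> ok (toggle b j.+1) j.+1 -> false.
Proof.
move=> jb ej; have jt : (0 < j.+1 < be)%N by rewrite -addnn in jb; lia.
have jn : (j < n)%N by rewrite /n; lia.
have c1 i : (i <= j.+1)%N -> (i < be - j.+1)%N by move: jb; rewrite -addnn; lia.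
have c2 i : (n - j.+1 + i < j.+1)%N = false by move: jb; rewrite /n -addnn; lia.
have c3 i : (al < n - j.+1 + i - j.+1)%N by move: jb; rewrite /n -addnn; lia.
have c4 i : (n - j.+1 + i < be - j.+1)%N = false by move: jb; rewrite /n -addnn; lia.
have c5 i : (n - j.+1 + i - (be - j.+1) = al + i)%N by move: jb; rewrite /n -addnn; lia.
have c6 : (j.+1 <= n)%N by [].
have [[P0 Q0] [Pn Qn]] := (PQ_coef0 b, PQ_coefn b).
have [[P0' Q0'] [Pn' Qn']] := (PQ_coef0 (toggle b j.+1), PQ_coefn (toggle b j.+1)).
rewrite /ok !autocorrS // => /eqP ok1 /eqP ok2; move: ok2.
have -> : (P (toggle b j.+1))`_j.+1 = ~~ (P b)`_j.+1.
  by rewrite P_toggle // ltnn subnn nbit0 addbT.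
have -> : (Q (toggle b j.+1))`_j.+1 = (Q b)`_j.+1.
  by rewrite Q_toggle // c1 // addbF.
have hi i : (i <= j)%N -> (P (toggle b j.+1))`_(n - j.+1 + i) = (P b)`_(n - j.+1 + i).
  by move=> ij; rewrite P_toggle // c2 nbit_out ?addbF.
have lo i : (i < j)%N -> (P (toggle b j.+1))`_i.+1 = (P b)`_i.+1.
  by move=> ij; rewrite P_toggle // ltnS ij addbF.
have hiQ i : (Q (toggle b j.+1))`_(n - j.+1 + i) = (Q b)`_(n - j.+1 + i) (+) nbit fa (al + i).
  by rewrite Q_toggle // c4 c5.
have loQ i : (i < j)%N -> (Q (toggle b j.+1))`_i.+1 = (Q b)`_i.+1.
  by move=> ij; rewrite Q_toggle // c1 ?addbF // ltnS ltnW.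
have -> : (P (toggle b j.+1))`_(n - j.+1) = (P b)`_(n - j.+1).
  by have := hi 0%N isT; rewrite addn0.
have -> : (Q (toggle b j.+1))`_(n - j.+1) = ~~ (Q b)`_(n - j.+1).
  by have := hiQ 0%N; rewrite !addn0 nbitn addbT.
have -> : (\sum_(i < j) nat_of_bool ((P (toggle b j.+1))`_i.+1 && (P (toggle b j.+1))`_(n - j.+1 + i.+1))%R =
  \sum_(i < j) nat_of_bool ((P b)`_i.+1 && (P b)`_(n - j.+1 + i.+1))%R)%N.
  by apply: eq_bigr => i _; rewrite lo // hi.
have -> : (\sum_(i < j) nat_of_bool ((Q (toggle b j.+1))`_i.+1 && (Q (toggle b j.+1))`_(n - j.+1 + i.+1))%R =
  \sum_(i < j) nat_of_bool ((Q b)`_i.+1 && (Q b)`_(n - j.+1 + i.+1))%R)%N.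
  by apply: eq_bigr => i _; rewrite loQ // hiQ nbit_out ?addbF // -addSnnS ltn_addr.
move: ej ok1; rewrite eE // => {c1 c2 c3 c4 c5 c6 hi lo hiQ loQ P0 Q0 Pn Qn P0' Q0' Pn' Qn'}.
move: (\sum_(i < j) _)%N (\sum_(i < j) _)%N => u v.
by case: (P b)`_j.+1; case: (Q b)`_(n - j.+1) => //= _; move: (nat_of_bool _) (nat_of_bool _); clear; lia.
Qed.

(** The toggle changes [P] only between [t] and [t + al], and [Q] only between [be - t] and [n - t],
    whereas level [i] reads the indices at most [i] or at least [n - i]. *)
Let ok_inv b i t : (0 < i < t)%N -> (t.*2 < be)%N -> ok (toggle b t) i = ok b i.
Proof.
rewrite -addnn => it tb; have jt : (0 < t < be)%N by lia.
have c1 s : (s < i.+1)%N -> (s < t)%N by lia.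
have c2 s : (n - i + s < t)%N = false by rewrite /n; lia.
have c3 s : (al < n - i + s - t)%N by rewrite /n; lia.
have c4 s : (s < i.+1)%N -> (s < be - t)%N by lia.
have c5 s : (al < n - i + s - (be - t))%N by rewrite /n; lia.
rewrite /ok /autocorr; congr (_ == _); apply: eq_bigr => s _; congr (nat_of_bool (_ && _)).
- by rewrite P_toggle // c1 // addbF.
- by rewrite P_toggle // c2 nbit_out ?addbF.
- by rewrite Q_toggle // c4 // addbF.
- by rewrite Q_toggle // nbit_out // if_same addbF.
Qed.

Variable m : nat.
Hypotheses (mal : (m <= al)%N) (am : nbit fa m != nbit fa (al - m)).
Hypothesis (asym : forall i, (i < m)%N -> nbit fa i = nbit fa (al - i)).

Let e_inv b t i : (0 < t < be)%N -> (i < t + m)%N -> e (toggle b t) i = e b i.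
Proof.
move=> tb im; rewrite e_toggle //; case: ltnP => ti; first by rewrite addbF.
have itm : (i - t < m)%N by lia.
by rewrite (leq_trans (ltnW itm)) // -asym // addbb addbF.
Qed.

Let e_flip b t : (0 < t < be)%N -> e (toggle b t) (t + m) = ~~ e b (t + m).
Proof.
move=> tb; rewrite e_toggle // ltnNge leq_addr /= addKn mal.
by move: am; case: (nbit fa m) (nbit fa (al - m)) => [] [] //= _; rewrite addbT.
Qed.

Variable R : realFieldType.

Let w1 b j : R := if ok b j.+1 then 2 ^+ (e b j.+1) else 0.
Let w2 b j : R := 2^-1 ^+ (e b (j.+1 + m)).

(** Toggling [k + 1] changes neither the earlier factors nor, as [m] is positive, the bit [e] at
    level [k + 1]. If that bit is 0, both weights are at most 1; otherwise [ok_step] leaves the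
    weight 2 to at most one of the two. *)
Let sum_w1 k : (0 < m)%N -> (k.*2 < be)%N ->
  \sum_b \prod_(j < k) w1 b j <= \sum_(b : {ffun 'I_be.-1 -> bool}) 1.
Proof.
move=> m0; elim: k => [|k IHk] kb.
  by apply: ler_sum => b _; rewrite big_ord0.
have kb' : (k.*2 < be)%N by apply: ltn_trans kb; rewrite ltn_double.
apply: le_trans (IHk kb'); apply: (@sum_toggle_le _ _ k.+1) => b.
have kt : (0 < k.+1 < be)%N by rewrite -addnn in kb; lia.
have E : \prod_(j < k) w1 (toggle b k.+1) j = \prod_(j < k) w1 b j.
  apply: eq_bigr => j _; have jk := ltn_ord j.
  by rewrite /w1 ok_inv // e_inv //; lia.
rewrite !big_ord_recr /= E -mulrDr -mulr2n -mulr_natr; apply: ler_wpM2l.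
  by apply: prodr_ge0 => j _; rewrite /w1; case: ifP => // _; rewrite exprn_ge0.
have ek : e (toggle b k.+1) k.+1 = e b k.+1 by rewrite e_inv // -[X in (X < _)%N]addn0 ltn_add2l.
have st := @ok_step b k kb; rewrite /w1 ek.
move: st; case: (e b k.+1) => st; case: ifP => o1; case: ifP => o2 //=; 
  rewrite ?expr1 ?expr0; try lra.
by have := st isT o1 o2.
Qed.

(** Toggling [k + 1] flips the bit [e] at [k + 1 + m], so the last factor averages to
    [(1 + 1 / 2) / 2 = 3 / 4]. *)
Let sum_w2 k : (k < be)%N ->
  \sum_b \prod_(j < k) w2 b j <= (3 / 4) ^+ k * \sum_(b : {ffun 'I_be.-1 -> bool}) 1.
Proof.
elim: k => [|k IHk] kb.
  by rewrite mul1r; apply: ler_sum => b _; rewrite big_ord0.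
rewrite exprS -mulrA; apply: le_trans (ler_wpM2l _ (IHk (ltnW kb))); last by lra.
rewrite mulr_sumr; apply: (@sum_toggle_le _ _ k.+1) => b.
have kt : (0 < k.+1 < be)%N by [].
have E : \prod_(j < k) w2 (toggle b k.+1) j = \prod_(j < k) w2 b j.
  apply: eq_bigr => j _; have jk := ltn_ord j.
  by rewrite /w2 e_inv // addSn ltnS ltn_add2r.
have : 0 <= \prod_(j < k) w2 b j.
  by apply: prodr_ge0 => j _; rewrite exprn_ge0 // invr_ge0.
rewrite !big_ord_recr /= E; move: (\prod_(j < k) _) => z z0.
by rewrite /w2 e_flip //; case: (e b _); rewrite /= ?expr1 ?expr0; lra.
Qed.

(** The second weight is taken on the levels [m + 1] to [h], where it cancels the first one. Scaling
    by [x] and its inverse balances the two means, 1 and [(3 / 4) ^ s]. *)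
Lemma card_autocorr_collision h : (0 < m)%N -> (m <= h)%N -> (h.*2 < be)%N ->
  #|[set b : {ffun 'I_be.-1 -> bool} | [forall j : 'I_h, autocorr n (bpoly fa * bpoly b) j.+1 ==
      autocorr n (bpoly fa * star be (bpoly b)) j.+1]]|%:R
  <= 2 ^+ be.-1 * (7 / 8) ^+ (h - m) :> R.
Proof.
move=> m0 mh hb; set S := [set b | _]; set s := (h - m)%N; set x : R := (7 / 8) ^+ s.
have x0 : 0 < x by rewrite exprn_gt0 //; lra.
have C : \sum_(b : {ffun 'I_be.-1 -> bool}) 1 = 2 ^+ be.-1 :> R.
  by rewrite sumr_const card_ffun card_bool card_ord natrX.
have b1 := sum_w1 m0 hb; have b2 : _ <= _ := @sum_w2 s _; rewrite C in b1 b2.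
apply: le_trans (_ : \sum_b (x * \prod_(j < h) w1 b j + x^-1 * \prod_(j < s) w2 b j) / 2 <= _).
  rewrite -sum1_card natr_sum big_mkcond /=; apply: ler_sum => b _.
  have B0 : 0 <= \prod_(j < s) w2 b j.
    by apply: prodr_ge0 => j _; rewrite exprn_ge0 // invr_ge0.
  have A0 : 0 <= \prod_(j < h) w1 b j.
    by apply: prodr_ge0 => j _; rewrite /w1; case: ifP => // _; rewrite exprn_ge0.
  case: ifP => [|_]; last by rewrite divr_ge0 ?addr_ge0 ?mulr_ge0 // ?invr_ge0 ltW.
  rewrite inE => /forallP okb.
  (* AM-GM: on a collision the product of the two weights is at least 1. *)
  have : 1 <= (x * \prod_(j < h) w1 b j) * (x^-1 * \prod_(j < s) w2 b j).
    rewrite mulrACA divff ?gt_eqF // mul1r.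
    have -> : \prod_(j < h) w1 b j = \prod_(j < h) 2 ^+ (e b j.+1).
      by apply: eq_bigr => j _; rewrite /w1 ifT //; exact: okb.
    rewrite -(big_mkord predT (fun j => 2 ^+ (e b j.+1))) (big_cat_nat (n := m)) //=.
    have E : (\prod_(m <= j < h) 2 ^+ (e b j.+1)) * \prod_(j < s) w2 b j = 1.
      rewrite -{1}[m]add0n big_addn -/s big_mkord -big_split /= big1 // => j _.
      by rewrite /w2 addSn -exprMn divff ?pnatr_eq0 // expr1n.
    rewrite -mulrA E mulr1 big_mkord.
    apply: (big_ind (fun y => 1 <= y)) => // [y z|j _]; first exact: mulr_ege1.
    by rewrite exprn_ege1 // ler1n.
  have : 0 <= x * \prod_(j < h) w1 b j by rewrite mulr_ge0 // ltW.
  have : 0 <= x^-1 * \prod_(j < s) w2 b j by rewrite mulr_ge0 // invr_ge0 ltW.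
  set u := x * _; set v := x^-1 * _ => v0 u0 uv.
  rewrite ler_pdivlMr // mul1r.
  have : 4 <= (u + v) ^+ 2 by have := sqr_ge0 (u - v); rewrite !expr2; nra.
  by rewrite -[4](_ : 2 ^+ 2 = 4) ?ler_pXn2r ?nnegrE ?addr_ge0 //; rewrite expr2; lra.
rewrite -mulr_suml big_split /= -!mulr_sumr.
have b2' : x^-1 * \sum_b \prod_(j < s) w2 b j <= x * 2 ^+ be.-1.
  have sbe : (s < be)%N by rewrite /s -addnn in hb *; lia.
  rewrite mulrC ler_pdivrMr //; apply: le_trans (b2 sbe) _.
  rewrite mulrAC mulrC [leRHS]mulrC; apply: ler_wpM2l; first by rewrite exprn_ge0.
  (* The constant 7/8 is chosen for this: [3 / 4 <= (7 / 8) ^ 2]. *)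
  by rewrite /x -exprMn; apply: lerXn2r; rewrite ?nnegrE; lra.
have b1' : x * \sum_b \prod_(j < h) w1 b j <= x * 2 ^+ be.-1 by rewrite ler_pM2l.
rewrite [leRHS]mulrC; lra.
Qed.
End CollisionCount.

(** * Counting factorizations with an asymmetric factor *)

Definition sym_prefix al (a : {ffun 'I_al.-1 -> bool}) (m : nat) : bool :=
  [forall i : 'I_m, nbit a i == nbit a (al - i)].

Lemma sum_ffun_bool (R : realFieldType) n :
  \sum_(p : {ffun 'I_n -> bool}) 1 = 2 ^+ n :> R.
Proof. by rewrite sumr_const card_ffun card_bool card_ord natrX. Qed.

(** The condition at index 0 always holds, so [m + 1] conditions only give the exponent [m]; each of
    the others is destroyed or created by toggling its own coefficient. *)
Lemma card_sym_prefix (R : realFieldType) al m : (m.*2 < al)%N ->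
  #|[set a : {ffun 'I_al.-1 -> bool} | sym_prefix a m.+1]|%:R <=
    2 ^+ al.-1 * 2^-1 ^+ m :> R.
Proof.
elim: m => [|m IHm] ma.
  rewrite mulr1 -sum_ffun_bool -sum1_card natr_sum big_mkcond.
  by apply: ler_sum => a _; case: ifP.
have ma' : (m.*2 < al)%N by apply: ltn_trans ma; rewrite ltn_double.
have E k : #|[set a : {ffun 'I_al.-1 -> bool} | sym_prefix a k]|%:R =
    \sum_(a : {ffun 'I_al.-1 -> bool}) (sym_prefix a k)%:R :> R.
  rewrite -sum1_card natr_sum big_mkcond; apply: eq_bigr => a _.
  by rewrite inE; case: (sym_prefix a k).
rewrite exprSr mulrA E; rewrite E in IHm.
apply: le_trans (_ : (\sum_(a : {ffun 'I_al.-1 -> bool}) (sym_prefix a m.+1)%:R) * 2^-1 <= _); last first.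
  by apply: ler_wpM2r (IHm ma'); rewrite invr_ge0.
rewrite mulr_suml; apply: (@sum_toggle_le _ _ m.+1) => a.
have mt : (0 < m.+1 < al)%N by rewrite -addnn in ma; lia.
have S k (b : {ffun 'I_al.-1 -> bool}) : sym_prefix b k.+1 = sym_prefix b k && (nbit b k == nbit b (al - k)).
  apply/forallP/andP => [h|[/forallP h1 h2] i].
    split; last by have := h ord_max.
    by apply/forallP => i; have := h (widen_ord (leqnSn k) i).
  case: (ltnP i k) => ik; first by have := h1 (Ordinal ik).
  by have -> : (i : nat) = k by apply/eqP; rewrite eqn_leq ik -ltnS ltn_ord.
have inv : sym_prefix (toggle a m.+1) m.+1 = sym_prefix a m.+1.
  apply: eq_forallb => i; have := ltn_ord i; move: ma; rewrite -addnn => mm im.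
  rewrite !nbit_toggle // (_ : (i : nat) == m.+1 = false); last by lia.
  by rewrite (_ : (al - i)%N == m.+1 = false) ?addbF //; lia.
rewrite !(S m.+1) inv !nbit_toggle // eqxx (_ : (al - m.+1)%N == m.+1 = false); last first.
  by move: ma; rewrite -addnn; lia.
case: (sym_prefix a m.+1); case: (nbit a m.+1); case: (nbit a (al - m.+1)) => /=; lra.
Qed.

(* The trace modulo 2 of a factorization [P = A B] with [A] not self-reciprocal. *)
Definition nonrec_split n (p : {ffun 'I_n.-1 -> bool}) : Prop :=
  exists al be (fa : {ffun 'I_al.-1 -> bool}) (fb : {ffun 'I_be.-1 -> bool}),
    [/\ (0 < al <= be)%N, (al + be = n)%N, bpoly p = bpoly fa * bpoly fb,
        star al (bpoly fa) != bpoly fa &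
        forall j, (j <= n)%N -> autocorr n (bpoly fa * bpoly fb) j = autocorr n (bpoly fa * star be (bpoly fb)) j].

Lemma card_bigcup_le (T I : finType) (F : I -> {set T}) :
  (#|\bigcup_i F i| <= \sum_i #|F i|)%N.
Proof.
apply: (big_ind2 (fun (A : {set T}) k => #|A| <= k)%N) => [|A k B l hA hB|//].
  by rewrite cards0.
by apply: leq_trans (leq_add hA hB); rewrite cardsU leq_subr.
Qed.

(** For fixed [al] and first asymmetry [m] the two factors have [n - 2] free bits, one less than
    [P]; this bit pays for the exponent [m - 1] of [card_sym_prefix]. The symmetric prefix then
    costs [2 ^ - m] and the collisions cost [(7 / 8) ^ (h - m)], together at most [(7 / 8) ^ h]. As
    the larger factor has degree at least [n / 2], [h] is at least [n %/ 4 - 1]. *)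
Lemma card_nonrec_split (R : realFieldType) n :
  #|[set p : {ffun 'I_n.-1 -> bool} | `[< nonrec_split p >]]|%:R <=
    (n ^ 2)%:R * 2 ^+ n.-1 * (7 / 8) ^+ (n %/ 4).-1 :> R.
Proof.
pose ok al m (x : {ffun 'I_al.-1 -> bool} * {ffun 'I_(n - al).-1 -> bool}) : bool :=
  [&& (0 < m)%N, (0 < al <= n - al)%N, (m.*2 < al)%N, sym_prefix x.1 m, nbit x.1 m != nbit x.1 (al - m) &
    [forall j : 'I_((n - al).-1)./2, autocorr n (bpoly x.1 * bpoly x.2) j.+1 ==
      autocorr n (bpoly x.1 * star (n - al) (bpoly x.2)) j.+1]].
pose T al m := [set x | @ok al m x].
pose img al (x : {ffun 'I_al.-1 -> bool} * {ffun 'I_(n - al).-1 -> bool}) :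
    {ffun 'I_n.-1 -> bool} := [ffun i : 'I_n.-1 => (bpoly x.1 * bpoly x.2)`_i.+1].
have cov : [set p : {ffun 'I_n.-1 -> bool} | `[< nonrec_split p >]] \subset
    \bigcup_(i : 'I_n * 'I_n) [set img i.1 x | x in T i.1 i.2].
  apply/subsetP => p; rewrite inE => /asboolP[al [be [fa [fb]]]] [alb E Dp ns ac].
  have Ebe : be = (n - al)%N by rewrite -E addKn.
  subst be; have alt : (al < n)%N by lia.
  (* The least asymmetric index lies before the middle, since its mirror image is asymmetric as
     well; it is positive, since both end coefficients are 1. *)
  have [m [m0 ma asym am]] : exists m, [/\ (0 < m)%N, (m.*2 < al)%N, sym_prefix fa m &
      nbit fa m != nbit fa (al - m)].
    have exm : exists m, (m <= al)%N && (nbit fa m != nbit fa (al - m)).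
      apply: contrapT => h; move/negP: ns; apply; apply/eqP/polyP => i.
      rewrite coef_star !coef_bpoly; case: leqP => ia; last by rewrite nbit_out.
      by apply/eqP; apply: contraT => ne; case: h; exists i; rewrite ia eq_sym.
    case: (ex_minnP exm) => m /andP[mal am] mmin; exists m.
    have m0 : (0 < m)%N.
      by case: m am {mal mmin} => //; rewrite subn0 nbit0 nbitn.
    split=> //.
      have : (m <= al - m)%N by apply: mmin; rewrite leq_subr subKn // eq_sym.
      have : m != (al - m)%N by apply: contraNneq am => {1}->.
      by rewrite -addnn; lia.
    apply/forallP => i; apply: contraT => ne.
    have := ltn_ord i; rewrite ltnNge => /negP[]; apply: mmin.
    by rewrite ne andbT (leq_trans (ltnW (ltn_ord i))).
  have mn : (m < n)%N by rewrite -addnn in ma; lia.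
  apply/bigcupP; exists (Ordinal alt, Ordinal mn) => //=.
  apply/imsetP; exists (fa, fb).
    rewrite inE /ok m0 alb ma asym am /=; apply/forallP => j; apply/eqP; apply: ac.
    by have := ltn_ord j; lia.
  by apply/ffunP => i; rewrite ffunE /= -Dp coef_bpoly nbit_ord.
apply: le_trans (_ : (\sum_(i : 'I_n * 'I_n) #|T i.1 i.2|)%:R <= _).
  rewrite ler_nat; apply: leq_trans (subset_leq_card cov) _.
  apply: leq_trans (card_bigcup_le _) _.
  by apply: leq_sum => i _; apply: leq_imset_card.
rewrite natr_sum; apply: le_trans (_ : \sum_(i : 'I_n * 'I_n) 2 ^+ n.-1 * (7 / 8) ^+ (n %/ 4).-1 <= _).
  apply: ler_sum => -[[al aln] [m mn]] _ /=.
  set c := (al.-1 + (n - al).-1)%N.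
  case: (boolP [&& (0 < m)%N, (0 < al <= n - al)%N & (m.*2 < al)%N]) => [/and3P[m0 alb ma]|nc]; last first.
    have -> : T al m = set0.
      apply/setP => x; rewrite !inE; apply/negP => /and4P[h1 h2 h3 _].
      by rewrite h1 h2 h3 in nc.
    by rewrite cards0 mulr_ge0 ?exprn_ge0 //; lra.
  pose h := ((n - al).-1)./2.
  have mh : (m <= h)%N by rewrite -addnn in ma; rewrite /h; lia.
  have hb : (h.*2 < n - al)%N by rewrite /h; lia.
  have n4 : ((n %/ 4).-1 <= h)%N by rewrite /h; lia.
  have bnd (a : {ffun 'I_al.-1 -> bool}) :
      \sum_(b : {ffun 'I_(n - al).-1 -> bool}) (ok al m (a, b))%:R <=
      (sym_prefix a m)%:R * (2 ^+ (n - al).-1 * (7 / 8) ^+ (h - m)) :> R.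
    case: (boolP (sym_prefix a m && (nbit a m != nbit a (al - m)))) => [/andP[sm am]|nsm].
      rewrite sm mul1r.
      have mal : (m <= al)%N by rewrite -addnn in ma; lia.
      have asym i : (i < m)%N -> nbit a i = nbit a (al - i).
        by move=> im; apply/eqP; have /forallP /(_ (Ordinal im)) := sm.
      have /andP[al0 albe] := alb.
      apply: le_trans (card_autocorr_collision al0 albe mal am asym R m0 mh hb).
      rewrite -sum1_card natr_sum [leRHS]big_mkcond; apply: ler_sum => b _.
      rewrite inE /ok /= m0 alb ma sm am /= subnKC; last by lia.
      by case: [forall j, _].
    rewrite big1 ?mulr_ge0 ?ler0n ?exprn_ge0 //; first by lra.
    move=> b _; rewrite /ok /=; move: nsm.
    by case: (sym_prefix a m) => /= [/negPf ->|_]; rewrite ?andbF.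
  apply: le_trans (_ : \sum_(a : {ffun 'I_al.-1 -> bool}) (sym_prefix a m)%:R * (2 ^+ (n - al).-1 * (7 / 8) ^+ (h - m)) <= _).
    apply: le_trans (ler_sum _ (fun a _ => bnd a)).
    rewrite pair_bigA /= -sum1_card natr_sum big_mkcond; apply: ler_sum => -[a b] _ /=.
    by rewrite inE; case: (ok al m (a, b)).
  rewrite -mulr_suml.
  have : \sum_(a : {ffun 'I_al.-1 -> bool}) (sym_prefix a m)%:R <= 2 ^+ al.-1 * 2^-1 ^+ m.-1 :> R.
    have ma' : (m.-1.*2 < al)%N by rewrite -addnn in ma *; lia.
    have := card_sym_prefix R ma'; rewrite prednK //; apply: le_trans.
    rewrite -sum1_card natr_sum [leRHS]big_mkcond; apply: ler_sum => a _.
    by rewrite inE; case: (sym_prefix a m).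
  move=> /ler_wpM2r le1; apply: le_trans (le1 _ _) _.
    by rewrite mulr_ge0 ?exprn_ge0 //; lra.
  have -> : 2 ^+ al.-1 * 2^-1 ^+ m.-1 * (2 ^+ (n - al).-1 * (7 / 8) ^+ (h - m)) =
      2 ^+ n.-1 * (2^-1 ^+ m * (7 / 8) ^+ (h - m)) :> R.
    have -> : n.-1 = (al.-1 + (n - al).-1).+1 by lia.
    have -> : 2^-1 ^+ m = 2^-1 * 2^-1 ^+ m.-1 :> R by rewrite -exprS prednK.
    rewrite exprS exprD; move: (2^-1 ^+ m.-1) (2 ^+ al.-1) (2 ^+ (n - al).-1) => u v w.
    by field.
  apply: ler_wpM2l; first by rewrite exprn_ge0.
  apply: le_trans (_ : (7 / 8) ^+ h <= _); last first.
    by apply: ler_wiXn2l => //; lra.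
  rewrite -[in leRHS](subnKC mh) exprD; apply: ler_wpM2r; first by rewrite exprn_ge0 //; lra.
  by apply: lerXn2r; rewrite ?nnegrE; lra.
by rewrite sumr_const card_prod !card_ord mulnn -[X in X <= _]mulr_natl mulrA.
Qed.

(** * Factorizations of Newman polynomials *)

Lemma coef_mul_star (R : comNzRingType) n (Q : {poly R}) j : (j <= n)%N ->
  (Q * star n Q)`_j = \sum_(i < j.+1) Q`_i * Q`_(n - j + i).
Proof.
move=> jn; rewrite coefM; apply: eq_bigr => i _; have ij := ltn_ord i.
by rewrite coef_star ifT; [congr (_ * _`_ _)|]; lia.
Qed.

(** With [k] the order of [a], division by the monic ['Phi_k] stays in Z[x]; the remainder vanishes
    at [a] but has smaller degree than its minimal polynomial ['Phi_k]. *)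
Lemma dvd_Cyclotomic_root (a : algC) m (Y : {poly int}) :
  (0 < m)%N -> a ^+ m = 1 -> root (map_poly intr Y) a ->
  exists2 k, (0 < k)%N & exists J, Y = 'Phi_k * J.
Proof.
move=> m0 am Ya; have [k prim_k _] := prim_order_exists m0 am.
exists k; first exact: prim_order_gt0 prim_k.
have mon := Cyclotomic_monic k.
exists (Pdiv.Ring.rdivp Y 'Phi_k); rewrite mulrC.
rewrite {1}(Pdiv.RingMonic.rdivp_eq mon Y).
set r := Pdiv.Ring.rmodp _ _; suff -> : r = 0 by rewrite addr0.
have [p [Dp mon_p] dvp] := minCpolyP a.
have Dphi : map_poly intr 'Phi_k = minCpoly a.
  by rewrite (Cintr_Cyclotomic prim_k) (minCpoly_cyclotomic prim_k).
have szi (h : {poly int}) : size (map_poly (intr : int -> rat) h) = size h.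
  by rewrite size_map_inj_poly ?rmorph0 //; exact: intr_inj.
have szC (h : {poly int}) : size (map_poly (intr : int -> algC) h) = size h.
  by rewrite size_map_inj_poly ?rmorph0 //; exact: intr_inj.
apply/eqP; apply: contraT => r0.
have ra : root (map_poly intr r) a.
  move: Ya; rewrite {1}(Pdiv.RingMonic.rdivp_eq mon Y) -/r rmorphD rmorphM /=.
  by rewrite /root hornerD hornerM Dphi (rootP (root_minCpoly a)) mulr0 add0r.
have /dvdp_leq : p %| map_poly intr r by rewrite -dvp map_poly_ratr_int.
rewrite -size_poly_eq0 szi size_poly_eq0 => /(_ r0).
rewrite leqNgt -(size_map_poly (ratr : {rmorphism rat -> algC})) -Dp -Dphi szC.
by rewrite Pdiv.Ring.ltn_rmodpN0 ?monic_neq0.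
Qed.

Lemma exists_max_Cyclotomic (P : {poly int}) : P \is monic ->
  exists Phi I, [/\ P = Phi * I, is_cyclotomic_product Phi, Phi \is monic, I \is monic &
    forall k J, (0 < k)%N -> I <> 'Phi_k * J].
Proof.
elim: {P}(size P) {-2}P (leqnn (size P)) => [|s IHs] P sP mP.
  by move: sP; rewrite leqn0 size_poly_eq0 => /eqP P0; rewrite P0 monicE lead_coef0 eq_sym oner_eq0 in mP.
case: (pselect (exists k J, (0 < k)%N /\ P = 'Phi_k * J)) => [[k [J [k0 E]]]|h]; last first.
  exists 1, P; split; rewrite ?mul1r ?monic1 //.
    by exists [::]; rewrite big_nil.
  by move=> k J k0 E; apply: h; exists k, J.
have mJ : J \is monic by move: mP; rewrite E monicMl ?Cyclotomic_monic.
have sJ : (size J <= s)%N.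
  move: sP; rewrite E size_monicM ?Cyclotomic_monic ?monic_neq0 // size_Cyclotomic.
  have := totient_gt0 k; rewrite k0; lia.
have [Phi [I [EJ [sq [asq Esq]] mPhi mI hI]]] := IHs J sJ mJ.
exists ('Phi_k * Phi), I; split=> //; first by rewrite -mulrA -EJ.
  by exists (k :: sq); rewrite /= k0 big_cons -Esq.
by rewrite monicMl ?Cyclotomic_monic.
Qed.

Lemma size_newman n (p : {ffun 'I_n.-1 -> bool}) : (0 < n)%N ->
  size (newman_poly p) = n.+1.
Proof.
move=> n0; apply/eqP; rewrite eqn_leq; apply/andP; split.
  by apply/leq_sizeP => j nj; rewrite coef_newman // nbit_out.
rewrite ltnNge; apply/negP => /leq_sizeP /(_ n (leqnn n)).
by rewrite coef_newman // nbitn.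
Qed.

Lemma newman_monic n (p : {ffun 'I_n.-1 -> bool}) : (0 < n)%N ->
  newman_poly p \is monic.
Proof. by move=> n0; rewrite monicE lead_coefE size_newman // coef_newman // nbitn. Qed.

Lemma bpoly_newman n (p : {ffun 'I_n.-1 -> bool}) : (0 < n)%N ->
  bpoly p = map_poly (intr : int -> bool) (newman_poly p).
Proof.
move=> n0; apply/polyP => i; rewrite coef_bpoly coef_map coef_newman //=.
by case: (nbit p i).
Qed.

Lemma intZ_sq_ge (x : int) : x <= x ^+ 2.
Proof. by nia. Qed.

Lemma intZ_sq_eq (x : int) : x ^+ 2 = x -> x = 0 \/ x = 1.
Proof.
move=> e; have /eqP : x * (x - 1) = 0 by rewrite mulrBr mulr1 -expr2 e subrr.
by rewrite mulf_eq0 subr_eq0 => /orP[] /eqP; auto.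
Qed.

(* Flipping one factor of a 0-1 polynomial [P = A B] preserves the value at 1
   and the sum of the squares of the coefficients; these two agree for a
   polynomial with integer coefficients only if its coefficients are 0 or 1. *)
Lemma star_factor01 n (p : {ffun 'I_n.-1 -> bool}) (A B : {poly int}) a b :
  (0 < n)%N -> newman_poly p = A * B -> size A = a.+1 -> size B = b.+1 ->
  (a + b = n)%N -> exists q : {ffun 'I_n.-1 -> bool}, A * star b B = newman_poly q.
Proof.
move=> n0 PAB sA sB ab; set P := newman_poly p in PAB; set Q := A * star b B.
have sAl : (size A <= a.+1)%N by rewrite sA.
have sBl : (size B <= b.+1)%N by rewrite sB.
have QQ : Q * star n Q = P * star n P.
  by rewrite PAB /Q -ab !starM ?size_star // starK //; ring.
have sQ : (size Q <= n.+1)%N.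
  apply: leq_trans (size_polyMleq _ _) _; rewrite sA addSn /= -ab -addnS.
  by rewrite leq_add2l size_star.
have sP : (size P <= n.+1)%N by rewrite size_newman.
have Q1 : Q.[1] = P.[1].
  rewrite PAB /Q !hornerM; congr (_ * _).
  rewrite (horner_coef_wide _ (size_star b B)) (horner_coef_wide _ sBl).
  rewrite (reindex_inj rev_ord_inj) /=; apply: eq_bigr => i _.
  rewrite coef_star !expr1n !mulr1 ifT; last by lia.
  by congr (_`_ _); have := ltn_ord i; lia.
have sq (R : {poly int}) : (R * star n R)`_n = \sum_(i < n.+1) R`_i ^+ 2.
  by rewrite coef_mul_star // subnn; apply: eq_bigr => i _; rewrite expr2.
have S1 : \sum_(i < n.+1) (Q`_i ^+ 2 - Q`_i) = 0.
  rewrite sumrB -sq QQ sq.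
  have -> : \sum_(i < n.+1) Q`_i = Q.[1].
    rewrite (horner_coef_wide _ sQ); apply: eq_bigr => i _.
    by rewrite expr1n mulr1.
  rewrite Q1 (horner_coef_wide _ sP) -sumrB big1 // => i _.
  by rewrite coef_newman // expr1n mulr1; case: (nbit p i).
have Q01 i : Q`_i = 0 \/ Q`_i = 1.
  case: (ltnP i n.+1) => [ni|ni]; last by left; rewrite nth_default // (leq_trans sQ).
  apply: intZ_sq_eq; apply/eqP; rewrite -subr_eq0.
  have /eqP := S1; rewrite psumr_eq0 => [|j _]; last by rewrite subr_ge0 intZ_sq_ge.
  by move/allP/(_ (Ordinal ni)); apply; rewrite mem_index_enum.
(* This coefficient is the product of the two end coefficients of [Q], which are thereby both 1. *)
have : (Q * star n Q)`_0 = 1.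
  by rewrite QQ coef0M coef_star leq0n subn0 !coef_newman // nbit0 nbitn.
rewrite coef0M coef_star leq0n subn0 => Q0n.
exists [ffun i : 'I_n.-1 => Q`_i.+1 == 1]; apply/polyP => i; rewrite coef_newman //.
have Q0 : Q`_0 = 1 by case: (Q01 0%N) Q0n => -> //; rewrite mul0r.
have Qn : Q`_n = 1 by rewrite Q0 mul1r in Q0n.
case: (posnP i) => [->|i0]; first by rewrite nbit0.
case: (ltngtP i n) => [ni|ni|->]; last by rewrite nbitn.
  have ni' : (i.-1 < n.-1)%N by lia.
  have E : i = (Ordinal ni').+1 by rewrite /= prednK.
  by rewrite E nbit_ord ffunE; case: (Q01 (Ordinal ni').+1) => ->.
by rewrite nbit_out // nth_default // (leq_trans sQ).
Qed.

Lemma bpoly_surj a (c : {poly bool}) : (size c <= a.+1)%N -> c`_0 = true -> c`_a = true ->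
  exists f : {ffun 'I_a.-1 -> bool}, bpoly f = c.
Proof.
move=> sc c0 ca; exists [ffun i : 'I_a.-1 => c`_i.+1]; apply/polyP => i.
rewrite coef_bpoly; case: (posnP i) => [->|i0]; first by rewrite nbit0.
case: (ltngtP i a) => [ia|ia|->]; last by rewrite nbitn.
  have ia' : (i.-1 < a.-1)%N by lia.
  have E : i = (Ordinal ia').+1 by rewrite /= prednK.
  by rewrite E nbit_ord ffunE.
by rewrite nbit_out // nth_default // (leq_trans sc).
Qed.

Lemma autocorr_newman n (p : {ffun 'I_n.-1 -> bool}) j : (0 < n)%N -> (j <= n)%N ->
  (autocorr n (bpoly p) j)%:Z = (newman_poly p * star n (newman_poly p))`_j.
Proof.
move=> n0 jn; rewrite coef_mul_star // /autocorr -natz natr_sum; apply: eq_bigr => i _.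
rewrite !coef_bpoly !coef_newman // -natrM; congr (_%:R).
by case: (nbit p i); case: (nbit p _).
Qed.

Lemma star0_const (A : {poly int}) : (size A <= 1)%N -> star 0 A = A.
Proof.
move=> sA; apply/polyP => i; rewrite coef_star; case: i => [|i] //.
by rewrite [RHS]nth_default ?(leq_trans sA).
Qed.

(** Asymmetry of [A] survives reduction modulo 2. Otherwise [star n P] and [Q = A * star b B] would
    agree modulo 2, hence be equal as 0-1 polynomials, and cancelling [star b B] would give
    [star a A = A]. *)
Lemma newman_split_nonrec_le n (p : {ffun 'I_n.-1 -> bool}) (A B : {poly int}) a b :
  (0 < n)%N -> newman_poly p = A * B -> size A = a.+1 -> size B = b.+1 ->
  (a + b = n)%N -> (a <= b)%N -> star a A != A -> nonrec_split p.
Proof.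
move=> n0 PAB sA sB ab leab nA.
have [q Dq] := star_factor01 n0 PAB sA sB ab.
have sAl : (size A <= a.+1)%N by rewrite sA.
have sBl : (size B <= b.+1)%N by rewrite sB.
pose A2 := map_poly (intr : int -> bool) A; pose B2 := map_poly (intr : int -> bool) B.
have D2 : bpoly p = A2 * B2 by rewrite bpoly_newman // PAB rmorphM.
have Dq2 : bpoly q = A2 * star b B2.
  rewrite bpoly_newman // -Dq rmorphM /=; congr (_ * _).
  exact: (map_star (intr : {rmorphism int -> bool})).
have sA2 : (size A2 <= a.+1)%N by apply: leq_trans (size_poly _ _) _.
have sB2 : (size B2 <= b.+1)%N by apply: leq_trans (size_poly _ _) _.
have /andP[A20 B20] : A2`_0 && B2`_0.
  have : (bpoly p)`_0 by rewrite coef_bpoly nbit0.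
  by rewrite D2 coef0M.
have /andP[A2a B2b] : A2`_a && B2`_b.
  have : (star n (bpoly p))`_0 by rewrite coef_star leq0n subn0 coef_bpoly nbitn.
  by rewrite D2 -ab starM // coef0M !coef_star !leq0n !subn0.
have [fa Dfa] := bpoly_surj sA2 A20 A2a; have [fb Dfb] := bpoly_surj sB2 B20 B2b.
have a0 : (0 < a)%N.
  by rewrite lt0n; apply: contra nA => /eqP a0; rewrite a0 star0_const // sA a0.
exists a, b, fa, fb; rewrite Dfa Dfb; split=> //; first by rewrite a0.
  apply: contra nA => /eqP sfa; apply/eqP.
  have S : star n (A2 * B2) = star a A2 * star b B2 by rewrite -ab starM.
  have E : star n (bpoly p) = bpoly q by rewrite D2 S sfa Dq2.
  have sB0 : star b B != 0.
    apply: contraTneq (newman_monic q n0) => sB0.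
    by rewrite -Dq sB0 mulr0 monicE lead_coef0 eq_sym oner_eq0.
  apply: (mulIf sB0); rewrite -starM // -PAB ab Dq; apply/polyP => i.
  rewrite coef_star !coef_newman //.
  have /polyP /(_ i) := E; rewrite coef_star !coef_bpoly => <-.
  by case: leqP.
move=> j jn; rewrite -Dq2 -D2; apply/eqP; rewrite -eqz_nat !autocorr_newman //.
rewrite -Dq PAB -ab !starM ?size_star // starK //; apply/eqP.
by rewrite (_ : A * B * (star a A * star b B) = A * star b B * (star a A * B)) //; ring.
Qed.

(** The collision count uses the asymmetry of the factor of smaller degree; either of the two may be
    that one, so both are assumed asymmetric. *)
Lemma newman_split_nonrec n (p : {ffun 'I_n.-1 -> bool}) (A B : {poly int}) a b :
  (0 < n)%N -> newman_poly p = A * B -> size A = a.+1 -> size B = b.+1 ->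
  star a A != A -> star b B != B -> nonrec_split p.
Proof.
move=> n0 PAB sA sB nA nB.
have ab : (a + b = n)%N.
  have := size_newman p n0; rewrite PAB size_mul -?size_poly_eq0 ?sA ?sB //; lia.
case: (leqP a b) => h; first exact: (newman_split_nonrec_le n0 PAB sA sB ab h nA).
by apply: (newman_split_nonrec_le n0 _ sB sA _ (ltnW h) nB); rewrite ?PAB 1?mulrC 1?addnC.
Qed.

Lemma norm_root_of_unity (a : algC) m : (0 < m)%N -> a ^+ m = 1 -> `|a| = 1.
Proof.
move=> m0 am; apply/eqP; rewrite -(@pexpr_eq1 _ _ m) // -normrX am normr1 //.
Qed.

(* A polynomial all of whose roots are roots of unity is, up to a constant,
   its own reversal, since inversion is complex conjugation on its roots. *)
Lemma star_all_unity_roots n (P : {poly int}) : P \is monic -> P`_0 = 1 -> size P = n.+1 ->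
  (forall a : algC, root (map_poly intr P) a -> exists2 m, (0 < m)%N & a ^+ m = 1) ->
  star n P = P.
Proof.
move=> mP P0 sP ru.
have [rs] := closed_field_poly_normal (map_poly (intr : int -> algC) P).
have mPC : map_poly (intr : int -> algC) P \is monic by rewrite monic_map.
rewrite (monicP mPC) scale1r => Drs.
have srs : size rs = n.
  apply/eqP; rewrite -eqSS -sP -(size_prod_XsubC rs id) -Drs.
  by rewrite size_map_inj_poly ?rmorph0 //; exact: intr_inj.
have inj : injective (map_poly (intr : int -> algC)).
  by apply: map_inj_poly => //; exact: intr_inj.
have unit_rs r : r \in rs -> r^* * r = 1.
  move=> r_rs; have [|m m0 rm] := ru r; first by rewrite Drs root_prod_XsubC.
  by rewrite mulrC -normCK (norm_root_of_unity m0 rm) expr1n.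
have st : star n (map_poly (intr : int -> algC) P) =
    (\prod_(r <- rs) - r) *: \prod_(r <- rs) ('X - (r^*)%:P).
  rewrite Drs -srs; elim: (rs) unit_rs => [|r s IHs] us.
    rewrite !big_nil scale1r; apply/polyP => i; rewrite coef_star.
    by case: i => [|i] //=; rewrite !coef1.
  have ur := us r (mem_head _ _).
  have {}IHs := IHs (fun x xs => us x (@mem_behead _ (r :: s) x xs)).
  rewrite !big_cons /= -[(size s).+1]add1n starM ?size_XsubC ?size_prod_XsubC // IHs.
  have -> : star 1 ('X - r%:P) = - r *: ('X - (r^*)%:P).
    apply/polyP => i; rewrite coef_star coefZ !coefB !coefX !coefC.
    case: i => [|[|i]] //=; rewrite ?subr0 ?sub0r ?mulr0 ?mulr1 //.
    by rewrite mulrNN mulrC ur.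
  by rewrite -scalerAl -scalerAr scalerA.
have cP : \prod_(r <- rs) ('X - (r^*)%:P) = map_poly intr P.
  have -> : map_poly intr P = map_poly Num.conj (map_poly (intr : int -> algC) P).
    by apply/polyP => i; rewrite !coef_map /= rmorph_int.
  rewrite Drs rmorph_prod; apply: eq_bigr => r _ /=.
  by rewrite rmorphB /= map_polyX map_polyC.
apply: inj; rewrite (map_star (intr : {rmorphism int -> algC})) st cP.
suff -> : \prod_(r <- rs) - r = 1 by rewrite scale1r.
have := congr1 (fun p : {poly algC} => p`_n) st.
rewrite cP coef_star leqnn subnn coefZ !coef_map /= P0.
have -> : P`_n = 1 by rewrite -(monicP mP) lead_coefE sP.
by rewrite mulr1.
Qed.

Lemma exists_algC_root (y : {poly int}) : (1 < size y)%N ->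
  exists a : algC, root (map_poly intr y) a.
Proof.
move=> sy; have [|a ha] := @closed_rootP _ (map_poly (intr : int -> algC) y) _.
  rewrite size_map_inj_poly ?rmorph0 //; last exact: intr_inj.
  by rewrite gtn_eqF.
by exists a.
Qed.

Lemma star_root_fixed n (P A B : {poly int}) a b (x : algC) :
  P = A * B -> size A = a.+1 -> size B = b.+1 -> (a + b = n)%N ->
  star a A = A -> root (map_poly intr A) x -> root (map_poly intr (star n P)) x.
Proof.
move=> -> sA sB ab sAA Ax; rewrite -ab starM ?sA ?sB // sAA rmorphM /=.
by rewrite rootM Ax.
Qed.

Definition shared_root n (p : {ffun 'I_n.-1 -> bool}) : Prop :=
  exists a : algC, [/\ root (map_poly intr (newman_poly p)) a,
    root (map_poly intr (star n (newman_poly p))) a & forall m, (0 < m)%N -> a ^+ m != 1].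

Lemma cyclotomic_product_root Phi (a : algC) : is_cyclotomic_product Phi ->
  root (map_poly intr Phi) a -> exists2 m, (0 < m)%N & a ^+ m = 1.
Proof.
case=> s [as_ ->]; elim: s as_ => [|k s IHs] /=.
  by rewrite big_nil rmorph1 (negPf (root1 _)).
case/andP => k0 as_; rewrite big_cons rmorphM rootM => /orP[ka|/(IHs as_)//].
exists k => //; have dk : k \in divisors k by rewrite -dvdn_divisors.
have : root (map_poly intr ('X^k - 1)) a.
  by rewrite -prod_Cyclotomic // (perm_big _ (perm_to_rem dk)) big_cons rmorphM rootM ka.
rewrite rmorphB /= map_polyXn rmorph1 /root !hornerE subr_eq0 => /eqP //.
Qed.

(** A nontrivial [I = y * z] splits [P] as [y * (Phi * z)]. If one of these two factors is
    palindromic, a root of [y] or of [z] is also a root of [star n P], and by maximality of [Phi] it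
    is not a root of unity; otherwise the flip applies. *)
Lemma good_factorization_newman n (p : {ffun 'I_n.-1 -> bool}) : (0 < n)%N ->
  star n (newman_poly p) <> newman_poly p -> ~ nonrec_split p -> ~ shared_root p ->
  exists Phi I, good_factorization (newman_poly p) Phi I.
Proof.
move=> n0 nsP nsplit nsh; set P := newman_poly p in nsP *.
have mP := newman_monic p n0; have sP := size_newman p n0.
have [Phi [I [EP cP mPhi mI hI]]] := exists_max_Cyclotomic mP.
exists Phi, I; have I0 := monic_neq0 mI; have Phi0 := monic_neq0 mPhi.
have noroot y z : I = y * z -> (1 < size y)%N ->
    (forall a : algC, root (map_poly intr y) a -> root (map_poly intr (star n P)) a) -> False.
  move=> E sy h; have [a ya] := exists_algC_root sy.
  have Pa : root (map_poly intr P) a by rewrite /P EP E !rmorphM !rootM ya orbT.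
  case: (pselect (exists2 m, (0 < m)%N & a ^+ m = 1)) => [[m m0 am]|nru].
    have [k k0 [J EJ]] := dvd_Cyclotomic_root m0 am ya.
    by apply: (hI k (J * z) k0); rewrite E EJ mulrA.
  apply: nsh; exists a; split=> //; first exact: h.
  by move=> m m0; apply/eqP => am; apply: nru; exists m.
split=> //; last first.
  by case=> k [k0 EI]; apply: (hI k 1 k0); rewrite mulr1.
split=> //.
  (* If [I] were a unit, all roots of [P] would be roots of unity and [P] would be its own
     reversal. *)
  apply/negP => uI; apply: nsP.
  have sI : size I = 1%N by move: uI; rewrite poly_unitE => /andP[/eqP].
  have I1 : I = 1.
    have I00 : I`_0 = 1 by rewrite -(monicP mI) lead_coefE sI.
    by rewrite (size1_polyC (eq_leq sI)) I00.
  apply: star_all_unity_roots => //; first by rewrite /P coef_newman // nbit0.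
  by move=> a; rewrite /P EP I1 mulr1; apply: cyclotomic_product_root.
move=> y z E.
have lyz : lead_coef y * lead_coef z = 1 by rewrite -lead_coefM -E (monicP mI).
have unit_of (u v : {poly int}) : lead_coef u * lead_coef v = 1 -> (size u <= 1)%N -> u \is a GRing.unit.
  move=> luv su; have u0 : u != 0.
    by apply: contra_eq_neq luv => ->; rewrite lead_coef0 mul0r eq_sym oner_eq0.
  have s1 : size u = 1%N by apply/eqP; rewrite eqn_leq su size_poly_gt0.
  have -> : u = (lead_coef u)%:P by rewrite lead_coefE s1 /=; apply/size1_polyC.
  rewrite poly_unitE size_polyC lead_coef_eq0 u0 coefC eqxx /=.
  by apply/unitrP; exists (lead_coef v); rewrite mulrC.
case: (leqP (size y) 1) => sy; first by left; apply: unit_of lyz sy.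
case: (leqP (size z) 1) => sz; first by right; apply: (unit_of z y) sz; rewrite mulrC.
exfalso.
have y0 : y != 0 by rewrite -size_poly_gt0 ltnW.
have z0 : z != 0 by rewrite -size_poly_gt0 ltnW.
have Pz0 : Phi * z != 0 by rewrite mulf_neq0.
pose a := (size y).-1; pose b := (size (Phi * z)).-1.
have sa : size y = a.+1 by rewrite prednK // ltnW.
have sb : size (Phi * z) = b.+1 by rewrite prednK // size_poly_gt0.
have EP' : P = y * (Phi * z) by rewrite /P EP E mulrCA.
have ab : (a + b = n)%N.
  by move: sP; rewrite -/P EP' size_mul // sa sb addSn addnS /= => -[].
case: (eqVneq (star a y) y) => sty.
  apply: (noroot y z E sy) => x yx; exact: (star_root_fixed EP' sa sb ab sty yx).
(* The root is taken from [z] and not from [Phi], whose roots are all roots of unity. *)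
case: (eqVneq (star b (Phi * z)) (Phi * z)) => stz.
  apply: (noroot z y _ sz); first by rewrite mulrC.
  move=> x zx; apply: (star_root_fixed (a := b) (b := a) _ sb sa _ stz).
  - by rewrite mulrC.
  - by rewrite addnC.
  - by rewrite rmorphM rootM zx orbT.
by apply: nsplit; apply: (newman_split_nonrec n0 EP' sa sb).
Qed.

(** * Roots shared with the reversal *)

Definition avoids n (js : seq nat) (p : {ffun 'I_n.-1 -> bool}) : bool :=
  all (fun j => ~~ (nbit p j && nbit p (n - j))) js.

(** Three of the four patterns on each pair are allowed, and the pairs are disjoint. The average
    over a pair is taken in two toggles: the one at [j] gives the weight [1 - nbit p (n - j) / 2],
    and the one at [n - j] turns it into 3/4. *)
Lemma card_avoids (R : realFieldType) n (js : seq nat) :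
  uniq js -> all (fun j => 0 < j < n - j)%N js ->
  #|[set p : {ffun 'I_n.-1 -> bool} | avoids js p]|%:R <=
     2 ^+ n.-1 * (3 / 4) ^+ size js :> R.
Proof.
pose F l (p : {ffun 'I_n.-1 -> bool}) : R := (avoids l p)%:R.
have E l : #|[set p : {ffun 'I_n.-1 -> bool} | avoids l p]|%:R = \sum_p F l p.
  rewrite -sum1_card natr_sum big_mkcond; apply: eq_bigr => p _.
  by rewrite inE /F; case: (avoids l p).
rewrite E; elim: js => [|j js IHjs] /=.
  by move=> _ _; rewrite mulr1 -sum_ffun_bool.
case/andP => jjs ujs /andP[jn ajs].
rewrite exprS mulrCA; apply: le_trans (ler_wpM2l _ (IHjs ujs ajs)); last by lra.
have Finv t p : t = j \/ t = (n - j)%N -> F js (toggle p t) = F js p.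
  move=> tj; rewrite /F /avoids; congr (nat_of_bool _)%:R; apply: eq_in_all => i ijs.
  have ne : i != j by apply: contraNneq jjs => <-.
  have := allP ajs i ijs => ib.
  have tn : (0 < t < n)%N by case: tj => ->; lia.
  have n1 : (i == t) = false by apply/eqP; move/eqP: ne; case: tj => ->; lia.
  have n2 : (n - i == t)%N = false by apply/eqP; move/eqP: ne; case: tj => ->; lia.
  by rewrite !nbit_toggle // n1 n2 !addbF.
have F0 p : 0 <= F js p by rewrite ler0n.
have jn1 : (0 < j < n)%N by lia.
have jn2 : (0 < n - j < n)%N by lia.
have jn3 : (n - j == j)%N = false by apply/eqP; lia.
have jn4 : (j == n - j)%N = false by apply/eqP; lia.
apply: le_trans (_ : \sum_p (1 - (nbit p (n - j))%:R / 2) * F js p <= _).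
  apply: (@sum_toggle_le _ _ j) => p; rewrite (Finv j p (or_introl erefl)).
  rewrite [F (j :: js) _]/F [F (j :: js) (toggle _ _)]/F /avoids /= -!/(avoids _ _).
  rewrite !nbit_toggle // eqxx jn3 addbF.
  have := Finv j p (or_introl erefl); rewrite /F => h.
  have {h} -> : avoids js (toggle p j) = avoids js p.
    by move/eqP: h; rewrite eqr_nat; case: avoids; case: avoids.
  by case: (nbit p j); case: (nbit p (n - j)); case: (avoids js p) => /=; lra.
rewrite mulr_sumr; apply: (@sum_toggle_le _ _ (n - j)) => p.
rewrite (Finv _ p (or_intror erefl)) nbit_toggle // eqxx.
by have := F0 p; case: (nbit p (n - j)) => /= h; lra.
Qed.

(* Erasing both ones of a symmetric pair does not change [P - star n P]. *)
Definition erase_pairs n (js : seq nat) (p : {ffun 'I_n.-1 -> bool}) : {ffun 'I_n.-1 -> bool} :=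
  [ffun i : 'I_n.-1 => p i && ~~ [&& (i.+1 \in js) || (n - i.+1 \in js)%N, nbit p i.+1 & nbit p (n - i.+1)]].

Lemma nbit_erase_pairs n js (p : {ffun 'I_n.-1 -> bool}) i : all (fun j => 0 < j < n - j)%N js ->
  nbit (erase_pairs js p) i = nbit p i && ~~ [&& (i \in js) || (n - i \in js)%N, nbit p i & nbit p (n - i)].
Proof.
move=> ajs; have njs j : (n <= j)%N || (j == 0)%N -> j \in js = false.
  by move=> nj; apply/negP => /(allP ajs); lia.
case: (posnP i) => [->|i0]; first by rewrite !nbit0 subn0 !njs ?leqnn // eqxx orbT.
case: (ltngtP i n) => [ni|ni|->].
- have ni' : (i.-1 < n.-1)%N by lia.
  have -> : i = (Ordinal ni').+1 by rewrite /= prednK.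
  by rewrite nbit_ord ffunE nbit_ord.
- by rewrite nbit_out // (nbit_out p ni).
- by rewrite !nbitn subnn !njs ?leqnn // eqxx orbT.
Qed.

Lemma avoids_erase_pairs n js (p : {ffun 'I_n.-1 -> bool}) : all (fun j => 0 < j < n - j)%N js ->
  avoids js (erase_pairs js p).
Proof.
move=> ajs; apply/allP => j js_j; have := allP ajs j js_j => jn.
rewrite !nbit_erase_pairs // js_j /= subKn; last by lia.
by rewrite js_j orbT /=; case: (nbit p j); case: (nbit p (n - j)).
Qed.

Lemma erase_pairs_antisym n js (p : {ffun 'I_n.-1 -> bool}) i : (i <= n)%N ->
  all (fun j => 0 < j < n - j)%N js ->
  (nbit (erase_pairs js p) i)%:R - (nbit (erase_pairs js p) (n - i))%:R =
  (nbit p i)%:R - (nbit p (n - i))%:R :> int.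
Proof.
move=> ni ajs; rewrite !nbit_erase_pairs // subKn // [(n - i \in js)%N || _]orbC.
by case: (_ || _); case: (nbit p i); case: (nbit p (n - i)).
Qed.

Definition sep_root n (q : nat) (p : {ffun 'I_n.-1 -> bool}) (a : algC) : Prop :=
  [/\ root (map_poly intr (newman_poly p)) a,
    root (map_poly intr (star n (newman_poly p))) a &
    forall W : {poly int}, W != 0 -> (size W <= n.+1)%N ->
      (forall i, `|W`_i| <= 1) -> ~~ root (map_poly intr W) (a ^+ q)].

Definition anti n (p : {ffun 'I_n.-1 -> bool}) : {poly int} :=
  newman_poly p - star n (newman_poly p).

Lemma coef_anti n (p : {ffun 'I_n.-1 -> bool}) i : (0 < n)%N -> (i <= n)%N ->
  (anti p)`_i = (nbit p i)%:R - (nbit p (n - i))%:R.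
Proof. by move=> n0 ni; rewrite coefB coef_star ni !coef_newman. Qed.

Lemma size_anti n (p : {ffun 'I_n.-1 -> bool}) : (0 < n)%N -> (size (anti p) <= n)%N.
Proof.
move=> n0; apply/leq_sizeP => i; rewrite leq_eqVlt => /orP[/eqP <-|ni].
  by rewrite coef_anti // subnn nbit0 nbitn subrr.
by rewrite coefB coef_star leqNgt ni subr0 coef_newman // nbit_out.
Qed.

Lemma anti_erase_pairs n js (p : {ffun 'I_n.-1 -> bool}) : (0 < n)%N ->
  all (fun j => 0 < j < n - j)%N js -> anti (erase_pairs js p) = anti p.
Proof.
move=> n0 ajs; apply/polyP => i; case: (leqP i n) => ni.
  by rewrite !coef_anti // erase_pairs_antisym.
by rewrite !nth_default // (leq_trans (size_anti _ n0)) // ltnW.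
Qed.

(* The difference [p - p'] is supported on the single class [2 i = n] modulo [q],
   so it is [X ^ c * W(X ^ q)] with [W] having coefficients in {-1, 0, 1}. *)
Lemma sep_root_inj n q js (p p' : {ffun 'I_n.-1 -> bool}) (a : algC) :
  (0 < n)%N -> (0 < q)%N -> odd q ->
  all (fun j => 0 < j < n - j)%N js -> all (fun j => q %| n - j.*2)%N js ->
  erase_pairs js p = erase_pairs js p' -> sep_root q p a -> sep_root q p' a -> p = p'.
Proof.
move=> n0 q0 oq ajs qjs enf [Pa _ sep] [P'a _ _].
pose U := newman_poly p - newman_poly p'.
have UE i : U`_i = (nbit p i)%:R - (nbit p' i)%:R by rewrite coefB !coef_newman.
case: (eqVneq U 0) => [U0|U0].
  apply: nbit_inj => i; have /eqP := UE i; rewrite U0 coef0 eq_sym subr_eq0 eqr_nat.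
  by case: (nbit p i); case: (nbit p' i).
have supp i : U`_i != 0 -> (i <= n)%N /\ (i.*2 = n %[mod q])%N.
  move=> Ui; have ni : (i <= n)%N.
    by rewrite leqNgt; apply: contra Ui => ni; rewrite UE !nbit_out ?subrr.
  split=> //; have /(congr1 (fun f => nbit f i)) := enf; rewrite !nbit_erase_pairs //.
  have dj j : j \in js -> (q %| n - j.*2)%N /\ (j.*2 <= n)%N.
    by move=> h; have := allP ajs j h; have -> := allP qjs j h; rewrite -addnn; lia.
  case: (boolP (i \in js)) => [/dj [qd ijn] _|nij].
    by apply/eqP; rewrite eq_sym eqn_mod_dvd.
  case: (boolP (n - i \in js)%N) => [/dj [qd ijn] _|nij'].
    have E : (n - (n - i).*2 = i.*2 - n)%N by rewrite -!addnn; lia.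
    by apply/eqP; rewrite eqn_mod_dvd ?E in qd *; rewrite -?addnn in ijn *; rewrite ?addnn; lia.
  rewrite /= !andbT => e; by rewrite UE e subrr eqxx in Ui.
have [i0 Ui0] : exists i0, U`_i0 != 0.
  by exists (size U).-1; rewrite -lead_coefE lead_coef_eq0.
pose r := (i0 %% q)%N.
have suppr i : U`_i != 0 -> (i %% q = r)%N.
  move=> /supp[_ e]; have [_ e0] := supp _ Ui0; rewrite -e0 in e.
  apply/eqP; have cq : coprime q 2 by rewrite coprimen2.
  case: (leqP i0 i) => h.
    by rewrite eqn_mod_dvd // -(Gauss_dvdr _ cq) mulnBr !mul2n -eqn_mod_dvd ?leq_double //; apply/eqP.
  have h' := ltnW h; rewrite eq_sym eqn_mod_dvd // -(Gauss_dvdr _ cq) mulnBr !mul2n.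
  by rewrite -eqn_mod_dvd ?leq_double // eq_sym; apply/eqP.
pose W : {poly int} := \poly_(t < n.+1) U`_(r + q * t).
have UW : U = 'X^r * (W \Po 'X^q).
  apply/polyP => j; rewrite coefXnM; case: ltnP => jr.
    apply/eqP; apply: contraT => /suppr E; move: jr.
    by rewrite -E ltnNge leq_mod.
  rewrite coef_comp_poly_Xn //; case: ifP => qd.
    have E : (r + q * ((j - r) %/ q) = j)%N by rewrite mulnC divnK ?subnKC.
    rewrite coef_poly E; case: ltnP => // nt; apply/eqP; apply: contraT => /supp[jn _].
    by move: nt; rewrite ltnNge (leq_trans (leq_div _ _)) // (leq_trans (leq_subr _ _)).
  apply/eqP; apply: contraT => /suppr E; move: qd; rewrite -eqn_mod_dvd //.
  by rewrite /r modn_mod E eqxx.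
have W0 : W != 0 by apply: contraNneq U0 => W0; rewrite UW W0 comp_poly0 mulr0.
have W1 i : `|W`_i| <= 1.
  rewrite coef_poly; case: ifP => // _; rewrite UE.
  by case: (nbit p _); case: (nbit p' _).
have /negP[] := sep W W0 (size_poly _ _) W1.
have : root (map_poly (intr : int -> algC) U) a.
  by rewrite rmorphB /= /root hornerD hornerN (rootP Pa) (rootP P'a) subrr.
rewrite UW rmorphM rootM /= map_polyXn map_comp_poly map_polyXn => /orP[|].
  rewrite /root hornerXn expf_eq0 => /andP[_ /eqP a0].
  move: Pa; rewrite a0 /root horner_coef0 coef_map coef_newman // nbit0.
  by rewrite rmorph1 oner_eq0.
by rewrite /root horner_comp hornerXn.
Qed.

(** [p] is encoded by its erased form and the position of the shared root among the roots of
    [anti p]. Erasing preserves [anti p], and [rts] is a function of the polynomial, so the code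
    determines the root, and [sep_root_inj] then gives [p]. *)
Lemma card_sep_root (R : realFieldType) n q js : (0 < n)%N -> (0 < q)%N -> odd q ->
  uniq js -> all (fun j => 0 < j < n - j)%N js -> all (fun j => q %| n - j.*2)%N js ->
  #|[set p : {ffun 'I_n.-1 -> bool} |
      `[< star n (newman_poly p) <> newman_poly p /\ exists a, sep_root q p a >]]|%:R <=
  n.+1%:R * (2 ^+ n.-1 * (3 / 4) ^+ size js) :> R.
Proof.
move=> n0 q0 oq ujs ajs qjs; set B := [set p | _].
apply: le_trans (ler_wpM2l (ler0n _ _) (card_avoids R ujs ajs)).
set S := [set p | avoids js p].
pose rts (G : {poly int}) : seq algC := sval (closed_field_poly_normal (map_poly intr G)).
pose al (p : {ffun 'I_n.-1 -> bool}) : algC :=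
  if pselect (exists a, sep_root q p a) is left ex then sval (cid ex) else 0.
pose h p : 'I_n.+1 * {ffun 'I_n.-1 -> bool} :=
  (inord (index (al p) (rts (anti p))), erase_pairs js p).
have alP p : p \in B -> sep_root q p (al p) /\ (al p \in rts (anti p)) /\ (size (rts (anti p)) <= n)%N.
  rewrite inE => /asboolP[ns [a sa]]; have sal : sep_root q p (al p).
    by rewrite /al; case: pselect => [ex|[]]; [exact: (svalP (cid ex)) | exists a].
  split=> //; have D0 : anti p != 0 by rewrite subr_eq0 eq_sym; apply/eqP.
  have D0C : map_poly (intr : int -> algC) (anti p) != 0.
    rewrite -size_poly_eq0 size_map_inj_poly ?rmorph0 ?size_poly_eq0 //; exact: intr_inj.
  have E := svalP (closed_field_poly_normal (map_poly (intr : int -> algC) (anti p))).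
  rewrite -/(rts _) in E; have lc0 : lead_coef (map_poly (intr : int -> algC) (anti p)) != 0.
    by rewrite lead_coef_eq0.
  split.
    rewrite -root_prod_XsubC -(rootZ _ _ lc0) -E.
    by case: sal => r1 r2 _; rewrite rmorphB /= /root hornerD hornerN (rootP r1) (rootP r2) subrr.
  have := size_anti p n0.
  rewrite -(@size_map_inj_poly _ algC (intr : int -> algC)) ?rmorph0 //; last exact: intr_inj.
  by rewrite E size_scale // size_prod_XsubC => /ltnW.
have hinj : {in B &, injective h}.
  move=> p p' pB p'B [ei en].
  have [s1 [m1 z1]] := alP p pB; have [s2 [m2 z2]] := alP p' p'B.
  have ea : anti p = anti p' by rewrite -(anti_erase_pairs p n0 ajs) en anti_erase_pairs.
  have : al p = al p'.
    rewrite -(nth_index 0 m1) -(nth_index 0 m2) -ea; congr (nth 0 _ _).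
    have := congr1 val ei; rewrite -ea /= !inordK // ltnS.
      by rewrite (leq_trans (index_size _ _)) // ea.
    by rewrite (leq_trans (index_size _ _)).
  by move=> eal; apply: (sep_root_inj n0 q0 oq ajs qjs en s1); rewrite eal.
rewrite -natrM ler_nat -(card_in_imset hinj).
have -> : (n.+1 * #|S| = #|setX [set: 'I_n.+1] S|)%N by rewrite cardsX cardsT card_ord.
apply: subset_leq_card; apply/subsetP => _ /imsetP[p pB ->].
by rewrite !inE /= avoids_erase_pairs.
Qed.

(** The indices solve [2 * j = n - q * t]. As [q] is odd, [t] must have the parity of [n]; [t i]
    runs through the positive integers of that parity. *)
Lemma exists_progression n q : odd q -> exists js : seq nat,
  [/\ uniq js, all (fun j => 0 < j < n - j)%N js, all (fun j => q %| n - j.*2)%N js &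
      size js = ((n - 2) %/ q.*2)%N].
Proof.
move=> oq; set s := ((n - 2) %/ q.*2)%N.
have q0 : (0 < q)%N by case: (q) oq.
pose t i := (i.*2.+1 + ~~ odd n)%N.
pose j i := (n - q * t i)./2.
have tn i : (i < s)%N -> (q * t i + 2 <= n)%N.
  move=> is_; have h1 : (i.+1 * q.*2 <= n - 2)%N.
    by apply: leq_trans (leq_trunc_div (n - 2) q.*2); rewrite leq_mul2r is_ orbT.
  have h2 : (q * t i <= i.+1 * q.*2)%N.
    by rewrite -muln2 mulnCA leq_mul2l -[X in _ || X]/(_ <= _)%N /t; case: (odd n); lia.
  have : (0 < i.+1 * q.*2)%N by rewrite muln_gt0 double_gt0.
  by lia.
have jE i : (i < s)%N -> ((j i).*2 = n - q * t i)%N.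
  move=> /tn h; rewrite /j -[RHS]odd_double_half [X in _ = (X + _)%N](_ : _ = 0%N) //.
  rewrite oddB; last by lia.
  by rewrite oddM oq /= /t oddD /= odd_double /=; case: (odd n).
exists [seq j i | i <- iota 0 s]; split; last by rewrite size_map size_iota.
- rewrite map_inj_in_uniq ?iota_uniq // => i i'; rewrite !mem_iota !add0n /= => hi hi' e.
  have := jE i hi; rewrite e jE // => e2.
  have : (q * t i = q * t i')%N by have := tn i hi; have := tn i' hi'; lia.
  by move/eqP; rewrite eqn_pmul2l // /t => /eqP; lia.
- apply/allP => z /mapP[i]; rewrite mem_iota add0n /= => hi ->.
  have := jE i hi; have := tn i hi; rewrite -addnn.
  have : (0 < q * t i)%N by rewrite muln_gt0 q0.
  lia.
apply/allP => z /mapP[i]; rewrite mem_iota add0n /= => hi ->.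
by rewrite jE // subKn ?dvdn_mulr //; have := tn i hi; lia.
Qed.

Lemma card_shared_root (R : realFieldType) n l :
  (4 <= l)%N -> (n < 2 ^ 4 ^ l)%N -> (dob_k l + dob_k l ^ 2 <= n)%N ->
  #|[set p : {ffun 'I_n.-1 -> bool} |
      `[< star n (newman_poly p) <> newman_poly p /\ shared_root p >]]|%:R <=
  (dob_q2 l).+1%:R * n.+1%:R * 2 ^+ n.-1 * (3 / 4) ^+ ((n - 2) %/ (dob_q2 l).*2) :> R.
Proof.
move=> l4 nl kn; set B := [set p | _].
have n0 : (0 < n)%N by apply: leq_trans kn; rewrite addn_gt0.
pose Bq (q : 'I_(dob_q2 l).+1) : {set {ffun 'I_n.-1 -> bool}} :=
  if (q : nat) \in dob_primes l then [set p : {ffun 'I_n.-1 -> bool} |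
      `[< star n (newman_poly p) <> newman_poly p /\ exists a, sep_root q p a >]] else set0.
have sub : B \subset \bigcup_q Bq q.
  apply/subsetP => p; rewrite inE => /asboolP[ns [a [Pa sPa nra]]].
  have mP := newman_monic p n0; have sP := size_newman p n0.
  have [q qQ sep] : exists2 q, q \in dob_primes l & forall W : {poly int}, W != 0 -> (size W <= n.+1)%N ->
      (forall i, `|W`_i| <= 1) -> ~~ root (map_poly intr W) (a ^+ q).
    apply: (exists_separating_prime l4 nl kn _ _ nra (monic_neq0 mP) _ Pa); rewrite ?sP //.
      apply: (root_monic_Aint Pa); first by rewrite monic_map.
      by apply/polyOverP => i; rewrite coef_map intr_int.
    apply: contraTneq Pa => ->; rewrite /root horner_coef0 coef_map coef_newman // nbit0.
    by rewrite rmorph1 oner_eq0.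
  have q2 : (q < (dob_q2 l).+1)%N.
    by move: qQ; rewrite mem_filter mem_primes_upto ltnS => /and3P[].
  apply/bigcupP; exists (Ordinal q2) => //; rewrite /Bq /= qQ inE.
  by apply/asboolP; split=> //; exists a.
apply: le_trans (_ : (\sum_q #|Bq q|)%:R <= _).
  by rewrite ler_nat; apply: leq_trans (subset_leq_card sub) (card_bigcup_le _).
rewrite natr_sum; set c := n.+1%:R * (2 ^+ n.-1 * (3 / 4) ^+ ((n - 2) %/ (dob_q2 l).*2)) : R.
apply: le_trans (_ : \sum_(q < (dob_q2 l).+1) c <= _); last first.
  by rewrite sumr_const card_ord -[X in X <= _]mulr_natl /c !mulrA.
apply: ler_sum => q _; rewrite /Bq; case: ifP => [qQ|_]; last first.
  by rewrite cards0 mulr_ge0 // mulr_ge0 ?exprn_ge0 //; lra.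
move: (qQ); rewrite mem_filter mem_primes_upto => /andP[/andP[_ oq] /andP[pq _]].
have [js [ujs ajs qjs sjs]] := exists_progression n oq.
apply: le_trans (card_sep_root R n0 (prime_gt0 pq) oq ujs ajs qjs) _.
rewrite /c sjs; apply: ler_wpM2l => //; apply: ler_wpM2l; first by rewrite exprn_ge0.
apply: ler_wiXn2l; [lra|lra|].
by apply: leq_div2l; rewrite ?double_gt0 ?prime_gt0 // leq_double -ltnS.
Qed.

Lemma card_palindromic (R : realFieldType) n : (0 < n)%N ->
  #|[set p : {ffun 'I_n.-1 -> bool} | star n (newman_poly p) == newman_poly p]|%:R <=
  2 ^+ n.-1 * 2^-1 ^+ (n.-1)./2 :> R.
Proof.
move=> n0; have h : ((n.-1)./2.*2 < n)%N by have := odd_double_half n.-1; lia.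
apply: le_trans (card_sym_prefix R h); rewrite ler_nat; apply: subset_leq_card.
apply/subsetP => p; rewrite !inE => /eqP e; apply/forallP => i.
have ni : (i <= n)%N by have := ltn_ord i; move: h; rewrite -addnn; lia.
have /polyP /(_ i) := e; rewrite coef_star ni !coef_newman // => /eqP.
by rewrite eqr_nat eq_sym; case: (nbit p i); case: (nbit p (n - i)).
Qed.

(** * Cyclotomic factors of large degree *)

(** This bounds the indices of the cyclotomic factors of a polynomial of given degree. By
    multiplicativity it is enough to look at prime powers, for which [p ^ e <= totient (p ^ e) ^ 2]
    except that [p = 2] costs a factor 2. *)
Lemma totient_sq_ge k : (k <= 2 * totient k ^ 2)%N.
Proof.
case: (posnP k) => [->//|k0]; rewrite totientE // [X in (X <= _)%N](prod_prime_decomp k0).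
rewrite prime_decompE big_map /=.
apply: leq_trans (_ : \prod_(p <- primes k) ((if p == 2 then 2 else 1) * (p.-1 * p ^ (logn p k).-1) ^ 2) <= _)%N.
  rewrite big_seq [X in (_ <= X)%N]big_seq leq_prod // => p pk.
  move: (pk); rewrite mem_primes => /and3P[pp _ _].
  have : (0 < logn p k)%N by rewrite logn_gt0.
  have p1 := prime_gt1 pp.
  case: (logn p k) => // e _; rewrite /= expnS.
  have pe : (0 < p ^ e)%N by rewrite expn_gt0 prime_gt0.
  case: eqP => [->|/eqP p2]; first by rewrite mul1n; nia.
  have p3 : (3 <= p)%N by rewrite ltn_neqAle eq_sym p2.
  rewrite mul1n; have : (p <= p.-1 ^ 2)%N by nia.
  nia.
rewrite big_split /= leq_mul //.
  rewrite -big_mkcond big_const_seq iter_muln_1 -[X in (_ <= X)%N](expn1 2) leq_pexp2l //.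
  by rewrite (eq_count (a2 := pred1 2%N)) // count_uniq_mem ?primes_uniq // leq_b1.
rewrite (eq_bigr (fun p => p.-1 * p ^ (logn p k).-1 * (p.-1 * p ^ (logn p k).-1)))%N.
  by rewrite big_split /= mulnn.
by move=> p _; rewrite mulnn.
Qed.

Lemma filter_pred1_nseq (T : eqType) (x : T) (s : seq T) :
  [seq y <- s | y == x] = nseq (count_mem x s) x.
Proof. by elim: s => //= y s ->; case: eqP => [->|_]; rewrite ?add1n ?add0n. Qed.

Fixpoint cyc_prods (K D : nat) : seq {poly int} :=
  if K is K'.+1 then
    flatten [seq [seq 'Phi_K ^+ m * g | g <- cyc_prods K' (D - m * totient K)] |
             m <- iota 0 D.+1 & (m * totient K <= D)%N]
  else if D == 0%N then [:: 1] else [::].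

Lemma cyc_prodsS K D : cyc_prods K.+1 D =
  flatten [seq [seq 'Phi_K.+1 ^+ m * g | g <- cyc_prods K (D - m * totient K.+1)] |
             m <- iota 0 D.+1 & (m * totient K.+1 <= D)%N].
Proof. by []. Qed.

Lemma cyc_prods_mem K (s : seq nat) : all (fun k => 0 < k <= K)%N s ->
  \prod_(k <- s) 'Phi_k \in cyc_prods K (\sum_(k <- s) totient k).
Proof.
elim: K s => [|K IHK] s as_.
  case: s as_ => [_|k s /= /andP[]]; last by case: k.
  by rewrite !big_nil inE.
have pf : perm_eq s ([seq k <- s | k == K.+1] ++ [seq k <- s | k != K.+1]).
  by rewrite perm_sym perm_filterC.
set s' := [seq k <- s | k != K.+1] in pf.
have as' : all (fun k => 0 < k <= K)%N s'.
  apply/allP => k; rewrite mem_filter => /andP[kK /(allP as_) /andP[-> kK1]].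
  by rewrite -ltnS ltn_neqAle kK.
rewrite !(perm_big _ pf) !big_cat filter_pred1_nseq !big_nseq.
set m := count_mem K.+1 s; rewrite GRing.iter_mulr_1 iter_addn_0.
rewrite [X in cyc_prods _ X]/= [X in X \in _]/=; set D := (X in cyc_prods _ X).
have mD : (m * totient K.+1 <= D)%N by rewrite mulnC leq_addr.
rewrite cyc_prodsS; apply/flattenP; exists [seq 'Phi_K.+1 ^+ m * g | g <- cyc_prods K (D - m * totient K.+1)].
  apply: (map_f (fun m => [seq 'Phi_K.+1 ^+ m * g | g <- cyc_prods K (D - m * totient K.+1)])).
  rewrite mem_filter mD mem_iota add0n ltnS /=.
  apply: leq_trans mD; rewrite -[X in (X <= _)%N]muln1 leq_mul2l totient_gt0 orbT //.
by apply: map_f; rewrite /D mulnC addKn; apply: IHK.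
Qed.

Lemma geom_le (R : realFieldType) (t : R) n : 0 <= t < 1 ->
  (\sum_(m < n) t ^+ m) * (1 - t) <= 1.
Proof.
move=> /andP[t0 t1]; have := subrX1 t n; rewrite mulrC => h.
have -> : (\sum_(m < n) t ^+ m) * (1 - t) = 1 - t ^+ n by rewrite -[LHS]opprK -mulrN opprB -h opprB.
by rewrite gerBl exprn_ge0.
Qed.

(** The left side peaks at [m = 4] with the value 640/81, just below 8, and decreases from there
    on. *)
Lemma pow23_bound (R : realFieldType) m : (0 < m)%N ->
  (2 / 3) ^+ m * (2 * m%:R ^+ 2 + 8) <= 8 :> R.
Proof.
case: m => // m _.
case: m => [|m]; first by rewrite expr1; lra.
case: m => [|m]; first by rewrite !expr2; lra.
case: m => [|m]; first by rewrite !exprS expr0; lra.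
elim: m => [|m IHm]; first by rewrite !exprS expr0; lra.
rewrite exprS; apply: le_trans IHm; rewrite -mulrA mulrCA; apply: ler_wpM2l.
  by rewrite exprn_ge0 //; lra.
have : 0 <= m%:R :> R by rewrite ler0n.
rewrite -[m.+1.+4]addn1 -[m.+4]/(4 + m)%N !natrD; move: (m%:R : R) => z z0; rewrite !expr2; nra.
Qed.

Lemma bernoulli_ineq (R : realFieldType) (x : R) k : 0 <= x -> 1 + k%:R * x <= (1 + x) ^+ k.
Proof.
move=> x0; elim: k => [|k IHk]; first by rewrite mul0r addr0.
rewrite exprS; apply: le_trans (_ : (1 + x) * (1 + k%:R * x) <= _).
  have k0 : 0 <= k%:R * x * x by rewrite !mulr_ge0.
  by rewrite -addn1 natrD; nra.
by apply: ler_wpM2l IHk; rewrite addr_ge0.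
Qed.

(** Allowing the index [K + 1] multiplies the bound by at most [1 / (1 - t)], the sum over its
    multiplicities, where [t = (2 / 3) ^ totient K.+1]. Since [K + 1 <= 2 * totient K.+1 ^ 2], this
    is at most [1 + 8 / (K + 1)], hence by Bernoulli at most [((K + 2) / (K + 1)) ^ 8], and the
    product telescopes. *)
Lemma size_cyc_prods (R : realFieldType) K D :
  (size (cyc_prods K D))%:R <= K.+1%:R ^+ 8 * (3 / 2) ^+ D :> R.
Proof.
elim: K D => [|K IHK] D.
  rewrite /= expr1n mul1r; case: D => [|D] /=; first by rewrite expr0.
  by rewrite exprn_ge0 //; lra.
set phi := totient K.+1; have phi0 : (0 < phi)%N by rewrite totient_gt0.
rewrite cyc_prodsS -/phi size_flatten /shape -map_comp sumnE big_map big_filter natr_sum.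
set t : R := (2 / 3) ^+ phi.
have t0 : 0 <= t by rewrite exprn_ge0 //; lra.
have k1 : 0 < K.+1%:R :> R by rewrite ltr0n.
have kphi : K.+1%:R <= 2 * phi%:R ^+ 2 :> R.
  by rewrite -natrX -natrM ler_nat totient_sq_ge.
have tk : t * (K.+1%:R + 8) <= 8.
  apply: le_trans (pow23_bound R phi0); apply: ler_wpM2l => //; lra.
have t1 : t < 1 by nra.
apply: le_trans (_ : \sum_(m <- iota 0 D.+1) K.+1%:R ^+ 8 * (3 / 2) ^+ D * t ^+ m <= _).
  rewrite big_mkcond; apply: ler_sum => m _; case: ifP => [mD|_]; last first.
    by rewrite !mulr_ge0 ?exprn_ge0 //; lra.
  rewrite /= size_map; apply: le_trans (IHK _) _; rewrite -mulrA; apply: ler_wpM2l.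
    by rewrite exprn_ge0.
  rewrite -[in leRHS](subnK mD) exprD -mulrA /t -exprM [(phi * m)%N]mulnC -exprMn.
  by rewrite (_ : 3 / 2 * (2 / 3) = 1) ?expr1n ?mulr1 //; field.
rewrite -mulr_sumr mulrAC; apply: ler_wpM2r; first by rewrite exprn_ge0 //; lra.
have -> : \sum_(m <- iota 0 D.+1) t ^+ m = \sum_(m < D.+1) t ^+ m.
  by rewrite -(big_mkord predT (fun m => t ^+ m)) /index_iota subn0.
have := @geom_le R t D.+1; rewrite t0 t1 => /(_ isT); set S := \sum_(m < _) _ => hS.
have S0 : 0 <= S by apply: sumr_ge0 => m _; rewrite exprn_ge0.
have le1 : S <= 1 + 8 * K.+1%:R^-1.
  rewrite -(ler_pM2l k1) mulrDr mulr1 mulrCA divff ?gt_eqF // mulr1.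
  nra.
have le2 := @bernoulli_ineq R K.+1%:R^-1 8; rewrite invr_ge0 ltW // in le2.
apply: le_trans (_ : K.+1%:R ^+ 8 * (1 + K.+1%:R^-1) ^+ 8 <= _).
  apply: ler_wpM2l; first by rewrite exprn_ge0.
  exact: le_trans le1 (le2 isT).
rewrite -exprMn mulrDr mulr1 divff ?gt_eqF // -[1]/(1%:R) -natrD addn1 //.
Qed.

(** Modulo 2 the monic [g] keeps its degree and the cofactor has constant coefficient 1, so its
    coefficients of index 1 to [n - D] determine [P]. *)
Lemma card_newman_multiples n D (g : {poly int}) : (0 < n)%N -> g \is monic ->
  size g = D.+1 ->
  (#|[set p : {ffun 'I_n.-1 -> bool} | `[< exists I, newman_poly p = (g * I)%R >]]| <= 2 ^ (n - D))%N.
Proof.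
move=> n0 mg sg; set S := [set p | _].
pose g2 := map_poly (intr : int -> bool) g.
have mg2 : g2 \is monic by rewrite monic_map.
have g20 : g2 != 0 by rewrite monic_neq0.
have sg2 : size g2 = D.+1.
  rewrite /g2 size_map_poly_id0 // (monicP mg) rmorph1 oner_eq0 //.
pose h (p : {ffun 'I_n.-1 -> bool}) : {ffun 'I_(n - D) -> bool} :=
  [ffun i : 'I_(n - D) => (bpoly p %/ g2)`_i.+1].
have dv p : p \in S -> bpoly p = bpoly p %/ g2 * g2.
  rewrite inE => /asboolP[I E]; rewrite divpK //.
  by rewrite bpoly_newman // E rmorphM /= dvdp_mulr.
have hinj : {in S &, injective h}.
  move=> p p' pS p'S eh; apply: nbit_inj => i; rewrite -!coef_bpoly.
  rewrite (dv p) // (dv p') //; congr ((_ * g2)`_i); apply/polyP => j.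
  have sz (q : {ffun 'I_n.-1 -> bool}) : (size (bpoly q %/ g2)%R <= n.+1 - D)%N.
    by rewrite size_divp // sg2 /= leq_sub2r // size_bpoly.
  have c0 (q : {ffun 'I_n.-1 -> bool}) : q \in S -> (bpoly q %/ g2)`_0 = true.
    move=> /dv; set u := _ %/ _ => E.
    have : (bpoly q)`_0 by rewrite coef_bpoly nbit0.
    by rewrite E coef0M => /andP[].
  case: j => [|j]; first by rewrite !c0.
  case: (ltnP j (n - D)) => jn.
    by have /ffunP /(_ (Ordinal jn)) := eh; rewrite !ffunE.
  by rewrite !nth_default // (leq_trans (sz _)) //; lia.
rewrite -(card_in_imset hinj); apply: leq_trans (max_card _) _.
by rewrite card_ffun card_bool card_ord.
Qed.

Lemma size_prod_Cyclotomic (s : seq nat) :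
  size (\prod_(k <- s) 'Phi_k) = (\sum_(k <- s) totient k).+1.
Proof.
elim: s => [|k s IHs]; first by rewrite !big_nil size_poly1.
rewrite !big_cons size_monicM ?Cyclotomic_monic ?monic_neq0 ?monic_prod //.
  by rewrite IHs size_Cyclotomic addnS.
by move=> *; apply: Cyclotomic_monic.
Qed.

(** Only indices [k] with [totient k <= n] occur, whence [k <= 2 * n ^ 2]. The degree [D]
    contributes [(3 / 2) ^ D * 2 ^ (n - D) = 2 ^ n * (3 / 4) ^ D], up to a power of [n]. *)
Lemma card_cyclotomic_part (R : realFieldType) n T : (0 < n)%N ->
  #|[set p : {ffun 'I_n.-1 -> bool} | `[< exists Phi I, [/\ newman_poly p = Phi * I,
       is_cyclotomic_product Phi & (T <= (size Phi).-1)%N] >]]|%:R <=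
  n.+1%:R * (2 * n ^ 2).+1%:R ^+ 8 * 2 ^+ n * (3 / 4) ^+ T :> R.
Proof.
move=> n0; set B := [set p | _]; set K := (2 * n ^ 2)%N.
pose M g := [set p : {ffun 'I_n.-1 -> bool} |
   `[< (g \is monic) /\ exists I, newman_poly p = g * I >]].
have cov : B \subset \bigcup_(D < n.+1 | (T <= D)%N)
   \bigcup_(i < size (cyc_prods K D) | size (nth 0 (cyc_prods K D) i) == D.+1) M (nth 0 (cyc_prods K D) i).
  apply/subsetP => p; rewrite inE => /asboolP[Phi [I [E [s [as_ EPhi]] TPhi]]].
  pose D := (\sum_(k <- s) totient k)%N.
  have sPhi : size Phi = D.+1 by rewrite EPhi size_prod_Cyclotomic.
  have mPhi : Phi \is monic by rewrite EPhi monic_prod // => *; apply: Cyclotomic_monic.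
  have Dn : (D < n.+1)%N.
    have := size_newman p n0; rewrite E size_monicM // ?sPhi.
      have : (0 < size I)%N.
        by rewrite size_poly_gt0; apply: contraTneq (newman_monic p n0) => I0; rewrite E I0 mulr0 monicE lead_coef0 eq_sym oner_eq0.
      lia.
    by apply: contraTneq (newman_monic p n0) => I0; rewrite E I0 mulr0 monicE lead_coef0 eq_sym oner_eq0.
  have Phic : Phi \in cyc_prods K D.
    rewrite EPhi; apply: cyc_prods_mem; apply/allP => k ks; rewrite (allP as_) //=.
    apply: leq_trans (totient_sq_ge k) _; rewrite leq_mul2l /= leq_exp2r //.
    by rewrite -ltnS; apply: leq_ltn_trans Dn; rewrite /D (perm_big _ (perm_to_rem ks)) big_cons leq_addr.
  apply/bigcupP; exists (Ordinal Dn); first by rewrite sPhi in TPhi.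
  have iPhi : (index Phi (cyc_prods K D) < size (cyc_prods K D))%N by rewrite index_mem.
  apply/bigcupP; exists (Ordinal iPhi); rewrite /= nth_index ?sPhi //.
  by rewrite inE; apply/asboolP; split=> //; exists I.
have cbu (J : finType) (P : pred J) (F : J -> {set {ffun 'I_n.-1 -> bool}}) :
    (#|\bigcup_(j | P j) F j| <= \sum_(j | P j) #|F j|)%N.
  rewrite big_mkcond [X in (_ <= X)%N]big_mkcond; apply: leq_trans (card_bigcup_le _) _.
  by apply: leq_sum => j _; case: (P j); rewrite ?cards0.
apply: le_trans (_ : (\sum_(D < n.+1 | (T <= D)%N) size (cyc_prods K D) * 2 ^ (n - D))%:R <= _).
  rewrite ler_nat; apply: leq_trans (subset_leq_card cov) _.
  apply: leq_trans (cbu _ _ _) _; apply: leq_sum => D _.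
  apply: leq_trans (cbu _ _ _) _.
  apply: leq_trans (_ : \sum_(i < size (cyc_prods K D)) 2 ^ (n - D) <= _)%N; last first.
    by rewrite sum_nat_const card_ord.
  rewrite big_mkcond; apply: leq_sum => i _; case: eqP => // sg.
  case: (boolP (nth 0 (cyc_prods K D) i \is monic)) => [mg|nmg].
    apply: leq_trans (card_newman_multiples n0 mg sg); apply: subset_leq_card.
    by apply/subsetP => p; rewrite !inE => /asboolP[_ h]; apply/asboolP.
  rewrite (_ : M _ = set0) ?cards0 //; apply/setP => p; rewrite !inE; apply/asboolP => -[h].
  by rewrite h in nmg.
rewrite natr_sum; set c : R := K.+1%:R ^+ 8 * 2 ^+ n * (3 / 4) ^+ T.
have c0 : 0 <= c by rewrite !mulr_ge0 ?exprn_ge0 //; lra.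
apply: le_trans (_ : \sum_(D < n.+1) c <= _); last first.
  by rewrite sumr_const card_ord -[X in X <= _]mulr_natl /c !mulrA.
rewrite big_mkcond; apply: ler_sum => D _; case: ifP => // TD.
have Dn : (D <= n)%N by rewrite -ltnS.
move: (nat_of_ord D) Dn TD => {}D Dn TD.
rewrite natrM natrX.
apply: le_trans (_ : K.+1%:R ^+ 8 * (3 / 2) ^+ D * 2 ^+ (n - D) <= _).
  by apply: ler_wpM2r (size_cyc_prods R K D); rewrite exprn_ge0.
rewrite /c -[leLHS]mulrA -[leRHS]mulrA; apply: ler_wpM2l; first by apply: exprn_ge0; rewrite ler0n.
apply: le_trans (_ : 2 ^+ n * (3 / 4) ^+ D <= _).
  rewrite -[in leRHS](subnK Dn) exprD mulrC -mulrA -exprMn (_ : 2 * (3 / 4) = 3 / 2) //.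
  by field.
apply: ler_wpM2l; first by rewrite exprn_ge0.
by apply: ler_wiXn2l => //; lra.
Qed.

(** * Asymptotics *)

Lemma expR_ge_pow (R : realType) (x : R) k : 0 <= x -> (0 < k)%N -> (x / k%:R) ^+ k <= expR x.
Proof.
move=> x0 k0; have -> : expR x = expR (x / k%:R) ^+ k.
  by rewrite -expRM_natl [_ * (x / _)]mulrC divfK // pnatr_eq0 -lt0n.
apply: lerXn2r; rewrite ?nnegrE ?expR_ge0 ?divr_ge0 //.
by apply: le_trans (expR_ge1Dx _); rewrite lerDr.
Qed.

Lemma ln2_ge_half (R : realType) : 2^-1 <= ln 2 :> R.
Proof.
have := @le_ln1Dx R (- 2^-1); have -> : 1 + - 2^-1 = 2^-1 :> R by field.
rewrite lnV ?posrE //; lra.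
Qed.

Lemma linear_le_quadratic (R : realFieldType) (u v x : R) : 0 < v ->
  u * x <= v * x ^+ 2 + u ^+ 2 / v.
Proof.
move=> v0; have := sqr_ge0 (2 * v * x - u) => h.
have h2 := sqr_ge0 u.
rewrite -(ler_pM2l v0) mulrDr [v * (_ / v)]mulrC divfK ?gt_eqF //.
by rewrite !expr2 in h h2 *; nra.
Qed.

(** At [x = ln n] this absorbs the factor [n ^ 2] into half of the decay. The sixth power in
    [expR x >= (x / 6) ^ 6] leaves a quadratic term after division by [x ^ 4], which dominates the
    linear [2 * x]. *)
Lemma expR_absorb (R : realType) (c x : R) : 0 < c -> 0 < x ->
  expR (2 * x - c * (expR x / x ^+ 4)) <=
  expR (2 ^+ 2 / (c / 2 / 6 ^+ 6)) * expR (- (c / 2 * (expR x / x ^+ 4))).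
Proof.
move=> c0 x0; set y := expR x / x ^+ 4.
have hy : x ^+ 2 / 6 ^+ 6 <= y.
  rewrite /y ler_pdivlMr ?exprn_gt0 // mulrAC -exprD -expr_div_n.
  exact: expR_ge_pow (ltW x0) _.
have v0 : 0 < c / 2 / 6 ^+ 6 by rewrite !divr_gt0 // exprn_gt0.
have := linear_le_quadratic 2 x v0; set K := 2 ^+ 2 / _ => h.
rewrite -expRD ler_expR.
have : c / 2 * (x ^+ 2 / 6 ^+ 6) <= c / 2 * y by rewrite ler_pM2l // divr_gt0.
have -> : c / 2 * (x ^+ 2 / 6 ^+ 6) = c / 2 / 6 ^+ 6 * x ^+ 2 by ring.
move: (c / 2 / _ * _) h => z h; lra.
Qed.

Lemma pow_le_expR (R : realType) (a d : R) m (t : R) : 0 < a < 1 -> t - d <= m%:R ->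
  a ^+ m <= expR (- ln a * d) * expR (- (- ln a * t)).
Proof.
move=> /andP[a0 a1] td; have la : ln a < 0 by rewrite ln_lt0 // a0 a1.
rewrite -[a in leLHS]lnK ?posrE // -expRM_natl -expRD ler_expR -mulr_natl.
have : 0 <= (- ln a) * (m%:R - (t - d)) by rewrite mulr_ge0 ?oppr_ge0 ?subr_ge0 // ltW.
lra.
Qed.

Lemma uniform_pr_ge (R : realType) n (bad : {set {ffun 'I_n.-1 -> bool}})
    (E : {poly int} -> Prop) : (0 < n)%N ->
  (forall p, p \notin bad -> E (newman_poly p)) ->
  1 - #|bad|%:R / 2 ^+ n.-1 <= uniform_pr R (newman_polys n) E.
Proof.
move=> n0 h; rewrite /uniform_pr card_newman_polys // natrX.
have pw : 0 < 2 ^+ n.-1 :> R by rewrite exprn_gt0.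
rewrite ler_pdivlMr // mulrBl mul1r divfK ?gt_eqF // lerBlDr -natrX -natrD ler_nat.
have inj : injective (@newman_poly n).
  move=> p q e; apply: nbit_inj => i; have /eqP : (newman_poly p)`_i = (newman_poly q)`_i by rewrite e.
  by rewrite !coef_newman // eqr_nat; case: (nbit p i); case: (nbit q i).
have <- : #|{ffun 'I_n.-1 -> bool}| = (2 ^ n.-1)%N by rewrite card_ffun card_bool card_ord.
rewrite -(cardsC bad) addnC leq_add2r.
have <- : #|` [fset newman_poly p | p in ~: bad]%fset| = #|~: bad|.
  by rewrite card_in_imfset /= ?cardE // => p q _ _; apply: inj.
apply: fsubset_leq_card; apply/fsubsetP => P /imfsetP[p /= pb ->].
rewrite !inE /=; apply/andP; split; first by apply/imfsetP; exists p.
by apply/asboolP/h; move: pb; rewrite inE.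
Qed.

(** [4 ^ l] is the first power of 4 that reaches [T + 1], so it is at most [4 * T], and the
    threshold 64 forces [l >= 4]. The constant is [2 ^ 40 = 2 * 2 ^ 31 * 4 ^ 4]. *)
Lemma dob_level n : (64 <= trunc_log 2 n)%N ->
  exists l, [/\ (4 <= l)%N, (n < 2 ^ 4 ^ l)%N, (dob_k l + dob_k l ^ 2 <= n)%N &
    ((dob_q2 l).*2 <= 2 ^ 40 * trunc_log 2 n ^ 4)%N].
Proof.
move=> T64; set T := trunc_log 2 n in T64 *.
have n0 : (0 < n)%N by case: n @T T64.
have /andP[nT Tn] : (2 ^ T <= n < 2 ^ T.+1)%N by apply: trunc_log_bounds.
have /andP[] : (4 ^ (up_log 4 T.+1).-1 < T.+1 <= 4 ^ up_log 4 T.+1)%N.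
  by apply: up_log_bounds => //; lia.
set l := up_log 4 T.+1 => lT Tl.
have l4 : (4 <= l)%N.
  have : (4 ^ 3 < 4 ^ l)%N by apply: leq_trans Tl; apply: T64.
  by rewrite ltn_exp2l.
exists l; split => //.
- by apply: leq_trans Tn _; rewrite leq_exp2l.
- have [_ _ lam] := dob_lam_bound l4.
  have D1 : (1 <= 4 ^ l)%N by rewrite expn_gt0.
  have kD : (dob_k l <= 32 * 4 ^ l)%N by rewrite /dob_k; lia.
  apply: leq_trans nT.
  have : (2 ^ (11 + 4 * l) <= 2 ^ T)%N.
    rewrite leq_exp2l //; apply: leq_trans (_ : 4 ^ l.-1 <= _)%N; last by rewrite -ltnS.
    move: l4; clear; case: l => // k; rewrite ltnS /=.
    elim: k => // k IH; rewrite leq_eqVlt => /orP[/eqP <- //|k3].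
    by have := IH k3; rewrite expnS; lia.
  apply: leq_trans; rewrite expnD (expnM 2 4) -[(2 ^ 4)%N]/(4 * 4)%N expnMn.
  have : (dob_k l * dob_k l <= 32 * 4 ^ l * (32 * 4 ^ l))%N by apply: leq_mul.
  rewrite -[(2 ^ 11)%N]/(1024 + 1024)%N -mulnn.
  by move: D1 kD; move: (4 ^ l)%N (dob_k l) => D k; nia.
- have [_ q2] := dob_bounds l4.
  have l0 : (0 < l)%N by apply: leq_trans l4.
  have D : (4 ^ l <= 4 * T)%N by rewrite -(prednK l0) expnS leq_mul2l /= -ltnS.
  have : (4 ^ l * 4 ^ l * (4 ^ l * 4 ^ l) <= 4 * T * (4 * T) * (4 * T * (4 * T)))%N.
    by rewrite !leq_mul.
  rewrite -muln2.
  have e : (2 ^ (8 * l) = 4 ^ l * 4 ^ l * (4 ^ l * 4 ^ l))%N.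
    by rewrite -!expnMn -[(4 * 4 * (4 * 4))%N]/(2 ^ 8)%N -expnM.
  rewrite e in q2; move: q2 => q2 h.
  have -> : (2 ^ 40 * T ^ 4 = 2 ^ 31 * (4 * T * (4 * T) * (4 * T * (4 * T))) * 2)%N.
    have E u v : (2 ^ (u + v).+1 = 2 ^ u * 2 ^ v * 2)%N by rewrite expnSr expnD.
    rewrite -[40%N]/((31 + 8).+1)%N E.
    have -> : (2 ^ 8 = 256)%N by [].
    move: (2 ^ 31)%N => c; clear; ring.
  by rewrite leq_mul2r /=; apply: leq_trans q2 _; rewrite leq_mul2l h orbT.
Qed.

(** [d] stands for the rounding losses in the exponent [m]; they only enter [C]. *)
Lemma pow_absorb (R : realType) (a d c0 : R) : 0 < a < 1 -> 0 < c0 ->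
  exists c C : R, [/\ 0 < c, 0 < C & forall (x : R) m, 0 < x ->
    c0 * (expR x / x ^+ 4) - d <= m%:R ->
    expR (2 * x) * a ^+ m <= C * expR (- (c * (expR x / x ^+ 4)))].
Proof.
move=> a01 c00; have la : 0 < - ln a by rewrite oppr_gt0 ln_lt0.
pose c1 := - ln a * c0; have c10 : 0 < c1 by rewrite mulr_gt0.
exists (c1 / 2), (expR (- ln a * d) * expR (2 ^+ 2 / (c1 / 2 / 6 ^+ 6))).
split; [by rewrite divr_gt0|by rewrite mulr_gt0 ?expR_gt0|move=> x m x0 hm].
have := pow_le_expR a01 hm => h.
apply: le_trans (ler_wpM2l (expR_ge0 _) h) _.
rewrite mulrCA -[leRHS]mulrA ler_pM2l ?expR_gt0 // -[leLHS]expRD (mulrA (- ln a)) -/c1.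
exact: expR_absorb.
Qed.

(** * Decay of the failure probabilities *)

Definition fail_set n : {set {ffun 'I_n.-1 -> bool}} :=
  [set p | `[< ~ exists Phi I, good_factorization (newman_poly p) Phi I >]].

Lemma divn_ge (R : realFieldType) n q : (0 < q)%N -> n%:R / q%:R - 1 <= (n %/ q)%:R :> R.
Proof.
move=> q0; rewrite lerBlDr ler_pdivrMr ?ltr0n // natr1 -natrM ler_nat.
by rewrite ltnW // ltn_ceil.
Qed.

Lemma card_fail_set_le n :
  (0 < n)%N -> (#|fail_set n| <=
    #|[set p : {ffun 'I_n.-1 -> bool} | `[< star n (newman_poly p) <> newman_poly p /\ shared_root p >]]|
    + #|[set p : {ffun 'I_n.-1 -> bool} | `[< nonrec_split p >]]|
    + #|[set p : {ffun 'I_n.-1 -> bool} | star n (newman_poly p) == newman_poly p]|)%N.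
Proof.
move=> n0; set A := [set p | _]; set B := [set p | _]; set C := [set p | _].
have sub : fail_set n \subset A :|: B :|: C.
  apply/subsetP => p; rewrite !inE => /asboolP np.
  case: eqP => [_|pal]; rewrite ?orbT // orbF.
  apply: contra_notT np; rewrite negb_or => /andP[/asboolP h1 /asboolP h2].
  by apply: good_factorization_newman => // h; apply: h1.
apply: leq_trans (subset_leq_card sub) _.
by do 2 (apply: leq_trans (leq_card_setU _ _) _; rewrite ?leq_add2r).
Qed.

Lemma fail_decay_large (R : realType) : exists c C : R, [/\ 0 < c, 0 < C &
  forall n, (64 <= trunc_log 2 n)%N ->
    #|fail_set n|%:R / 2 ^+ n.-1 <= C * expR (- (c * (n%:R / ln n%:R ^+ 4)))].
Proof.
have l2 := ln2_ge_half R; have l20 : 0 < ln 2 :> R by apply: lt_le_trans l2; lra.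
have [Q Q0 QE] : exists2 Q : R, 0 < Q & Q = 2 ^+ 40 / ln 2 ^+ 4.
  by eexists; last by []; rewrite divr_gt0 ?exprn_gt0.
have Qi : 0 < Q^-1 by rewrite invr_gt0.
have a1 : 0 < (3 / 4 : R) < 1 by lra.
have a2 : 0 < (7 / 8 : R) < 1 by lra.
have a3 : 0 < (2^-1 : R) < 1 by lra.
have q4 : 0 < 4^-1 :> R by lra.
have q2 : 0 < 2^-1 :> R by lra.
have [c1 [C1 [c10 C10 H1]]] := pow_absorb 2 a1 Qi.
have [c2 [C2 [c20 C20 H2]]] := pow_absorb 2 a2 q4.
have [c3 [C3 [c30 C30 H3]]] := pow_absorb 1 a3 q2.
pose c := Num.min c1 (Num.min c2 c3).
have c0 : 0 < c by rewrite !lt_min c10 c20.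
(* From [(dob_q2 l + 1) * (n + 1) <= Q * x ^ 4 * (2 * expR x)] and [x ^ 4 <= 4 ^ 4 * expR x]: the
   prefactor of the shared-root bound is at most [K * n ^ 2]. *)
pose K : R := 2 * (Q * 4 ^+ 4).
have K0 : 0 < K.
  rewrite /K mulr_gt0 // mulr_gt0 //.
  by rewrite exprn_gt0.
exists c, (K * C1 + C2 + C3); split => //.
  by rewrite !addr_gt0 ?mulr_gt0.
move=> n T64; have n0 : (0 < n)%N by rewrite lt0n; apply: contraTneq T64 => ->; rewrite trunc_log0.
set x := ln n%:R; have nx : n%:R = expR x by rewrite lnK // posrE ltr0n.
have Tx : (trunc_log 2 n)%:R * ln 2 <= x.
  rewrite -ler_expR -nx expRM_natl lnK ?posrE // -natrX ler_nat.
  by have /andP[] := trunc_log_bounds (isT : (1 < 2)%N) n0.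
have x1 : 1 <= x.
  apply: le_trans Tx; have : 64%:R <= (trunc_log 2 n)%:R :> R by rewrite ler_nat.
  by move=> t64; have := ler_pM (ler0n _ _) (ltW q2) t64 l2; lra.
have x0 : 0 < x by apply: lt_le_trans x1.
rewrite nx; set y := expR x / x ^+ 4.
have y0 : 0 <= y by rewrite divr_ge0 ?expR_ge0 ?exprn_ge0 // ltW.
have yn : y <= expR x.
  by rewrite ler_pdivrMr ?exprn_gt0 // ler_peMr ?expR_ge0 // exprn_ege1.
have pw : 0 < 2 ^+ n.-1 :> R by rewrite exprn_gt0.
have mono c' C' : 0 < C' -> c <= c' -> C' * expR (- (c' * y)) <= C' * expR (- (c * y)).
  by move=> ? cc; rewrite ler_pM2l // ler_expR lerN2 ler_wpM2r.
have [l [l4 nl dn qT]] := dob_level T64.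
have qx : (dob_q2 l).*2%:R <= Q * x ^+ 4.
  apply: le_trans (_ : 2 ^+ 40 * (trunc_log 2 n)%:R ^+ 4 <= _).
    by rewrite -!natrX -natrM ler_nat.
  rewrite QE -[leRHS]mulrA ler_pM2l ?exprn_gt0 // mulrC ler_pdivlMr ?exprn_gt0 //.
  rewrite -exprMn; apply: lerXn2r; rewrite ?nnegrE ?(ltW x0) ?mulr_ge0 ?ler0n ?(ltW l20) //.
move: {QE} qT qx => _ qx.
have qp : (0 < dob_q2 l)%N by apply: dob_q2_gt0; apply: leq_trans l4.
have qp2 : (0 < (dob_q2 l).*2)%N by rewrite double_gt0.
have qR : 0 < (dob_q2 l).*2%:R :> R by rewrite ltr0n.
have n2 : (2 <= n)%N by apply: leq_trans dn; apply: dob_k_gt1.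
have B1 := card_shared_root R l4 nl dn.
have B2 := card_nonrec_split R n.
have B3 := card_palindromic R n0.
have F := card_fail_set_le n0; rewrite -(ler_nat R) in F.
move: F B1 B2 B3; rewrite !natrD.
set A := (#|_|%:R); set b1 := (#|_|%:R); set b2 := (#|_|%:R); set b3 := (#|_|%:R).
move=> F B1 B2 B3.
have e2x : expR (2 * x) = n%:R ^+ 2 by rewrite expRM_natl nx.
have D1 : b1 <= K * C1 * expR (- (c * y)) * 2 ^+ n.-1.
  apply: le_trans B1 _; rewrite -mulrA [2 ^+ n.-1 * _]mulrC mulrA ler_pM2r //.
  apply: le_trans (mono c1 _ _ _); rewrite ?mulr_gt0 ?ge_min ?lexx //.
  rewrite -[leRHS]mulrA.
  (* The 2 pays for the floor and for the passage from [n] to [n - 2]. *)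
  have h : Q^-1 * y - 2 <= ((n - 2) %/ (dob_q2 l).*2)%:R.
    apply: le_trans (divn_ge R _ qp2).
    have : Q^-1 * y <= n%:R / (dob_q2 l).*2%:R.
      rewrite nx /y mulrCA ler_pM2l ?expR_gt0 // -invfM lef_pV2 ?posrE ?mulr_gt0 ?exprn_gt0 //.
    have -> : n%:R / (dob_q2 l).*2%:R = (n - 2)%N%:R / (dob_q2 l).*2%:R + 2 / (dob_q2 l).*2%:R :> R.
      by rewrite -mulrDl -natrD subnK.
    have : 2 / (dob_q2 l).*2%:R <= 1 :> R.
      by rewrite ler_pdivrMr // mul1r ler_nat (leq_double 1).
    move: (2 / _) => w; lra.
  have := H1 x _ x0 h; set w := _ ^+ _ => hw.
  apply: le_trans (ler_wpM2l (ltW K0) hw); rewrite mulrA ler_wpM2r ?exprn_ge0 //; first lra.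
  have x4 := expR_ge_pow (ltW x0) (isT : (0 < 4)%N).
  rewrite expr_div_n ler_pdivrMr ?exprn_gt0 // in x4.
  have k1 : (dob_q2 l).+1%:R <= Q * x ^+ 4.
    by apply: le_trans qx; rewrite ler_nat -addnn -addn1 leq_add2l.
  have k2 : n.+1%:R <= 2 * expR x.
    by rewrite -nx -natrM ler_nat mul2n -addnn -addn1 leq_add2l.
  apply: le_trans (ler_pM _ _ k1 k2) _; rewrite ?ler0n //.
  rewrite /K expRM_natl.
  have -> : 2 * (Q * 4 ^+ 4) * expR x ^+ 2 = Q * (expR x * 4 ^+ 4) * (2 * expR x) by ring.
  by rewrite ler_pM2r ?mulr_gt0 ?expR_gt0 // ler_pM2l.
have D2 : b2 <= C2 * expR (- (c * y)) * 2 ^+ n.-1.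
  apply: le_trans B2 _; rewrite -mulrA [2 ^+ n.-1 * _]mulrC mulrA ler_pM2r //.
  apply: le_trans (mono c2 _ _ _); rewrite ?mulr_gt0 ?ge_min ?lexx ?orbT //.
  rewrite natrX -e2x; apply: H2 => //.
  have : n%:R / 4%:R - 1 <= (n %/ 4)%:R :> R by apply: divn_ge.
  have : (n %/ 4)%:R <= (n %/ 4).-1%:R + 1 :> R by rewrite natr1 ler_nat leqSpred.
  rewrite nx -/y; lra.
have D3 : b3 <= C3 * expR (- (c * y)) * 2 ^+ n.-1.
  apply: le_trans B3 _; rewrite [2 ^+ n.-1 * _]mulrC ler_pM2r //.
  apply: le_trans (mono c3 _ _ _); rewrite ?mulr_gt0 ?ge_min ?lexx ?orbT //.
  apply: le_trans (H3 x (n.-1)./2 x0 _); last first.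
    have : n%:R <= 2 * ((n.-1)./2%:R + 1) :> R by rewrite natr1 -natrM ler_nat; clear; lia.
    rewrite nx -/y; lra.
  rewrite ler_peMl ?exprn_ge0 ?invr_ge0 ?ler0n //.
  by apply: le_trans (expR_ge1Dx _); lra.
rewrite ler_pdivrMr // !mulrDl; lra.
Qed.

Lemma card_ratio_le1 (R : realFieldType) n (A : {set {ffun 'I_n.-1 -> bool}}) :
  #|A|%:R / 2 ^+ n.-1 <= 1 :> R.
Proof.
rewrite ler_pdivrMr ?exprn_gt0 // mul1r -natrX ler_nat.
by apply: leq_trans (max_card _) _; rewrite card_ffun card_bool card_ord.
Qed.

(** Below the threshold the ratio is at most 1 and [n / (ln n) ^ 4] is at most [Y], so it is enough
    to enlarge [C] by [expR (c * Y)]. *)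
Lemma fail_decay (R : realType) : exists c C : R, [/\ 0 < c, 0 < C &
  forall n, (2 <= n)%N ->
    #|fail_set n|%:R / 2 ^+ n.-1 <= C * expR (- (c * (n%:R / ln n%:R ^+ 4)))].
Proof.
have [c [C [c0 C0 H]]] := fail_decay_large R.
have l20 : 0 < ln 2 :> R by apply: lt_le_trans (ln2_ge_half R); rewrite invr_gt0.
have [N HN] : exists N, forall n, (trunc_log 2 n < 64)%N -> (n <= N)%N.
  exists (2 ^ 64)%N => n T64; apply: ltnW.
  apply: (leq_trans (trunc_log_ltn n (isT : (1 < 2)%N))).
  by rewrite leq_exp2l.
pose Y : R := N%:R / ln 2 ^+ 4.
exists c, (C + expR (c * Y)); split => //; first by rewrite addr_gt0 ?expR_gt0.
move=> n n2; rewrite mulrDl; have [T64|T64] := leqP 64 (trunc_log 2 n).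
  apply: le_trans (H n T64) _.
  by rewrite lerDl mulr_ge0 ?expR_ge0.
apply: le_trans (card_ratio_le1 R _) _; rewrite -[leLHS]add0r; apply: lerD.
  by rewrite mulr_ge0 ?expR_ge0 // ltW.
rewrite -expRD; apply: le_trans (expR_ge1Dx _); rewrite lerDl subr_ge0 ler_pM2l // /Y.
have n0 : (0 < n)%N by apply: leq_trans n2.
have lx : ln 2 <= ln n%:R :> R by rewrite ler_ln ?posrE ?ltr0n // ler_nat.
apply: ler_pM; rewrite ?ler0n ?invr_ge0 ?exprn_ge0 ?(ltW (lt_le_trans l20 lx)) //.
  by rewrite ler_nat HN.
rewrite lef_pV2 ?posrE ?exprn_gt0 ?(lt_le_trans l20 lx) //.
by apply: lerXn2r; rewrite ?nnegrE ?(ltW l20) ?(ltW (lt_le_trans l20 lx)).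
Qed.

Lemma powR_nat_expR (R : realType) n (alpha : R) : (0 < n)%N ->
  n%:R `^ alpha = expR (alpha * ln n%:R).
Proof. by move=> n0; rewrite /powR pnatr_eq0 -[n == 0%N]negbK -lt0n n0. Qed.

(** [n / (ln n) ^ 4] dominates [n ^ alpha] because [expR u >= (u / 4) ^ 4] at
    [u = (1 - alpha) * ln n]. The case [n = 1], outside the range of [fail_decay], is paid for by
    [expR d]. *)
Lemma fail_decay_powR (R : realType) (alpha : R) : 0 < alpha -> alpha < 1 ->
  exists c C : R, [/\ 0 < c, 0 < C & forall n, (1 <= n)%N ->
    #|fail_set n|%:R / 2 ^+ n.-1 <= C * expR (- (c * n%:R `^ alpha))].
Proof.
move=> a0 a1; have [c [C [c0 C0 H]]] := fail_decay R.
have b0 : 0 < (1 - alpha) / 4 by rewrite divr_gt0 ?subr_gt0.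
pose d := c * ((1 - alpha) / 4) ^+ 4.
have d0 : 0 < d by rewrite mulr_gt0 ?exprn_gt0.
exists d, (C + expR d); split => //; first by rewrite addr_gt0 ?expR_gt0.
move=> n; rewrite leq_eqVlt => /orP[/eqP <-|n2]; rewrite mulrDl.
  apply: le_trans (card_ratio_le1 R _) _.
  rewrite powR1 mulr1 -expRD subrr expR0 lerDr mulr_ge0 ?expR_ge0 //; exact: ltW.
apply: le_trans (H n n2) _; rewrite -[leLHS]addr0.
apply: lerD; last by rewrite mulr_ge0 ?expR_ge0.
have n0 : (0 < n)%N by apply: leq_trans n2.
rewrite ler_pM2l // ler_expR lerN2 powR_nat_expR //.
set x := ln n%:R; have nx : n%:R = expR x by rewrite lnK // posrE ltr0n.
have x0 : 0 < x by rewrite ln_gt0 // ltr1n.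
rewrite /d -mulrA ler_pM2l // nx ler_pdivlMr ?exprn_gt0 //.
have -> : expR x = expR ((1 - alpha) * x) * expR (alpha * x).
  by rewrite -expRD; congr expR; ring.
rewrite mulrAC ler_pM2r ?expR_gt0 //.
have := @expR_ge_pow R ((1 - alpha) * x) 4 _ isT; rewrite mulr_ge0 ?subr_ge0 ?(ltW a1) ?(ltW x0) // => /(_ isT).
by rewrite -exprMn mulrAC.
Qed.

Definition big_cyclotomic_set n T : {set {ffun 'I_n.-1 -> bool}} :=
  [set p | `[< exists Phi I, [/\ newman_poly p = Phi * I,
    is_cyclotomic_product Phi & (T <= (size Phi).-1)%N] >]].

(** The prefactor is at most [4 * 3 ^ 8 * n ^ 17], from [n + 1 <= 2 * n],
    [2 * n ^ 2 + 1 <= 3 * n ^ 2] and [2 ^ n = 2 * 2 ^ n.-1]. Half of the decay absorbs it, since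
    [n ^ alpha] is at least [(alpha / 2) ^ 2 * (ln n) ^ 2]. *)
Lemma big_cyclotomic_decay (R : realType) (alpha : R) : 0 < alpha ->
  exists c C : R, [/\ 0 < c, 0 < C & forall n, (1 <= n)%N ->
    #|big_cyclotomic_set n (Num.truncn (n%:R `^ alpha))|%:R / 2 ^+ n.-1 <=
      C * expR (- (c * n%:R `^ alpha))].
Proof.
move=> a0; have a1 : 0 < (3 / 4 : R) < 1 by lra.
have d0 : 0 < - ln (3 / 4) :> R by rewrite oppr_gt0 ln_lt0.
set d := - ln _ in d0.
pose v := d / 2 * (alpha / 2) ^+ 2.
have v0 : 0 < v by rewrite mulr_gt0 ?exprn_gt0 ?divr_gt0.
pose K : R := 4 * 3 ^+ 8; have K0 : 0 < K by rewrite mulr_gt0 ?exprn_gt0.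
exists (d / 2), (K * expR (d * 1 + 17 ^+ 2 / v)); split; first by rewrite divr_gt0.
  by rewrite mulr_gt0 ?expR_gt0.
move=> n n0; set t := _ `^ _; set T := Num.truncn t.
have pw : 0 < 2 ^+ n.-1 :> R by rewrite exprn_gt0.
set x : R := ln n%:R; have nx : n%:R = expR x by rewrite lnK // posrE ltr0n.
have tE : t = expR (alpha * x) by rewrite /t powR_nat_expR.
have x0 : 0 <= x by rewrite ln_ge0 // ler1n.
have tx : (alpha / 2) ^+ 2 * x ^+ 2 <= t.
  have := @expR_ge_pow R (alpha * x) 2 _ isT; rewrite tE -exprMn mulrAC; apply.
  by rewrite mulr_ge0 // ltW.
have hT : t - 1 <= T%:R.
  have t0 : 0 <= t by rewrite tE expR_ge0.
  by rewrite lerBlDr natr1 ltW //; have /andP[] := truncn_itv t0.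
rewrite ler_pdivrMr //; apply: le_trans (card_cyclotomic_part R T n0) _.
have -> : 2 ^+ n = 2 * 2 ^+ n.-1 :> R by rewrite -exprS prednK.
have k1 : n.+1%:R <= 2 * expR x.
  by rewrite -nx -natrM ler_nat mul2n -addnn -addn1 leq_add2l.
have k2 : (2 * n ^ 2).+1%:R <= 3 * expR x ^+ 2.
  rewrite -nx -natrX -natrM ler_nat; have : (0 < n ^ 2)%N by rewrite expn_gt0 n0.
  by clear; lia.
have k3 : (2 * n ^ 2).+1%:R ^+ 8 <= (3 * expR x ^+ 2) ^+ 8.
  by apply: lerXn2r; rewrite ?nnegrE ?ler0n ?mulr_ge0 ?exprn_ge0 ?expR_ge0.
have k4 := pow_le_expR a1 hT; rewrite -/d in k4.
have -> : forall A B : R, A * B * (2 * 2 ^+ n.-1) * (3 / 4) ^+ T = 2 * (A * B * (3 / 4) ^+ T) * 2 ^+ n.-1.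
  by move=> A B; move: (2 ^+ n.-1) (_ ^+ T) => u w; ring.
rewrite ler_pM2r //.
have k5 : n.+1%:R * (2 * n ^ 2).+1%:R ^+ 8 <= 2 * expR x * (3 * expR x ^+ 2) ^+ 8 :> R.
  by apply: ler_pM; rewrite ?exprn_ge0 ?ler0n.
have k6 : n.+1%:R * (2 * n ^ 2).+1%:R ^+ 8 * (3 / 4) ^+ T <=
   2 * expR x * (3 * expR x ^+ 2) ^+ 8 * (expR (d * 1) * expR (- (d * t))).
  by apply: ler_pM k5 k4; rewrite ?mulr_ge0 ?exprn_ge0 ?divr_ge0 ?ler0n.
apply: le_trans (ler_wpM2l (ler0n R 2) k6) _.
have -> : 2 * (2 * expR x * (3 * expR x ^+ 2) ^+ 8 * (expR (d * 1) * expR (- (d * t)))) =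
  K * (expR x ^+ 17 * (expR (d * 1) * expR (- (d * t)))).
  have E (e f g : R) : 2 * (2 * e * (3 * e ^+ 2) ^+ 8 * (f * g)) = 4 * 3 ^+ 8 * (e ^+ 17 * (f * g)).
    rewrite exprMn -(exprM e) -[(2 * 8)%N]/16%N (exprSr e 16).
    move: (3 ^+ 8) (e ^+ 16) => u w; ring.
  exact: E.
rewrite -[leRHS]mulrA ler_pM2l // -expRM_natl -!expRD ler_expR.
have h1 := linear_le_quadratic 17 x v0.
have h2 : v * x ^+ 2 <= d / 2 * t by rewrite /v -mulrA ler_pM2l // divr_gt0.
move: h1 h2; move: (v * _) (17 ^+ 2 / v) => z w; clear; lra.
Qed.

Theorem theorem1p2 (R : realType) :
  (exists c C : R, [/\ 0 < c, 0 < C &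
     forall n : nat, (2 <= n)%N ->
       1 - C * expR (- (c * n%:R / ln (n%:R : R) ^+ 4))
       <= uniform_pr R (newman_polys n)
            (fun P => exists Phi I : {poly int}, good_factorization P Phi I)])
  /\
  (forall alpha : R, 0 < alpha -> alpha < 1 ->
     exists c C : R, [/\ 0 < c, 0 < C &
       forall n : nat, (1 <= n)%N ->
         1 - C * expR (- (c * n%:R `^ alpha))
         <= uniform_pr R (newman_polys n)
              (fun P => exists Phi I : {poly int},
                 good_factorization P Phi I
                 /\ (size Phi).-1%:R <= n%:R `^ alpha)]).
Proof.
split.
  have [c [C [c0 C0 H]]] := fail_decay R; exists c, C; split => // n n2.
  have n0 : (0 < n)%N by apply: leq_trans n2.
  apply: le_trans (uniform_pr_ge (bad := fail_set n) R n0 _).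
    by rewrite lerD2l lerN2 -mulrA; apply: H.
  by move=> p; rewrite inE => /asboolP/contrapT.
move=> alpha a0 a1.
have [c1 [C1 [c10 C10 H1]]] := fail_decay_powR a0 a1.
have [c2 [C2 [c20 C20 H2]]] := big_cyclotomic_decay a0.
exists (Num.min c1 c2), (C1 + C2); split; rewrite ?lt_min ?c10 ?addr_gt0 // => n n0.
set t := n%:R `^ alpha; have t0 : 0 <= t by apply: powR_ge0.
pose bad := fail_set n :|: big_cyclotomic_set n (Num.truncn t).
apply: le_trans (uniform_pr_ge (bad := bad) R n0 _).
  rewrite lerD2l lerN2 mulrDl.
  apply: le_trans (_ : #|fail_set n|%:R / 2 ^+ n.-1 +
    #|big_cyclotomic_set n (Num.truncn t)|%:R / 2 ^+ n.-1 <= _).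
    by rewrite -mulrDl ler_pM2r ?invr_gt0 ?exprn_gt0 // -natrD ler_nat leq_card_setU.
  apply: lerD; [apply: le_trans (H1 n n0) _|apply: le_trans (H2 n n0) _].
    by rewrite ler_pM2l // ler_expR lerN2 ler_wpM2r // ge_min lexx.
  by rewrite ler_pM2l // ler_expR lerN2 ler_wpM2r // ge_min lexx orbT.
(* Outside the second set no cyclotomic product dividing [P] has large degree, so the bound holds
   for the [Phi] of whichever good factorization is given. *)
move=> p; rewrite !inE negb_or => /andP[/asboolP/contrapT [Phi [I g]] /asboolP big].
exists Phi, I; split => //; have [le_t _] := andP (truncn_itv t0).
apply: le_trans le_t; rewrite ler_nat leqNgt; apply/negP => lt_T; apply: big.
by exists Phi, I; case: g => -> cyc _ _; split => //; apply: ltnW.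
Qed.
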